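(* Let $k$ be an algebraically closed field of characteristic $p$, and let $\mathfrak g$ be the $2$-dimensional abelian restricted Lie algebra over $k$ with trivial restriction, i.e. $\mathfrak g^{[p]}=0$. If $p>2$ then $\mathfrak g$ does not satisfy Property PA. In other words, there exist a finite group scheme $G$ arising from a cocommutative Hopf algebra structure on $A=u(\mathfrak g)$ (with the fixed counit), a point $\mathfrak p$ which is noble for $G$, and modules $V,W\in\mathcal C(\mathfrak p)$ such that $V\otimes W$ is not isomorphic to $V\widetilde\otimes W$. So $\mathfrak g$ does not satisfy Property PC.
   Context: **Hopf structures.** $k$ is an algebraically closed field of characteristic $p>0$. For a finite-dimensional restricted Lie algebra $\mathfrak g$ over $k$, let $A=u(\mathfrak g)$ be its restricted enveloping algebra, with the augmentation $A\to k$ killing $\mathfrak g$. $\widetilde\Delta$ denotes the comultiplication on $A$ for which all elements of $\mathfrak g$ are primitive, and $\widetilde\otimes$ the resulting tensor product of $A$-modules. We consider all cocommutative Hopf algebra structures $\Delta$ on the algebra $A$ whose counit is this fixed augmentation. Each one makes $A$ the group algebra $kG=k[G]^*$ of a finite group scheme $G$; the resulting tensor product of $A$-modules is denoted $\otimes$. **Points and support.** $\mathscr X(A)=\operatorname{Proj}H^*(A,k)$, where $H^*(A,k)=\operatorname{Ext}^*_A(k,k)$, is the space of homogeneous primes of the reduction of this graded-commutative ring; it does not depend on $\Delta$. A $\pi$-point of $G$ over a field extension $K/k$ is a flat map of $K$-algebras $\alpha_K:K[t]/t^p\to KG_K$ factoring through the group algebra of a unipotent abelian subgroup scheme of $G_K$.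 The point $\mathfrak p(\alpha_K)\in\mathscr X(A)$ is the radical of the kernel of $H^*(A,k)\to H^*(A_K,K)\to H^*(K[t]/t^p,K)$. Every point of $\mathscr X(A)$ arises this way, and two $\pi$-points are called equivalent if they give the same point. For a finite-dimensional $A$-module $M$, its support $\mathscr X(A,M)\subseteq\mathscr X(A)$ is the closed set of those $\mathfrak p(\alpha_K)$ for which $\alpha_K^*(M_K)$ is not projective; it does not depend on $\Delta$. For a closed point $\mathfrak p$, $\mathcal C(\mathfrak p)$ is the full subcategory of finite-dimensional $A$-modules $M$ with $\mathscr X(A,M)\subseteq\{\mathfrak p\}$. **Noble points.** $\mathfrak p\in\mathscr X(A)$ is noble for $G$ if $\mathfrak p=\mathfrak p(\alpha_K)$ for some $\pi$-point $\alpha_K$ of $G$ whose image is a Hopf subalgebra of $KG_K$; otherwise it is ignoble for $G$. **Properties.** - Property PA: for every finite group scheme $G$ with group algebra $kG=A$ arising from a cocommutative Hopf algebra structure $\Delta$ on $A=u(\mathfrak g)$ whose counit is the fixed augmentation $A\to k$ (with resulting tensor product $\otimes$), and every closed $\mathfrak p$ noble for $G$, $V\otimes W\cong V\widetilde\otimes W$ for all $V,W\in\mathcal C(\mathfrak p)$. - Property PB: for every finite group scheme $G$ with group algebra $kG=A$ arising from a cocommutative Hopf algebra structure $\Delta$ on $A=u(\mathfrak g)$ whose counit is the fixed augmentation $A\to k$ (with resulting tensor product $\otimes$), and every closed $\mathfrak p$ ignoble for $G$, there exist $V,W\in\mathcal C(\mathfrak p)$ with $V\otimes W\not\cong V\widetilde\otimes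 W$. - Property PC: both PA and PB. *)

(* Defs.v *)
From HB Require Import structures.
From mathcomp Require Import all_boot all_order all_algebra all_field.

Set Implicit Arguments.
Unset Strict Implicit.
Unset Printing Implicit Defensive.

Import GRing.Theory.
Local Open Scope ring_scope.

(* The matrix [X : tens U V] stands for the sum of the
   [X i j *: (e_i (x) f_j)], where [e] and [f] are the bases
   [vbasis {:U}] and [vbasis {:V}]. *)
Definition tens (F : fieldType) (U V : vectType F) : Type :=
  'M[F]_(\dim {:U}, \dim {:V}).
HB.instance Definition _ (F : fieldType) (U V : vectType F) :=
  Vector.copy (tens U V) 'M[F]_(\dim {:U}, \dim {:V}).

Section Tensor.
Variable F : fieldType.

Definition tpure (U V : vectType F) (u : U) (v : V) : tens U V :=
  \matrix_(i, j) (coord (vbasis {:U}) i u * coord (vbasis {:V}) j v).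

(* The linear map on [tens U V] induced by a bilinear map [f]. *)
Definition tlift (U V T : vectType F) (f : U -> V -> T) (X : tens U V) : T :=
  \sum_i \sum_j X i j *: f (vbasis {:U})`_i (vbasis {:V})`_j.

Definition bilin (U V T : vectType F) (f : U -> V -> T) : Prop :=
  (forall v, linear (fun u => f u v)) /\ (forall u, linear (f u)).

Lemma tlift_is_linear (U V T : vectType F) (f : U -> V -> T) :
  linear (tlift f).
Proof.
move=> c X Y; rewrite /tlift scaler_sumr -big_split; apply: eq_bigr => i _.
rewrite scaler_sumr -big_split; apply: eq_bigr => j _.
by rewrite !mxE scalerDl scalerA.
Qed.
HB.instance Definition _ (U V T : vectType F) (f : U -> V -> T) :=
  GRing.isLinear.Build F (tens U V) T _ (tlift f) (tlift_is_linear f).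

Lemma tpure_bilin (U V : vectType F) : bilin (@tpure U V).
Proof.
split=> [v c u u' | u c v v']; apply/matrixP => i j; rewrite !mxE linearP /=.
  by rewrite mulrDl mulrA.
by rewrite mulrDr mulrCA.
Qed.

Lemma bilin_sum (U V T : vectType F) (f : U -> V -> T) (m n : nat)
    (a : 'I_m -> F) (x : 'I_m -> U) (b : 'I_n -> F) (y : 'I_n -> V) :
  bilin f ->
  f (\sum_i a i *: x i) (\sum_j b j *: y j) =
  \sum_i \sum_j (a i * b j) *: f (x i) (y j).
Proof.
move=> [fl fr].
have f0 v : f 0 v = 0.
  by have /eqP := fl v 1 0 0; rewrite !scale1r addr0 -subr_eq subrr eq_sym => /eqP.
have f0r u : f u 0 = 0.
  by have /eqP := fr u 1 0 0; rewrite !scale1r addr0 -subr_eq subrr eq_sym => /eqP.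
transitivity (\sum_i a i *: f (x i) (\sum_j b j *: y j)).
  elim/big_rec2: _ => [|i u w _ <-]; first exact: f0.
  by rewrite fl.
apply: eq_bigr => i _; transitivity (a i *: \sum_j b j *: f (x i) (y j)).
  congr (_ *: _); elim/big_rec2: _ => [|j u w _ <-]; first exact: f0r.
  by rewrite fr.
by rewrite scaler_sumr; apply: eq_bigr => j _; rewrite scalerA.
Qed.

Lemma tliftE (U V T : vectType F) (f : U -> V -> T) (u : U) (v : V) :
  bilin f -> tlift f (tpure u v) = f u v.
Proof.
move=> fB; rewrite {2}(coord_vbasis (memvf u)) {2}(coord_vbasis (memvf v)).
rewrite bilin_sum // /tlift; apply: eq_bigr => i _; apply: eq_bigr => j _.
by rewrite mxE.
Qed.

Lemma tens_sumE (U V : vectType F) (X : tens U V) :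
  X = \sum_i \sum_j X i j *: tpure (vbasis {:U})`_i (vbasis {:V})`_j.
Proof.
apply/matrixP => i j; rewrite summxE (bigD1 i) //= summxE (bigD1 j) //= !mxE.
rewrite !coord_free ?(basis_free (vbasisP _)) // !eqxx !mulr1.
rewrite !big1 ?addr0 // => [i' ne|j' ne].
  rewrite summxE big1 // => j' _.
  by rewrite !mxE !coord_free ?(basis_free (vbasisP _)) // [i' == i](negPf ne) mul0r mulr0.
by rewrite !mxE !coord_free ?(basis_free (vbasisP _)) // [j' == j](negPf ne) !mulr0.
Qed.

Lemma tens_ext (U V T : vectType F) (f g : tens U V -> T) :
  linear f -> linear g ->
  (forall u v, f (tpure u v) = g (tpure u v)) -> f =1 g.
Proof.
move=> lf lg efg X.
pose f' := HB.pack_for {linear tens U V -> T} f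
  (GRing.isLinear.Build F (tens U V) T _ f lf).
pose g' := HB.pack_for {linear tens U V -> T} g
  (GRing.isLinear.Build F (tens U V) T _ g lg).
rewrite -[f X]/(f' X) -[g X]/(g' X) (tens_sumE X) !linear_sum.
apply: eq_bigr => i _; rewrite !linear_sum; apply: eq_bigr => j _.
by rewrite !linearZ /= efg.
Qed.

Definition tmap (U V U' V' : vectType F) (f : 'Hom(U, U')) (g : 'Hom(V, V')) :
    'Hom(tens U V, tens U' V') :=
  linfun (tlift (fun u v => tpure (f u) (g v))).

Lemma tmapE (U V U' V' : vectType F) (f : 'Hom(U, U')) (g : 'Hom(V, V')) u v :
  tmap f g (tpure u v) = tpure (f u) (g v).
Proof.
have [pl pr] := tpure_bilin U' V'; rewrite lfunE /= tliftE //.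
by split=> [w c x y | w c x y]; rewrite linearP ?pl ?pr.
Qed.

Definition tassoc (U V W : vectType F) :
    tens (tens U V) W -> tens U (tens V W) :=
  tlift (fun x w => tlift (fun u v => tpure u (tpure v w)) x).

Definition tswap (U V : vectType F) : tens U V -> tens V U :=
  tlift (fun u v => tpure v u).

(* The image of [S (x) S] in [V (x) V]. *)
Definition tens_sub (V : vectType F) (S : {vspace V}) : {vspace tens V V} :=
  <<[seq tpure a b | a <- vbasis S, b <- vbasis S]>>%VS.

(* The product of the algebra [A (x) A]. *)
Definition tmul (A : falgType F) (X Y : tens A A) : tens A A :=
  tlift (fun a b => tlift (fun c d => tpure (a * c) (b * d)) Y) X.

End Tensor.

Lemma tmul_bilin (F : fieldType) (A : falgType F) : bilin (@tmul F A).
Proof.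
split=> [Y | X c Y Y']; first exact: tlift_is_linear.
have E Z : tmul X Z = \sum_i \sum_j X i j *:
    tlift (fun c d : A => tpure ((vbasis {:A})`_i * c) ((vbasis {:A})`_j * d)) Z.
  by [].
rewrite !E scaler_sumr -big_split; apply: eq_bigr => i _ /=.
rewrite scaler_sumr -big_split; apply: eq_bigr => j _ /=.
by rewrite linearP scalerDr !scalerA (mulrC c).
Qed.

Lemma tmulE (F : fieldType) (A : falgType F) (a b c d : A) :
  tmul (tpure a b) (tpure c d) = tpure (a * c) (b * d).
Proof.
have [pl pr] := tpure_bilin A A; rewrite /tmul tliftE.
  by rewrite tliftE //; split=> [w e x y | w e x y];
    rewrite mulrDr -scalerAr ?pl ?pr.
split=> [v e u u' | u e v v']; rewrite /tlift scaler_sumr -big_split /=;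
  apply: eq_bigr => i _; rewrite scaler_sumr -big_split /=;
  apply: eq_bigr => j _; rewrite mulrDl -scalerAl ?pl ?pr scalerDr;
  by rewrite !scalerA (mulrC e).
Qed.

(* [lie_word br x y w] is [ [z_1, [z_2, ... [z_n, x]]] ] where [z_i] is [x] or
   [y] according to whether the [i]-th letter of [w] is [true] or [false]. *)
Definition lie_word (T : Type) (br : T -> T -> T) (x y : T) (w : seq bool) : T :=
  foldr (fun b z => br (if b then x else y) z) x w.

(* Jacobson's polynomial [s_i]: the product [i * s_i(x, y)] is the coefficient
   of [t ^ (i - 1)] in [ad(t x + y) ^ (p - 1) (x)]. *)
Definition jacobson (k : fieldType) (g : lmodType k) (br : g -> g -> g)
    (p i : nat) (x y : g) : g :=
  (i%:R : k)^-1 *: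
    \sum_(w : (p.-1).-tuple bool | count id w == i.-1) lie_word br x y w.

Record restrictedLie (k : fieldType) (p : nat) := RestrictedLie {
  lie_sort :> vectType k;
  lie_br : lie_sort -> lie_sort -> lie_sort;
  lie_pmap : lie_sort -> lie_sort;
  lie_br_bilin : bilin lie_br;
  lie_br_alt : forall x, lie_br x x = 0;
  lie_jacobi : forall x y z,
    lie_br x (lie_br y z) + lie_br y (lie_br z x) + lie_br z (lie_br x y) = 0;
  lie_pmapZ : forall (c : k) x, lie_pmap (c *: x) = c ^+ p *: lie_pmap x;
  lie_pmap_ad : forall x y, lie_br (lie_pmap x) y = iter p (lie_br x) y;
  lie_pmapD : forall x y, lie_pmap (x + y) =
    lie_pmap x + lie_pmap y + \sum_(1 <= i < p) jacobson lie_br p i x y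
}.

(* A finite group scheme [G] with group algebra [kG = A], that is, a
   cocommutative Hopf algebra structure on the algebra [A] with counit [eps]. *)
Record group_scheme (k : fieldType) (A : falgType k)
    (eps : {lrmorphism A -> k^o}) := GroupScheme {
  comul : 'Hom(A, tens A A);
  antipode : 'End(A);
  comul1 : comul 1 = tpure 1 1;
  comulM : forall a b, comul (a * b) = tmul (comul a) (comul b);
  comulA : forall a,
    tassoc (tmap comul \1%VF (comul a)) = tmap \1%VF comul (comul a);
  counitl : forall a, tlift (fun x y : A => eps x *: y) (comul a) = a;
  counitr : forall a, tlift (fun x y : A => eps y *: x) (comul a) = a;
  antipodel : forall a,
    tlift (fun x y : A => antipode x * y) (comul a) = eps a *: 1;
  antipoder : forall a,
    tlift (fun x y : A => x * antipode y) (comul a) = eps a *: 1;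
  comulC : forall a, tswap (comul a) = comul a
}.

(* The group algebras of the closed subgroup schemes of [G] are the Hopf
   subalgebras of [kG]. *)
Definition hopf_subalgebra (k : fieldType) (A : falgType k)
    (eps : {lrmorphism A -> k^o}) (G : group_scheme eps) (S : {vspace A}) : Prop :=
  [/\ 1 \in S,
      forall a b, a \in S -> b \in S -> a * b \in S,
      forall a, a \in S -> comul G a \in tens_sub S &
      forall a, a \in S -> antipode G a \in S].

Definition abelian_subgroup (k : fieldType) (A : falgType k) (S : {vspace A}) :
    Prop :=
  forall a b, a \in S -> b \in S -> a * b = b * a.

(* Every nonzero finite-dimensional representation of the subgroup scheme with
   group algebra [S] has a nonzero fixed vector. Representations [rho] of [S]
   are given with an arbitrary linear extension to [A], which plays no role. *)
Definition unipotent_subgroup (k : fieldType) (A : falgType k)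
    (eps : {lrmorphism A -> k^o}) (S : {vspace A}) : Prop :=
  forall (M : vectType k) (rho : {linear A -> 'End(M)}),
    (exists m : M, m != 0) ->
    rho 1 = \1%VF ->
    (forall a b, a \in S -> b \in S -> rho (a * b) = (rho a \o rho b)%VF) ->
    exists2 m : M, m != 0 & forall a, a \in S -> rho a m = (eps a : k) *: m.

(* [u(g)] is given by its universal property. The augmentation kills [g] and
   the Hopf algebra structure [env_std] makes the elements of [g] primitive;
   both are uniquely determined since [g] generates [u(g)]. *)
Record envelope (k : fieldType) (p : nat) (g : restrictedLie k p) := Envelope {
  env_alg :> falgType k;
  env_in : {linear g -> env_alg};
  env_in_br : forall x y, env_in (lie_br x y) =
    env_in x * env_in y - env_in y * env_in x;
  env_in_pmap : forall x, env_in (lie_pmap x) = env_in x ^+ p;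
  env_ex : forall (B : algType k) (f : {linear g -> B}),
    (forall x y, f (lie_br x y) = f x * f y - f y * f x) ->
    (forall x, f (lie_pmap x) = f x ^+ p) ->
    exists h : {lrmorphism env_alg -> B}, forall x, h (env_in x) = f x;
  env_uniq : forall (B : algType k) (h h' : {lrmorphism env_alg -> B}),
    (forall x, h (env_in x) = h' (env_in x)) -> h =1 h';
  env_eps : {lrmorphism env_alg -> k^o};
  env_eps_in : forall x, env_eps (env_in x) = 0;
  env_std : group_scheme env_eps;
  env_std_prim : forall x,
    comul env_std (env_in x) = tpure (env_in x) 1 + tpure 1 (env_in x)
}.

Record module (k : fieldType) (A : algType k) := Module {
  mod_sort :> vectType k;
  mod_act : A -> 'End(mod_sort);
  mod_act_linear : linear mod_act;
  mod_act1 : mod_act 1 = \1%VF;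
  mod_actM : forall a b, mod_act (a * b) = (mod_act a \o mod_act b)%VF
}.

Section Modules.
Variables (k : fieldType) (A : algType k).

Definition mod_hom (M N : module A) (f : 'Hom(M, N)) : Prop :=
  forall a m, f (mod_act M a m) = mod_act N a (f m).

Definition mod_iso (M N : module A) : Prop :=
  exists f : 'Hom(M, N), mod_hom f /\ bijective f.

Definition projective (P : module A) : Prop :=
  forall (M N : module A) (q : 'Hom(M, N)) (f : 'Hom(P, N)),
    mod_hom q -> mod_hom f -> (forall n, exists m, q m = n) ->
    exists f' : 'Hom(P, M), mod_hom f' /\ forall x, q (f' x) = f x.

(* For commutative [A], the kernel of the quotient map from [M (x) N] over [k]
   to [M (x) N] over [A]. *)
Definition balanced (M N : module A) (X : tens M N) : Prop :=
  exists s : seq (M * A * N),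
    X = \sum_(r <- s) (tpure (mod_act M r.1.2 r.1.1) r.2 - tpure r.1.1 (mod_act N r.1.2 r.2)).

(* For commutative finite-dimensional [A]: tensoring over [A] with [M]
   preserves injections. *)
Definition flat (M : module A) : Prop :=
  forall (N' N : module A) (f : 'Hom(N', N)), mod_hom f -> injective f ->
  forall X : tens N' M,
    balanced (M := N) (N := M) (tmap f \1%VF X) -> balanced (M := N') (N := M) X.

Variables (B : algType k) (h : {lrmorphism A -> B}).

Program Definition mod_pullback (M : module B) : module A :=
  @Module k A M (fun a => mod_act M (h a)) _ _ _.
Next Obligation. by move=> M c a b; rewrite /= linearP mod_act_linear. Qed.
Next Obligation. by move=> M; rewrite /= rmorph1 mod_act1. Qed.
Next Obligation. by move=> M a b; rewrite /= rmorphM mod_actM. Qed.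

End Modules.

Program Definition mod_regular (k : fieldType) (A : falgType k) : module A :=
  @Module k A A (fun a => amull a) _ _ _.
Next Obligation. by move=> k A c a b; rewrite /= linearP. Qed.
Next Obligation. by move=> k A; rewrite /= amull1. Qed.
Next Obligation.
by move=> k A a b; apply/lfunP => x; rewrite comp_lfunE !lfunE /= mulrA.
Qed.

Section TensorModule.
Variables (k : fieldType) (A : falgType k) (eps : {lrmorphism A -> k^o}).
Variables (G : group_scheme eps) (V W : module A).

Definition tens_act2 (X : tens A A) : 'End(tens V W) :=
  tlift (fun a b => tmap (mod_act V a) (mod_act W b)) X.

Lemma tens_act2_bilin :
  bilin (fun a b => tmap (mod_act V a) (mod_act W b) : 'End(tens V W)).
Proof.
have [pl pr] := tpure_bilin V W.
have linE (h : 'End(tens V W)) : linear h by move=> c x y; rewrite linearP.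
split=> [b c a a' | a c b b']; apply/lfunP;
  apply: (tens_ext (linE _) (linE _)) => v w;
  rewrite add_lfunE scale_lfunE !tmapE mod_act_linear add_lfunE scale_lfunE;
  by rewrite ?pl ?pr.
Qed.

Lemma tens_act2E a b : tens_act2 (tpure a b) = tmap (mod_act V a) (mod_act W b).
Proof. by rewrite /tens_act2 tliftE //; apply: tens_act2_bilin. Qed.

Lemma tens_act2M X Y : tens_act2 (tmul X Y) = (tens_act2 X \o tens_act2 Y)%VF.
Proof.
move: X; apply: tens_ext => [c X X'|c X X'|a b].
- by rewrite (tmul_bilin A).1 /tens_act2 linearP.
- by rewrite /tens_act2 linearP /= comp_lfunDl comp_lfunZl.
move: Y; apply: tens_ext => [c Y Y'|c Y Y'|a' b'].
- by rewrite (tmul_bilin A).2 /tens_act2 linearP.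
- by rewrite /tens_act2 linearP /= comp_lfunDr comp_lfunZr.
rewrite tmulE !tens_act2E; apply/lfunP; apply: tens_ext => [c x y|c x y|v w].
- by rewrite linearP.
- by rewrite linearP.
by rewrite comp_lfunE !tmapE !mod_actM !comp_lfunE.
Qed.

Program Definition mod_tens : module A :=
  @Module k A (tens V W) (fun a => tens_act2 (comul G a)) _ _ _.
Next Obligation. by move=> c a b; rewrite /= linearP /tens_act2 linearP. Qed.
Next Obligation.
rewrite /= comul1 tens_act2E !mod_act1; apply/lfunP.
apply: tens_ext => [c x y|c x y|v w]; rewrite ?linearP //.
by rewrite tmapE !id_lfunE.
Qed.
Next Obligation. by move=> a b; rewrite /= comulM tens_act2M. Qed.

End TensorModule.

(* [H^*(A, k) = Ext_A^*(k, k)] is computed by the bar complex. A cochain of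
   degree [n] is a function [f : seq A -> k] of which only the values on
   sequences of length [n] are relevant, and which is multilinear there. The
   Yoneda product on [Ext] is, up to sign, the cup product below. *)
Section Bar.
Variables (k : fieldType) (A : algType k) (eps : A -> k).
Implicit Types (f g : seq A -> k) (s : seq A).

Definition cochain (n : nat) f : Prop :=
  forall s s' (c : k) (a b : A), (size s + (size s').+1)%N = n ->
    f (s ++ (c *: a + b) :: s') = c * f (s ++ a :: s') + f (s ++ b :: s').

Definition bar_merge (i : nat) s : seq A :=
  take i s ++ (s`_i * s`_i.+1) :: drop i.+2 s.

Definition bar_diff f s : k :=
  let n := (size s).-1 in
  eps (head 0 s) * f (behead s)
  + \sum_(i < n) (-1) ^+ i.+1 * f (bar_merge i s)
  + (-1) ^+ n.+1 * (f (take n s) * eps (last 0 s)).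

Definition cocycle (n : nat) f : Prop :=
  cochain n f /\ forall s, size s = n.+1 -> bar_diff f s = 0.

Definition coboundary (n : nat) f : Prop :=
  if n is m.+1 then
    exists2 g, cochain m g & forall s, size s = n -> f s = bar_diff g s
  else f [::] = 0.

(* The product of [f], of degree [n], with [g]. *)
Definition cup (n : nat) f g s : k := f (take n s) * g (drop n s).

(* The [m]-th power of [f], of degree [n]. *)
Definition cupX (n : nat) f (m : nat) : seq A -> k :=
  iter m (cup n f) (fun=> 1).

(* [P n] is the set of cocycles of degree [n] whose class lies in a given
   homogeneous ideal of [H^*(A, k)]. The points of [Proj H^*(A, k)] are the
   homogeneous prime ideals that do not contain all elements of positive
   degree. They contain all the nilpotent elements, and primality of a
   homogeneous ideal may be tested on homogeneous elements. *)
Record proj_point (P : nat -> (seq A -> k) -> Prop) : Prop := ProjPoint {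
  pt_cocycle : forall n f, P n f -> cocycle n f;
  pt_coboundary : forall n f, coboundary n f -> P n f;
  pt_add : forall n f g h, P n f -> P n g ->
    (forall s, size s = n -> h s = f s + g s) -> P n h;
  pt_mull : forall m n f g, cocycle m f -> P n g -> P (m + n)%N (cup m f g);
  pt_mulr : forall m n f g, P m f -> cocycle n g -> P (m + n)%N (cup m f g);
  pt_prime : forall m n f g, cocycle m f -> cocycle n g ->
    P (m + n)%N (cup m f g) -> P m f \/ P n g;
  pt_relevant : exists n f, [/\ (0 < n)%N, cocycle n f & ~ P n f]
}.

Definition same_point (P Q : nat -> (seq A -> k) -> Prop) : Prop :=
  forall n f, P n f <-> Q n f.

Definition closed_point (P : nat -> (seq A -> k) -> Prop) : Prop :=
  proj_point P /\
  forall Q, proj_point Q -> (forall n f, P n f -> Q n f) -> same_point Q P.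

End Bar.

(* A field extension [K/k] with the group scheme [G_K]. The [K]-algebra
   [K (x) A] is characterised, up to unique isomorphism, as a [K]-algebra with a
   [k]-algebra map from [A] sending a [k]-basis to a [K]-basis. *)
Record extension (k : fieldType) (A : falgType k) (eps : {lrmorphism A -> k^o})
    (G : group_scheme eps) := Extension {
  ext_field : fieldType;
  ext_in : {rmorphism k -> ext_field};
  ext_alg : falgType ext_field;
  ext_map : {lrmorphism A -> ext_alg | ext_in \; *:%R};
  ext_basis : basis_of {:ext_alg} (map ext_map (vbasis {:A}));
  ext_eps : {lrmorphism ext_alg -> ext_field^o};
  ext_eps_map : forall a, ext_eps (ext_map a) = ext_in (eps a);
  ext_gs : group_scheme ext_eps;
  ext_comul : forall a, comul ext_gs (ext_map a) =
    \sum_i \sum_j ext_in (comul G a i j) *: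
      tpure (ext_map (vbasis {:A})`_i) (ext_map (vbasis {:A})`_j);
  ext_antipode : forall a,
    antipode ext_gs (ext_map a) = ext_map (antipode G a)
}.

(* The base change of a module [M], characterised in the same way. *)
Record mod_extension (k : fieldType) (A : falgType k)
    (eps : {lrmorphism A -> k^o}) (G : group_scheme eps) (E : extension G)
    (M : module A) := ModExtension {
  mext :> module (ext_alg E);
  mext_map : {linear M -> mext | ext_in E \; *:%R};
  mext_basis : basis_of {:mext} (map mext_map (vbasis {:M}));
  mext_act : forall a m, mext_map (mod_act M a m) = mod_act mext (ext_map E a) (mext_map m)
}.

(* [K[t]/t^p], for [p >= 2]. *)
Notation trunc_poly K p := {poly %/ ('X^p : {poly K})}.

Definition trunc_eps (K : fieldType) (p : nat) (q : trunc_poly K p) : K :=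
  (q : {poly K})`_0.

Section PiPoints.
Variables (p : nat) (k : fieldType) (A : falgType k).
Variables (eps : {lrmorphism A -> k^o}) (G : group_scheme eps).

Record pi_point := PiPoint {
  pi_ext :> extension G;
  pi_map : {lrmorphism trunc_poly (ext_field pi_ext) p -> ext_alg pi_ext};
  pi_flat : flat (mod_pullback pi_map (mod_regular (ext_alg pi_ext)));
  pi_unip : exists S : {vspace ext_alg pi_ext},
    [/\ hopf_subalgebra (ext_gs pi_ext) S,
        abelian_subgroup S,
        unipotent_subgroup (ext_eps pi_ext) S &
        (limg (linfun pi_map) <= S)%VS]
}.

(* The class of the cocycle [f] of degree [n] is in the kernel of
   [H^*(A, k) -> H^*(A_K, K) -> H^*(K[t]/t^p, K)]; here [F] is the
   [K]-multilinear extension of [f]. *)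
Definition pi_kernel (alpha : pi_point) (n : nat) (f : seq A -> k) : Prop :=
  exists F : seq (ext_alg alpha) -> ext_field alpha,
    [/\ cochain n F,
        forall s, size s = n -> F (map (ext_map alpha) s) = ext_in alpha (f s) &
        coboundary (@trunc_eps _ p) n (fun s => F (map (pi_map alpha) s))].

(* The point [p(alpha)]: the radical of the kernel, in degree [n]. *)
Definition pi_ideal (alpha : pi_point) (n : nat) (f : seq A -> k) : Prop :=
  cocycle eps n f /\ exists m, pi_kernel alpha (m * n) (cupX n f m).

Definition in_support (M : module A) (P : nat -> (seq A -> k) -> Prop) : Prop :=
  exists alpha : pi_point, same_point P (pi_ideal alpha) /\
    exists MK : mod_extension alpha M,
      ~ projective (mod_pullback (pi_map alpha) MK).

(* [M] is an object of the category [C(P)]. *)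
Definition supported_at (P : nat -> (seq A -> k) -> Prop) (M : module A) : Prop :=
  forall Q, in_support M Q -> same_point Q P.

Definition noble (P : nat -> (seq A -> k) -> Prop) : Prop :=
  exists alpha : pi_point, same_point P (pi_ideal alpha) /\
    hopf_subalgebra (ext_gs alpha) (limg (linfun (pi_map alpha))).

End PiPoints.

Section Properties.
Variables (k : fieldType) (p : nat) (g : restrictedLie k p) (A : envelope g).

Definition same_tens (G : group_scheme (env_eps A)) (V W : module A) : Prop :=
  mod_iso (mod_tens G V W) (mod_tens (env_std A) V W).

Definition property_PA : Prop :=
  forall (G : group_scheme (env_eps A)) P,
    closed_point (env_eps A) P -> noble p G P ->
    forall V W : module A, supported_at p G P V -> supported_at p G P W ->
    same_tens G V W.

Definition property_PB : Prop :=
  forall (G : group_scheme (env_eps A)) P,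
    closed_point (env_eps A) P -> ~ noble p G P ->
    exists V W : module A,
      [/\ supported_at p G P V, supported_at p G P W & ~ same_tens G V W].

Definition property_PC : Prop := property_PA /\ property_PB.

End Properties.

(* Main.v *)
Require Import Defs.
From HB Require Import structures.
From mathcomp Require Import all_boot all_order all_algebra all_field.
From mathcomp Require Import ring.

Set Implicit Arguments.
Unset Strict Implicit.
Unset Printing Implicit Defensive.

Import GRing.Theory.
Local Open Scope ring_scope.

(* Transport the standard Hopf structure of [A = k[x, y]/(x^p, y^p)] by the
   automorphism [x |-> x - y^2/2, y |-> y]. In the new structure the element
   [X = x - y^2/2] is primitive, so the point of the pi-point [t |-> X] is noble;
   as [p > 2], the elements [x] and [X] define the same point. On [V = A/(x)]
   the standard [x] acts on [V (x) V] as [0], the new one as [y (x) y].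

   The cohomological input is the value of a cocycle on the cycles
   [u^(p-1) | u | ... | u^(p-1) | u] of the bar complex, for [u^p = 0]: it decides
   whether the restriction of the cocycle to [K[t]/t^p] along [t |-> u] is a
   coboundary, and in even degree it depends on [u] only through its linear part
   when that part is a multiple of [X]. Both facts come from explicit homotopies
   between chain maps to the bar resolution. *)

(** * Cochains of the bar complex *)

(** The constant 1/2 comes from the coproduct: for primitive [y], that of [y^2/2] is
    [y^2/2 (x) 1 + 1 (x) y^2/2 + y (x) y], and the cross term is what separates the two tensor
    products. Evaluation at one cycle replaces it: in even degrees it is multiplicative with values
    in a field, and odd classes square to zero on it, so the ideal of a pi-point consists of the odd
    cocycles and of the even ones of value zero. An arbitrary pi-point sends [t] to some
    [u = X c1 + y c2]. If [c2] is a unit, [u] acts on [V] as [y] times a unit and [V] restricts to a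
    free module of rank one. Otherwise flatness forces [c1] to be a unit, and the value at [u] is a
    nonzero multiple of the value at [X], so the point is the noble one. *)

Section Multilinear.
Variables (k : fieldType) (A : lmodType k).

(** Peeling off the first argument makes induction on the degree possible. Values in a module [V]
    cover scalar cochains and algebra-valued comparison maps alike. *)
Fixpoint multilinear (V : lmodType k) (n : nat) (f : seq A -> V) : Prop :=
  if n is n'.+1 then
    (forall c a b s, size s = n' ->
       f ((c *: a + b) :: s) = c *: f (a :: s) + f (b :: s)) /\
    (forall a, multilinear n' (fun s => f (a :: s)))
  else True.

Lemma multilinear_ext (V : lmodType k) n (f g : seq A -> V) :
  (forall s, size s = n -> f s = g s) -> multilinear n f -> multilinear n g.
Proof.
elim: n f g => //= n IH f g efg [fl fm]; split=> [c a b s ss|a].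
  by rewrite -!efg /= ?ss // fl.
by apply: IH (fm a) => s ss; apply: efg; rewrite /= ss.
Qed.

Lemma multilinear_cst0 (V : lmodType k) n : multilinear n (fun=> 0 : V).
Proof. by elim: n => //= n IH; split=> [c a b s _|//]; rewrite scaler0 addr0. Qed.

Lemma multilinear_lincomb (V : lmodType k) n (f g : seq A -> V) c :
  multilinear n f -> multilinear n g -> multilinear n (fun s => c *: f s + g s).
Proof.
elim: n f g => //= n IH f g [fl fm] [gl gm]; split=> [e a b s ss|a].
  by rewrite fl // gl // !scalerDr !scalerA mulrC addrACA.
exact: IH.
Qed.

Lemma multilinear_sumf (V : lmodType k) n (I : Type) (r : seq I) (c : I -> k)
    (f : I -> seq A -> V) :
  (forall i, multilinear n (f i)) ->
  multilinear n (fun s => \sum_(i <- r) c i *: f i s).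
Proof.
elim: n f => //= n IH f fm; split=> [e a b s ss|a].
  rewrite scaler_sumr -big_split; apply: eq_bigr => i _ /=.
  by rewrite (fm i).1 // scalerDr !scalerA mulrC.
by apply: IH => i; apply: (fm i).2.
Qed.

Lemma multilinear_comp (V W : lmodType k) n (f : seq A -> V) (h : V -> W) :
  linear h -> multilinear n f -> multilinear n (fun s => h (f s)).
Proof.
move=> hl; elim: n f => //= n IH f [fl fm]; split=> [e a b s ss|a].
  by rewrite fl // hl.
exact: IH.
Qed.

Lemma multilinear_eq0 (V : lmodType k) n (f : seq A -> V) s :
  multilinear n f -> size s = n -> 0 \in s -> f s = 0.
Proof.
elim: n f s => [|n IH] f [|a s] //= [fl fm] [ss]; rewrite inE => /orP[/eqP<-|s0].
  by have := fl (-1) 0 0 s ss; rewrite scaler0 add0r scaleN1r addNr.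
exact: (IH (fun s => f (a :: s))).
Qed.

Lemma multilinear_0 (V : lmodType k) n (f : seq A -> V) s :
  multilinear n.+1 f -> size s = n -> f (0 :: s) = 0.
Proof. by move=> fm ss; apply: (multilinear_eq0 fm); rewrite /= ?ss // mem_head. Qed.

Lemma multilinear_cons (V : lmodType k) n (f : seq A -> V) a :
  multilinear n.+1 f -> multilinear n (fun s => f (a :: s)).
Proof. by case=> _; apply. Qed.

Lemma multilinear_opp (V : lmodType k) n (f : seq A -> V) s a :
  multilinear n.+1 f -> size s = n -> f (- a :: s) = - f (a :: s).
Proof.
move=> fm ss; have [fl _] := fm; have := fl (-1) a 0 s ss.
rewrite scaleN1r addr0 => ->; rewrite scaleN1r.
by rewrite (multilinear_0 fm) ?addr0.
Qed.

Lemma multilinear_add (V : lmodType k) n (f : seq A -> V) s a b :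
  multilinear n.+1 f -> size s = n ->
  f (a + b :: s) = f (a :: s) + f (b :: s).
Proof. by move=> [fl _] ss; have := fl 1 a b s ss; rewrite !scale1r. Qed.

Lemma multilinear_sum (V : lmodType k) n (f : seq A -> V) s (I : Type)
    (r : seq I) (c : I -> k) (e : I -> A) :
  multilinear n.+1 f -> size s = n ->
  f (\sum_(i <- r) c i *: e i :: s) = \sum_(i <- r) c i *: f (e i :: s).
Proof.
move=> fm ss; have [fl _] := fm; elim: r => [|i r IH].
  by rewrite !big_nil (multilinear_0 fm).
by rewrite !big_cons fl // IH.
Qed.

End Multilinear.

Section Bar.
Variables (k : fieldType) (A : algType k) (eps : A -> k).
Implicit Types (f g : seq A -> k) (s r : seq A).

Lemma cochainP n f : cochain n f <-> multilinear (V := k^o) n f.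
Proof.
split.
  elim: n f => //= n IH f fc; split=> [c a b s ss|a].
    by rewrite -[LHS]/(f ([::] ++ _ :: s)) fc //= add0n ss.
  by apply: IH => s s' c x y ss; rewrite -!cat_cons fc //= addSn ss.
elim: n f => [|n IH] f /=; first by move=> _ [|x s] s' c a b //=; rewrite ?addnS.
move=> [fl fm] [|x s] s' c a b /=; first by rewrite add0n => -[/fl]; apply.
by move=> [ss]; apply: (IH (fun s => f (x :: s))).
Qed.

(** Unfolded at [a] and [b_1, ..., b_n], this is [f(a b_1, b_2, ...) - f(a, b_1 b_2, ...) + ...],
    ending with the term [f(a, b_1, ..., b_(n-1)) eps(b_n)] of sign [(-1)^n]. The recursion carries
    the signs, so identities go by induction instead of by manipulating indexed sums. *)
Fixpoint bar_tail f (a : A) s : k :=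
  if s is b :: s' then f (a * b :: s') - bar_tail (fun r => f (a :: r)) b s'
  else f [::] * eps a.

(* The differential dual to that of the bar resolution: [f (a :: s)] is the
   value of [f] at [a [s]]; the module argument is not hit by [eps]. *)
Definition resd f s : k := if s is a :: s' then bar_tail f a s' else 0.

Lemma bar_merge_cons i b s : bar_merge i.+1 (b :: s) = b :: bar_merge i s.
Proof. by []. Qed.

Lemma bar_merge0 b c s : bar_merge 0 [:: b, c & s] = b * c :: s.
Proof. by rewrite /bar_merge /= drop0. Qed.

Lemma bar_tail_sum f a s : bar_tail f a s =
  (if s is b :: s' then f (a * b :: s') else f [::] * eps a) +
  (\sum_(i < (size s).-1) (-1) ^+ i.+1 * f (a :: bar_merge i s))
   + (-1) ^+ (size s) * (if s is b :: s' then f (a :: take (size s).-1 s) * eps (last 0 s) else 0).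
Proof.
elim: s f a => [|b s IH] f a; first by rewrite /= big_ord0 mulr0 !addr0.
rewrite [LHS]/= IH; case: s IH => [|c s] IH /=; first by rewrite !big_ord0; ring.
rewrite big_ord_recl bar_merge0 !exprS.
rewrite [X in _ = _ + (_ + X) + _](_ : _ = - \sum_(i < size s)
    (-1) ^+ i.+1 * f [:: a, b & bar_merge i (c :: s)]); first by ring.
rewrite -sumrN; apply: eq_bigr => i _.
by rewrite lift0 bar_merge_cons exprS !mulN1r mulNr.
Qed.

(** The bridge from the indexed sum in [bar_diff] to the recursive form, in which all later
    computations take place. *)
Lemma bar_diffE f a s : bar_diff eps f (a :: s) = eps a * f s - bar_tail f a s.
Proof.
rewrite bar_tail_sum; case: s => [|b s]; rewrite /bar_diff /=.
  by rewrite !big_ord0; ring.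
rewrite big_ord_recl bar_merge0 !exprS.
rewrite [X in _ + (_ + X) + _ = _](_ : _ = - \sum_(i < size s)
    (-1) ^+ i.+1 * f (a :: bar_merge i (b :: s))); first by ring.
rewrite -sumrN; apply: eq_bigr => i _.
by rewrite lift0 bar_merge_cons exprS !mulN1r mulNr.
Qed.

Lemma eq_bar_tail f g a s :
  (forall r, size r = size s -> f r = g r) -> bar_tail f a s = bar_tail g a s.
Proof.
elim: s f g a => [|b s IH] f g a efg /=; first by rewrite efg.
by rewrite efg // (IH _ (fun r => g (a :: r))) // => r rs; rewrite efg /= ?rs.
Qed.

Lemma bar_tail_lincomb c f g a s :
  bar_tail (fun r => c * f r + g r) a s = c * bar_tail f a s + bar_tail g a s.
Proof.
by elim: s f g a => [|b s IH] f g a /=; rewrite ?(IH (fun r => f (a :: r))); ring.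
Qed.

Lemma bar_tailZ (c : k) f a s : bar_tail (fun r => c * f r) a s = c * bar_tail f a s.
Proof.
elim: s f a => [|b s IH] f a /=; first by rewrite mulrA.
by rewrite (IH (fun r => f (a :: r))) mulrBr.
Qed.

Lemma bar_tail_0 a s : bar_tail (fun=> 0) a s = 0.
Proof. by elim: s a => [|b s IH] a /=; rewrite ?IH; ring. Qed.

(** The differential of the bar resolution is [A]-linear in the module argument. *)
Lemma bar_tail_act f a b c s :
  bar_tail (fun r => f (a * head 0 r :: behead r)) b (c :: s) =
  bar_tail f (a * b) (c :: s).
Proof. by rewrite /= mulrA. Qed.

Hypothesis eps_lin : forall c a b, eps (c *: a + b) = c * eps a + eps b.
Hypothesis epsM : forall a b, eps (a * b) = eps a * eps b.

(** This is [d^2 = 0]. Peeling the module argument off the inner differential leaves one term that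
    vanishes by induction and one that cancels by [A]-linearity. *)
Lemma bar_tail_resd f a s : bar_tail (resd f) a s = 0.
Proof.
elim: s f a => [|b [|c s] IH] f a; first by rewrite /= mul0r.
  by rewrite /= epsM; ring.
have E := IH (fun r => f (a :: r)) b.
rewrite -[LHS]/(bar_tail f (a * b) (c :: s) - bar_tail (fun r => resd f (a :: r)) b (c :: s)).
rewrite [X in _ - X](@eq_bar_tail _ (fun r => (-1) * (resd (fun r => f (a :: r)) r)
   + f (a * head 0 r :: behead r)) b (c :: s)).
  by rewrite bar_tail_lincomb E bar_tail_act mulr0 add0r subrr.
by case=> //= x r _; rewrite mulN1r addrC.
Qed.

Lemma multilinear_resd n f :
  multilinear (V := k^o) n f -> multilinear (V := k^o) n.+1 (resd f).
Proof.
elim: n f => [|n IH] f fm.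
  by split=> // c a b [] // _ /=; rewrite eps_lin /GRing.scale /=; ring.
have [fl fa] := fm.
split=> [c a b [|x s] //= [ss]|a].
  rewrite mulrDl -scalerAl fl // scalerDr.
  rewrite (@eq_bar_tail _ (fun r => c * f (a :: r) + f (b :: r))); last first.
    by move=> r rs; rewrite fl // rs.
  by rewrite bar_tail_lincomb /GRing.scale /=; ring.
apply: (@multilinear_ext _ _ _ _ (fun r => (-1 : k) *: (resd (fun r => f (a :: r)) r : k^o)
   + f (a * head 0 r :: behead r))) => [[|x s] //= _|].
  by rewrite scaleN1r addrC.
apply: multilinear_lincomb; first exact: IH (fa a).
split=> [c x y s ss|x] /=; last exact: fa.
by rewrite mulrDr -scalerAr fl.
Qed.

Lemma multilinear_bar_diff n f :
  multilinear (V := k^o) n f -> multilinear (V := k^o) n.+1 (bar_diff eps f).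
Proof.
move=> fm; apply: (@multilinear_ext _ _ _ _ (fun s => (-1 : k) *: (resd f s : k^o)
   + eps (head 0 s) * f (behead s))) => [[|a s] //= _|].
  by rewrite bar_diffE scaleN1r addrC.
apply: multilinear_lincomb; first exact: multilinear_resd.
split=> [c a b s ss|a] /=; first by rewrite eps_lin /GRing.scale /=; ring.
by apply: (multilinear_comp (W := k^o) _ fm) => c x y; rewrite /GRing.scale /=; ring.
Qed.

Lemma bar_diff_diff f s : (1 < size s)%N -> bar_diff eps (bar_diff eps f) s = 0.
Proof.
case: s => [|a [|b s]] // _; rewrite !bar_diffE.
rewrite (@eq_bar_tail _ (fun r => (-1) * resd f r
   + eps (head 0 r) * f (behead r)) a (b :: s)); last first.
  by case=> //= x r _; rewrite bar_diffE; ring.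
rewrite bar_tail_lincomb bar_tail_resd mulr0 add0r /= epsM.
by rewrite (bar_tailZ (eps a)); ring.
Qed.

Lemma bar_tail_cup0 f g a s : bar_tail (cup 0 f g) a s = f [::] * bar_tail g a s.
Proof. by rewrite -bar_tailZ; apply: eq_bar_tail => r _; rewrite /cup take0 drop0. Qed.

(** The graded Leibniz rule. Across the cut, the last term of the differential of [f] cancels the
    leading term [eps] of [bar_diff eps g]. *)
Lemma bar_tail_cup m f g a s : (m < size s)%N ->
  bar_tail (cup m.+1 f g) a s =
  bar_tail f a (take m.+1 s) * g (drop m.+1 s) +
  (-1) ^+ m * f (a :: take m s) * bar_diff eps g (drop m s).
Proof.
elim: m f a s => [|m IH] f a [|b s] //= ms.
  rewrite [X in _ - X](bar_tail_cup0 (fun r => f (a :: r))) bar_diffE /cup /= !take0 drop0 /= expr0 mul1r; ring.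
rewrite [X in _ - X](IH (fun r => f (a :: r))) // /cup /= exprS; ring.
Qed.

Lemma bar_diff_cup m n f g s : size s = (m + n).+1 ->
  bar_diff eps (cup m f g) s =
  bar_diff eps f (take m.+1 s) * g (drop m.+1 s) +
  (-1) ^+ m * f (take m s) * bar_diff eps g (drop m s).
Proof.
case: s => // a s [ss]; rewrite take_cons bar_diffE bar_diffE /=.
case: m ss => [|m] ss.
  rewrite /= !drop0 take0 bar_diffE bar_tail_cup0 /cup take0 drop0 /=; ring.
rewrite bar_tail_cup ?ss ?ltn_addr // /cup /= exprS; ring.
Qed.

Lemma cocycle_cup m n f g :
  cocycle eps m f -> cocycle eps n g -> cocycle eps (m + n) (cup m f g).
Proof.
move=> [/cochainP fc fd] [/cochainP gc gd]; split=> [|s ss].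
  apply/cochainP; elim: m f fc {fd} => [|m IH] f fc.
    rewrite add0n; apply: (@multilinear_ext _ _ k^o _ (fun s => f [::] * g s)) => [s _|].
      by rewrite /cup take0 drop0.
    by apply: (multilinear_comp (W := k^o) _ gc) => c x y; rewrite /GRing.scale /=; ring.
  have [fl fa] := fc; rewrite addSn; split=> [c a b s ss|a]; last exact: (IH _ (fa a)).
  rewrite /cup /= fl ?size_takel ?ss ?leq_addr // /GRing.scale /=; ring.
rewrite (bar_diff_cup _ _ ss) fd ?gd ?mul0r ?mulr0 ?addr0 //.
  by rewrite size_drop ss -addnS addKn.
by rewrite size_takel // ss ltnS leq_addr.
Qed.

End Bar.

(** * Homotopies *)

Section Homotopy.
Variables (k : fieldType) (A : algType k) (eps : A -> k).
Hypothesis eps_lin : forall c a b, eps (c *: a + b) = c * eps a + eps b.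
Hypothesis eps1 : eps 1 = 1.
Hypothesis epsM : forall a b, eps (a * b) = eps a * eps b.
Implicit Types (f g F : seq A -> k) (s r : seq A).

Local Notation ml := (@multilinear k A k^o).
Local Notation resd := (resd eps).
Local Notation bar_tail := (bar_tail eps).

Definition act (a : A) f r : k := f (a * head 0 r :: behead r).

(** The [A]-linear map from the bar resolution to the trivial module that corresponds to the cochain
    [F]. *)
Definition induced F r : k := eps (head 0 r) * F (behead r).

Lemma multilinear_act n a f : ml n.+1 f -> ml n.+1 (act a f).
Proof.
move=> [fl fa]; split=> [c x y s ss|x]; last exact: (fa (a * x)).
by rewrite /act /= mulrDr -scalerAr fl.
Qed.

Lemma multilinear_induced n F : ml n F -> ml n.+1 (induced F).
Proof.
move=> Fm; split=> [c a b s _|a].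
  by rewrite /induced /= eps_lin /GRing.scale /=; ring.
by apply: (@multilinear_comp _ _ k^o k^o _ _ ( *%R (eps a)) _ Fm) => c x y; rewrite /GRing.scale /=; ring.
Qed.

Lemma resd_act a f b c s : resd (act a f) [:: b, c & s] = act a (resd f) [:: b, c & s].
Proof. exact: bar_tail_act. Qed.

Lemma resd_induced n F s : cocycle eps n F -> size s = n.+2 -> resd (induced F) s = 0.
Proof.
move=> [_ Fd]; case: s => [|a [|b s]] // [ss].
have := Fd (b :: s); rewrite bar_diffE /= ss => /(_ erefl) E.
by rewrite /induced /= (bar_tailZ eps (eps a)) epsM -mulrA -mulrBr E mulr0.
Qed.

Lemma act_induced a F r : act a (induced F) r = eps a * induced F r.
Proof. by rewrite /act /induced /= epsM mulrA. Qed.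

Section Retract.

(** The model is a resolution by free modules of rank one: [phi] compares the bar resolution with
    it, and [z n] is the image of its [n]-th generator in the bar resolution. Hypothesis [phi_chain]
    says that the composite [a[s] |-> a phi(s)[z n]] is a chain map. *)
Variables (phi : seq A -> A) (z : nat -> seq A).
Hypothesis phi_nil : phi [::] = 1.
Hypothesis phi_ml : forall n, multilinear n phi.
Hypothesis z_nil : z 0%N = [::].
Hypothesis size_z : forall n, size (z n) = n.
Hypothesis phi_chain : forall n f s, ml n.+1 f -> size s = n.+1 ->
  resd (fun r => f (head 0 r * phi (behead r) :: z n)) (1 :: s)
    = resd f (phi s :: z n.+1).

(** A homotopy, written dually, from the identity to the composite through the small resolution. In
    each degree the contraction [x[s] |-> 1[x | s]] is applied to the composite minus the identity
    minus the previous homotopy after [d]; the module argument [a] is put back by linearity. *)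
Fixpoint retract_htpy (n : nat) f r : k :=
  match n, r with
  | n'.+1, a :: s => let g r := f (a :: r) in
      g (phi s :: z n) - g (1 :: s) - resd (retract_htpy n' g) (1 :: s)
  | _, _ => 0
  end.

Lemma retract_htpy_lincomb n c f g r :
  retract_htpy n (fun r => c * f r + g r) r =
  c * retract_htpy n f r + retract_htpy n g r.
Proof.
elim: n c f g r => [|n IH] c f g [|a s] /=; try ring.
rewrite (eq_bar_tail eps (g := fun r => c * retract_htpy n (fun r => f (a :: r)) r
   + retract_htpy n (fun r => g (a :: r)) r)).
  by rewrite bar_tail_lincomb; ring.
by move=> r _; rewrite -IH.
Qed.

Lemma retract_htpy_0 n r : retract_htpy n (fun=> 0) r = 0.
Proof.
elim: n r => [|n IH] [|a s] //=.
by rewrite (eq_bar_tail eps (g := fun=> 0)) ?bar_tail_0 ?subr0.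
Qed.

Lemma retract_htpy_act n a f b s :
  retract_htpy n (act a f) (b :: s) = retract_htpy n f (a * b :: s).
Proof. by case: n. Qed.

Lemma eq_retract_htpy n f g r : size r = n.+1 ->
  (forall r, size r = n.+2 -> f r = g r) -> retract_htpy n f r = retract_htpy n g r.
Proof.
elim: n f g r => [|n IH] f g [|a s] //= [ss] efg.
rewrite !efg /= ?ss ?size_z //.
rewrite (eq_bar_tail eps (g := retract_htpy n (fun r => g (a :: r)))) // => r rs.
by apply: IH => [|r' rs']; rewrite ?efg /= ?rs ?rs'.
Qed.

Lemma multilinear_retract_htpy n f : ml n.+2 f -> ml n.+1 (retract_htpy n f).
Proof.
elim: n f => [|n IH] f fm.
  apply: (@multilinear_ext _ _ k^o _ (fun=> 0)) => //.
  by split=> [c a b s _|a] //; rewrite scaler0 addr0.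
have [fl _] := fm; have fa a := multilinear_cons a fm; split=> [c a b s ss|a].
  rewrite /= !fl /= ?size_z ?ss //.
  rewrite (eq_bar_tail eps (g := fun r => c * retract_htpy n (fun r => f (a :: r)) r
   + retract_htpy n (fun r => f (b :: r)) r)).
    by rewrite bar_tail_lincomb /GRing.scale /=; ring.
  move=> r rs; rewrite -retract_htpy_lincomb; apply: eq_retract_htpy.
    by rewrite rs ss.
  by move=> r' rs'; rewrite fl.
apply: (@multilinear_ext _ _ k^o _ (fun s => (-1 : k) *: (f [:: a, 1 & s] : k^o)
  + ((-1 : k) *: (resd (retract_htpy n (fun r => f (a :: r))) (1 :: s) : k^o)
     + f [:: a, phi s & z n.+1]))) => [s ss|].
  by rewrite !scaleN1r /=; ring.
apply: (multilinear_lincomb (V := k^o)); first exact: (multilinear_cons 1 (fa a)).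
apply: (multilinear_lincomb (V := k^o)).
  exact: multilinear_cons (multilinear_resd eps_lin (IH _ (fa a))).
apply: (@multilinear_comp _ _ A k^o _ phi (fun x => f [:: a, x & z n.+1])) => // c x y.
by have [->] := fa a.
Qed.

Lemma retract_htpyP n f a s : ml n.+1 f -> size s = n ->
  retract_htpy n (resd f) (a :: s) +
  (if n is n'.+1 then resd (retract_htpy n' f) (a :: s) else 0) =
  f (a * phi s :: z n) - f (a :: s).
Proof.
elim: n f a s => [|n IH] f a s fm ss.
  by case: s ss => //= _; rewrite phi_nil z_nil mulr1 subrr addr0.
have fa a' := multilinear_cons a' fm.
have E b r : r != [::] -> resd f [:: a, b & r] = act a f (b :: r) - resd (fun r => f (a :: r)) (b :: r).
  by [].
have HE g : retract_htpy n.+1 g (a :: s) = g [:: a, phi s & z n.+1]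
  - g [:: a, 1 & s] - bar_tail (retract_htpy n (fun r => g (a :: r))) 1 s by [].
rewrite HE E; last by rewrite -size_eq0 size_z.
rewrite E; last by rewrite -size_eq0 ss.
rewrite (eq_bar_tail eps (g := fun r => (-1) *
  retract_htpy n (resd (fun r => f (a :: r))) r +
  retract_htpy n (act a f) r)); last first.
  move=> r rs; rewrite -retract_htpy_lincomb.
  apply: eq_retract_htpy; rewrite ?rs // => -[|b [|c r']] //= _; rewrite /act /=; ring.
rewrite bar_tail_lincomb.
(* By the induction hypothesis, homotopy after [d] becomes the composite minus the identity minus
   [d] after homotopy; the last summand then dies by [d^2 = 0]. *)
rewrite (eq_bar_tail eps (g := fun r => (-1) * resd (if n is n'.+1 then retract_htpy n' (fun r => f (a :: r)) else fun=> 0) r +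
  ((-1) * f (a :: r) + f [:: a, head 0 r * phi (behead r) & z n]))); last first.
  case=> [|b r]; rewrite ss => //= -[rs].
  have := IH _ b r (fa a) rs; case: (n) => [|n'] /(canRL (addrK _)) ->; last by rewrite /=; ring.
  by rewrite /= bar_tail_0; ring.
rewrite !bar_tail_lincomb.
rewrite [bar_tail (resd _) _ _](bar_tail_resd epsM).
have := phi_chain (fa a) ss => /= ->.
rewrite /act /= mulr1.
have -> : bar_tail (retract_htpy n (act a f)) 1 s = bar_tail (retract_htpy n f) a s.
  case: s ss {HE} => // b s ss /=; rewrite mul1r.
  rewrite retract_htpy_act; congr (_ - _); apply: eq_bar_tail => r _.
  by rewrite retract_htpy_act mulr1.
by rewrite /=; ring.
Qed.

(** The map induced by a cocycle kills boundaries, so the homotopy formula expresses [F] as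
    [F (z n)], up to a factor, plus a coboundary. The sign of the primitive is that of the identity
    in the formula. *)
Lemma coboundary_of_eq0 n F :
  cocycle eps n F -> F (z n) = 0 -> coboundary eps n F.
Proof.
case: n => [|n] Fc Fz; first by rewrite /= -z_nil.
have [/cochainP Fm _] := Fc; have Im := multilinear_induced Fm.
have Hm := multilinear_cons 1 (multilinear_retract_htpy Im).
exists (fun r => - retract_htpy n (induced F) (1 :: r)).
  apply/cochainP; apply: (@multilinear_comp _ _ k^o k^o _ _ -%R _ Hm) => c x y.
  by rewrite /GRing.scale /=; ring.
case=> // b s [ss]; have bs : size (b :: s) = n.+1 by rewrite /= ss.
have := retract_htpyP 1 Im bs.
rewrite (@eq_retract_htpy _ _ (fun=> 0)) ?retract_htpy_0 /= ?ss //; last first.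
  by move=> r rs; rewrite (resd_induced Fc).
rewrite [X in _ = X - _ -> _](_ : _ = 0); last by rewrite /induced /= Fz mulr0.
rewrite [X in _ = _ - X -> _](_ : _ = F (b :: s)); last by rewrite /induced /= eps1 mul1r.
rewrite !add0r mul1r bar_diffE => E.
rewrite (eq_bar_tail eps (g := fun r => (-1) * retract_htpy n (induced F) (1 :: r))).
  rewrite bar_tailZ -[LHS]opprK -E -[in LHS](mulr1 b) -retract_htpy_act.
  rewrite (@eq_retract_htpy _ _ (fun r => eps b * induced F r + 0)) /= ?ss //.
    rewrite (retract_htpy_lincomb n (eps b) (induced F) (fun=> 0)) retract_htpy_0 mulr1; ring.
  by move=> r _; rewrite act_induced addr0.
by move=> r _; rewrite mulN1r.
Qed.

End Retract.

(** Elements of the bar resolution in degree [n] are represented dually, by evaluation of cochains;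
    [n.+1] counts the module argument. The second clause stands in for extensionality. *)
Definition functional n (b : (seq A -> k) -> k) : Prop :=
  (forall c f g, b (fun r => c * f r + g r) = c * b f + b g) /\
  (forall f g, (forall r, size r = n.+1 -> f r = g r) -> b f = b g).

Section ChainMaps.
Variable u : nat -> A.
Hypothesis uu : forall n, u n.+1 * u n = 0.
Hypothesis eps_u : forall n, eps (u n) = 0.

(* A chain map to the bar resolution from the complex of free [A]-modules of
   rank one with differentials [u 0], [u 1], ...: the functional [b n] is the
   evaluation at the image of the [n]-th generator. *)
Definition chain_map (b : nat -> (seq A -> k) -> k) : Prop :=
  (forall n, functional n (b n)) /\
  (forall n f, ml n.+1 f -> b n.+1 (resd f) = b n (act (u n) f)).

Lemma functional_0 n b : functional n b -> b (fun=> 0) = 0.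
Proof.
move=> [bl be]; have := bl (-1) (fun=> 0) (fun=> 0).
by rewrite (be _ (fun=> 0)) ?mulN1r ?addNr // => r _; rewrite mulr0 addr0.
Qed.

Lemma functional_B n b f g : functional n b -> b (fun r => f r - g r) = b f - b g.
Proof.
move=> [bl be]; rewrite (be _ (fun r => (-1) * g r + f r)); last by move=> r _; ring.
by rewrite bl; ring.
Qed.

Variables b b' : nat -> (seq A -> k) -> k.
Hypotheses (bP : chain_map b) (bP' : chain_map b').
Hypothesis bb' : forall f, b 0%N f = b' 0%N f.

(** Two lifts of the same map to a resolution are homotopic; the homotopy is again built from the
    contraction that puts [1] in front. *)
Fixpoint chain_htpy n f : k :=
  if n is n'.+1 then
    b n (fun r => f (1 :: r)) - b' n (fun r => f (1 :: r))
    - chain_htpy n' (act (u n') (fun r => f (1 :: r)))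
  else 0.

Lemma functional_chain_htpy n : functional n.+1 (chain_htpy n).
Proof.
elim: n => [|n [hl he]]; first by split=> * /=; rewrite ?mulr0 ?addr0.
have [bl be] := bP.1 n.+1; have [bl' be'] := bP'.1 n.+1.
split=> [c f g|f g efg] /=.
  have := hl c (act (u n) (fun r => f (1 :: r))) (act (u n) (fun r => g (1 :: r))).
  by rewrite bl bl' => ->; ring.
congr (_ - _ - _); first by apply: be => r rs; rewrite efg /= ?rs.
  by apply: be' => r rs; rewrite efg /= ?rs.
by apply: he => -[|x r] // [rs]; rewrite /act efg //= rs.
Qed.

Lemma chain_htpyP n f : ml n.+1 f ->
  b n f - b' n f =
  chain_htpy n (resd f) + (if n is m.+1 then chain_htpy m (act (u m) f) else 0).
Proof.
elim: n f => [|n IH] f fm; first by rewrite bb' subrr addr0.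
have em := multilinear_cons 1 fm; set e := fun s => f (1 :: s) in em.
have [bl be] := bP.1 n.+1; have [bl' be'] := bP'.1 n.+1.
have [hl he] := functional_chain_htpy n.
have E r : size r = n.+2 -> resd f (1 :: r) = f r - resd e r.
  by case: r => // c r _; rewrite /= mul1r.
rewrite /= (be _ _ (fun r rs => E r rs)) (be' _ _ (fun r rs => E r rs)).
rewrite !(functional_B _ _ (bP.1 n.+1)) !(functional_B _ _ (bP'.1 n.+1)).
rewrite bP.2 // bP'.2 //.
rewrite (he _ (fun r => act (u n) f r - act (u n) (resd e) r)); last first.
  by case=> // c r [rs]; rewrite /act /= -E //= rs.
rewrite (functional_B _ _ (functional_chain_htpy n)).
rewrite (he (act (u n) (resd e)) (resd (act (u n) e))); last first.
  by case=> // c [|d r] // _; rewrite resd_act.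
(* The other term of the induction hypothesis involves two consecutive differentials, whose product
   is zero by [uu]. *)
have -> : chain_htpy n (resd (act (u n) e)) = b n (act (u n) e) - b' n (act (u n) e).
  rewrite (IH _ (multilinear_act (u n) em)); case: (n) em => [|m] em'.
    by rewrite addr0.
  have [_ he'] := functional_chain_htpy m.
  rewrite (he' _ (fun=> 0)) ?(functional_0 (functional_chain_htpy m)) ?addr0 //.
  by case=> // c r [rs]; rewrite /act /= mulrA uu mul0r (multilinear_0 em').
by ring.
Qed.

(** Of the two halves of the homotopy formula, one vanishes because [F] is a cocycle and the other
    because [eps] kills the differentials [u n]. *)
Lemma eq_chain_map n F : cocycle eps n F -> b n (induced F) = b' n (induced F).
Proof.
move=> Fc; have [/cochainP Fm _] := Fc.
apply/eqP; rewrite -subr_eq0; apply/eqP.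
rewrite (chain_htpyP (multilinear_induced Fm)).
have [_ he] := functional_chain_htpy n.
rewrite (he _ (fun=> 0)); last by move=> r rs; rewrite (resd_induced Fc).
rewrite (functional_0 (functional_chain_htpy n)) add0r; case: (n) => // m.
have [_ he'] := functional_chain_htpy m.
rewrite (he' _ (fun=> 0)) ?(functional_0 (functional_chain_htpy m)) //.
by move=> r _; rewrite act_induced eps_u mul0r.
Qed.

End ChainMaps.
End Homotopy.

(** * Periodic cycles *)

Section Cycles.
Variables (k : fieldType) (A : algType k) (eps : A -> k).
Hypothesis eps_lin : forall c a b, eps (c *: a + b) = c * eps a + eps b.
Hypothesis eps1 : eps 1 = 1.
Hypothesis epsM : forall a b, eps (a * b) = eps a * eps b.
Implicit Types (f g F : seq A -> k) (s r : seq A) (d : nat -> A).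

Local Notation ml := (@multilinear k A k^o).
Local Notation resd := (resd eps).
Local Notation bar_tail := (bar_tail eps).
Local Notation induced := (induced eps).

Fixpoint cyc d n : seq A := if n is n'.+1 then d n' :: cyc d n' else [::].

Lemma size_cyc d n : size (cyc d n) = n.
Proof. by elim: n => //= n ->. Qed.

Definition complex d := (forall n, d n.+1 * d n = 0) /\ (forall n, eps (d n) = 0).

(** Adjacent entries multiply to zero and the last one has augmentation zero, so each term of the
    differential vanishes separately. *)
Lemma bar_tail_cyc d n f : complex d -> ml n f -> bar_tail f (d n) (cyc d n) = 0.
Proof.
move=> [dd eps_d]; elim: n f => [|n IH] f fm /=; first by rewrite eps_d mulr0.
by rewrite dd (multilinear_0 fm) ?size_cyc // (IH (fun r => f (_ :: r)) (multilinear_cons _ fm)) subr0.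
Qed.

Lemma resd_cyc d n f a : complex d -> ml n.+1 f ->
  resd f (a :: cyc d n.+1) = f (a * d n :: cyc d n).
Proof.
move=> dP fm; rewrite /= (bar_tail_cyc (f := fun r => f (a :: r)) dP) ?subr0 //.
exact: multilinear_cons.
Qed.

Lemma coboundary_cyc d n F : complex d -> coboundary eps n F -> F (cyc d n) = 0.
Proof.
case: n => [|n] // dP [g /cochainP gm Fg].
rewrite Fg ?size_cyc // bar_diffE (bar_tail_cyc dP gm) (dP.2) mul0r subr0 //.
Qed.

Lemma functional_cons n (a : A) s : size s = n -> functional n (fun f => f (a :: s)).
Proof. by move=> ss; split=> // f g; apply; rewrite /= ss. Qed.

Lemma functional_add n b b' : functional n b -> functional n b' ->
  functional (A := A) n (fun f : seq A -> k => b f + b' f).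
Proof.
move=> [bl be] [bl' be']; split=> [c f g|f g efg]; first by rewrite bl bl'; ring.
by rewrite (be _ _ efg) (be' _ _ efg).
Qed.

Lemma functional_act n a b : functional n b ->
  functional (A := A) n (fun f : seq A -> k => b (act a f)).
Proof.
move=> [bl be]; split=> [c f g|f g efg]; first exact: (bl c (act a f) (act a g)).
by apply: be => -[|x r] // rs; rewrite /act efg.
Qed.

Lemma chain_map_cyc d : complex d ->
  chain_map eps d (fun n f => f (1 :: cyc d n)).
Proof.
move=> dP; split=> [n|n f fm]; first by apply: functional_cons; rewrite size_cyc.
by rewrite resd_cyc // /act /= mulr1 mul1r.
Qed.

(** The [c n] form a chain map from the complex [d'] to the complex [d] over the identity in degree
    0. Following it by the lift of [d] gives a second lift of [d']. *)
Lemma cocycle_cyc_scale d d' c n F : complex d -> complex d' ->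
  c 0%N = 1 -> (forall n, c n.+1 * d n = d' n * c n) ->
  cocycle eps n F -> F (cyc d' n) = eps (c n) * F (cyc d n).
Proof.
move=> dP dP' c0 cd Fc.
have bP : chain_map eps d' (fun n f => f (c n :: cyc d n)).
  split=> [m|m f fm]; first by apply: functional_cons; rewrite size_cyc.
  by rewrite resd_cyc // /act /= cd.
have := eq_chain_map eps_lin epsM dP'.1 dP'.2 (chain_map_cyc dP') bP _ Fc.
by rewrite /induced /= eps1 mul1r; apply=> f; rewrite c0.
Qed.

Section Koszul.
Variables (y : A) (d : nat -> A).
Hypothesis dP : complex d.
Hypothesis eps_y : eps y = 0.
Hypothesis yd : forall n, y * d n = d n * y.

(* Lifts to the bar resolution the generators [e_y * g_n] of the tensor product
   of the periodic complex [d] (with generators [g_n]) and the Koszul complex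
   of [y]. *)
Fixpoint koszul_lift n f : k :=
  f [:: 1, y & cyc d n] -
  (if n is n'.+1 then koszul_lift n' (act (d n') (fun r => f (1 :: r))) else 0).

Lemma functional_koszul_lift n : functional n.+1 (koszul_lift n).
Proof.
elim: n => [|n [hl he]].
  by split=> [c f g|f g efg] /=; rewrite ?subr0 // efg.
split=> [c f g|f g efg] /=.
  have := hl c (act (d n) (fun r => f (1 :: r))) (act (d n) (fun r => g (1 :: r))).
  by move=> ->; ring.
rewrite efg /= ?size_cyc //; congr (_ - _).
by apply: he => -[|x r] // [rs]; rewrite /act efg //= rs.
Qed.

(** The Koszul rule: the boundary of [e_y g_n] is [y g_n - d_(n-1) e_y g_(n-1)]. *)
Lemma koszul_lift_resd n f : ml n.+1 f ->
  koszul_lift n (resd f) = f (y :: cyc d n) -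
    (if n is m.+1 then koszul_lift m (act (d m) f) else 0).
Proof.
elim: n f => [|n IH] f fm; first by rewrite /= mul1r eps_y; ring.
have em := multilinear_cons 1 fm; set e := fun s => f (1 :: s) in em.
have [hl he] := functional_koszul_lift n.
have -> : koszul_lift n.+1 (resd f) = resd f [:: 1, y & cyc d n.+1] -
  koszul_lift n (act (d n) (fun r => resd f (1 :: r))) by [].
have -> : resd f [:: 1, y & cyc d n.+1] = f (y :: cyc d n.+1) - resd e (y :: cyc d n.+1).
  by rewrite [LHS]/= mul1r.
rewrite resd_cyc //.
rewrite (he _ (fun r => act (d n) f r - resd (act (d n) e) r)); last first.
  by case=> // x [|w r] // _; rewrite resd_act /act /= mul1r.
rewrite (functional_B _ _ (functional_koszul_lift n)).
rewrite (IH _ (multilinear_act (d n) em)).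
have -> : (if n is m.+1 then koszul_lift m (act (d m) (act (d n) e)) else 0) = 0.
  case: (n) em => // m em'.
  have [_ he'] := functional_koszul_lift m.
  rewrite (he' _ (fun=> 0)) ?(functional_0 (functional_koszul_lift m)) //.
  by case=> // c r [rs]; rewrite /act /= mulrA dP.1 mul0r (multilinear_0 em').
by rewrite /e /act /= yd; ring.
Qed.

(** The hypotheses say that sending the [n]-th generator to [g_n + c_n e_y g_(n-1)] is a chain map
    from [d'] to the tensor product with the Koszul complex. Since [eps (c n) = 0], the second
    summand is invisible to a cocycle. *)
Lemma cocycle_cyc_shift d' c n F : complex d' ->
  (forall n, d n + c n.+1 * y = d' n) ->
  (forall n, d' n.+1 * c n.+1 = - (c n.+2 * d n)) ->
  (forall n, eps (c n) = 0) ->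
  cocycle eps n F -> F (cyc d' n) = F (cyc d n).
Proof.
move=> dP' cy cd eps_c Fc.
pose b n f := f (1 :: cyc d n) +
  (if n is m.+1 then koszul_lift m (act (c n) f) else 0).
have bP : chain_map eps d' b.
  split=> [m|m f fm].
    rewrite /b; apply: functional_add.
      by apply: functional_cons; rewrite size_cyc.
    case: m => [|m]; first by split=> * //; rewrite mulr0 addr0.
    exact: functional_act (functional_koszul_lift m).
  rewrite /b resd_cyc // mul1r.
  have [hl he] := functional_koszul_lift m.
  rewrite (he _ (resd (act (c m.+1) f))); last first.
    by case=> // x [|w r] // _; rewrite resd_act.
  rewrite (koszul_lift_resd (multilinear_act _ fm)) addrA.
  rewrite /act /= mulr1 -cy (multilinear_add (V := k^o) _ _ fm) ?size_cyc // -!addrA.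
  congr (_ + (_ + _)); case: m fm {hl he} => [|m] fm; first by rewrite oppr0.
  have hB := functional_B _ _ (functional_koszul_lift m).
  have [_ he'] := functional_koszul_lift m.
  rewrite -[LHS]add0r -(functional_0 (functional_koszul_lift m)) -hB.
  apply: he' => -[|x r] //= [rs]; rewrite sub0r cy !mulrA cd mulNr.
  by rewrite (multilinear_opp (V := k^o) _ fm).
have := eq_chain_map eps_lin epsM dP'.1 dP'.2 (chain_map_cyc dP') bP _ Fc.
rewrite /induced /b /= eps1 !mul1r => -> //; last by move=> f; rewrite addr0.
case: n {Fc} => [|m]; first by rewrite addr0.
have [_ he'] := functional_koszul_lift m.
rewrite (he' _ (fun=> 0)) ?(functional_0 (functional_koszul_lift m)) ?addr0 //.
by move=> r _; rewrite act_induced // eps_c mul0r.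
Qed.

End Koszul.
End Cycles.

(** By Pascal's rule, consecutive binomials of row [p - 1] add up to an inner binomial of row [p],
    which is divisible by [p]; so they alternate in sign. *)
Lemma signr_bin_pred_pchar (S : nzRingType) (p i : nat) :
  p \in [pchar S] -> (i < p)%N -> (-1) ^+ i *+ 'C(p.-1, i) = 1 :> S.
Proof.
move=> pS; have p_pr := pcharf_prime pS; elim: i => [|i IH] ip.
  by rewrite bin0 expr0.
have : (-1 : S) ^+ i.+1 *+ 'C(p, i.+1) = 0.
  rewrite -mulr_natr; have /dvdnP [q ->] : (p %| 'C(p, i.+1))%N by rewrite prime_dvd_bin.
  by rewrite natrM (pcharf0 pS) mulr0 mulr0.
rewrite -[in 'C(p, _)](prednK (prime_gt0 p_pr)) binS mulrnDr exprS mulN1r.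
by rewrite ![(- _) *+ _]mulNrn IH ?(ltnW ip) // => /eqP; rewrite subr_eq0 => /eqP.
Qed.

(** The sum is [(x^p - y^p) / (x - y)], formally [(x - y)^(p - 1)] in characteristic [p]; the
    division is avoided by comparing binomial coefficients. *)
Lemma geom_sum_pchar (S : nzRingType) (p : nat) (x y : S) :
  p \in [pchar S] -> GRing.comm x y ->
  \sum_(i < p) x ^+ (p.-1 - i) * y ^+ i = (x - y) ^+ p.-1.
Proof.
move=> pS cxy; rewrite exprBn_comm // (prednK (prime_gt0 (pcharf_prime pS))).
apply: eq_bigr => i _.
rewrite -!mulrA -mulrnAl (signr_bin_pred_pchar pS) ?mul1r //.
Qed.

Section PowerCycles.
Variables (k : fieldType) (A : algType k) (eps : A -> k) (p : nat).
Hypothesis eps_lin : forall c a b, eps (c *: a + b) = c * eps a + eps b.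
Hypothesis eps1 : eps 1 = 1.
Hypothesis epsM : forall a b, eps (a * b) = eps a * eps b.
Hypothesis pk : p \in [pchar k].
Hypothesis p_gt2 : (2 < p)%N.
Hypothesis mulC : forall a b : A, a * b = b * a.
Implicit Types (F : seq A -> k) (u v c y : A).

Definition pdiff u n : A := if odd n then u ^+ p.-1 else u.

Definition pcyc u n : seq A := cyc (pdiff u) n.

Let p_gt0 : (0 < p)%N. Proof. exact: ltnW (ltnW p_gt2). Qed.

Let p1_neq0 : (p.-1 == 0)%N = false. Proof. by case: p p_gt2 => [|[|q]]. Qed.
Let p2S : p.-2.+1 = p.-1. Proof. by case: p p_gt2 => [|[|q]]. Qed.
Let p2_neq0 : (p.-2 == 0)%N = false. Proof. by case: p p_gt2 => [|[|[|q]]]. Qed.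

Lemma epsX a n : eps (a ^+ n) = eps a ^+ n.
Proof. by elim: n => [|n IH]; rewrite ?expr0 // !exprS epsM IH. Qed.

Lemma eps_nilp u n : u ^+ n = 0 -> eps u = 0.
Proof.
have e0 : eps 0 = 0.
  by have := eps_lin (-1) 0 0; rewrite scaler0 addr0 mulN1r addNr.
move=> /(congr1 eps); rewrite epsX e0 => /eqP.
by rewrite expf_eq0 => /andP[_ /eqP].
Qed.

Lemma complex_pdiff u : u ^+ p = 0 -> complex eps (pdiff u).
Proof.
move=> up; split=> n; rewrite /pdiff /=.
  by case: (odd n); rewrite /= -?exprS -?exprSr prednK.
by case: (odd n); rewrite /= ?epsX (eps_nilp up) // expr0n p1_neq0.
Qed.

(** Multiplication by [u^(p-2)] in odd degrees is a chain map onto the complex with [u] and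
    [u^(p-1)] exchanged, and [eps] kills [u^(p-2)] as [p > 2]. The shifted cycle is what remains
    when a periodic cycle is cut at an odd position. *)
Lemma cocycle_pcyc_odd u F n : u ^+ p = 0 -> odd n -> cocycle eps n F ->
  F (cyc (fun i => pdiff u i.+1) n) = 0.
Proof.
move=> up n_odd Fc; have uP := complex_pdiff up.
have sP : complex eps (fun i => pdiff u i.+1) by split=> i; [exact: uP.1 | exact: uP.2].
rewrite (cocycle_cyc_scale eps_lin eps1 epsM uP sP
  (c := fun i => if odd i then u ^+ p.-2 else 1)) ?n_odd //.
  by rewrite epsX (eps_nilp up) expr0n p2_neq0 mul0r.
move=> i; rewrite /pdiff /=; case: (odd i); rewrite /= ?mul1r ?mulr1.
  by case: p p_gt2 => [|[|[|q]]] //= _; rewrite -exprS.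
by case: p p_gt2 => [|[|[|q]]] //= _; rewrite -exprSr.
Qed.

(** Two consecutive differentials [c u] and [(c u)^(p-1)] together contribute a factor [c^p], which
    gives [p] in the exponent for every two degrees. *)
Lemma cocycle_pcyc_mul u c F n : u ^+ p = 0 -> ~~ odd n -> cocycle eps n F ->
  F (pcyc (c * u) n) = eps c ^+ (p * n./2) * F (pcyc u n).
Proof.
move=> up n_even Fc.
have cup m : (c * u) ^+ m = c ^+ m * u ^+ m by rewrite exprMn_comm //; apply: mulC.
have cuP : (c * u) ^+ p = 0 by rewrite cup up mulr0.
rewrite -epsX; pose e i := c ^+ (p * i./2 + odd i).
rewrite /pcyc (cocycle_cyc_scale eps_lin eps1 epsM (complex_pdiff up) (complex_pdiff cuP)
  (c := e)) ?(negPf n_even) /e ?(negPf n_even) ?addn0 ?muln0 //.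
move=> i; rewrite /pdiff /= uphalf_half; case: (odd i); rewrite /= ?addn0 ?addn1.
  rewrite cup -mulrA [u ^+ _ * _]mulC mulrA -exprD; congr (c ^+ _ * _).
  by rewrite add1n mulnS -addSnnS prednK.
by rewrite add0n -mulrA [u * _]mulC mulrA -exprS.
Qed.

(** Both [c] and [y] are nilpotent, so [c y] lies in the square of the augmentation ideal: the value
    only sees the linear part. *)
Lemma cocycle_pcyc_add v c y F n : v ^+ p = 0 -> y ^+ p = 0 -> c ^+ p = 0 ->
  cocycle eps n F -> F (pcyc (v + c * y) n) = F (pcyc v n).
Proof.
move=> vp yp cp Fc; set u := v + c * y.
have pA : p \in [pchar A] by rewrite pchar_lalg.
have up : u ^+ p = 0.
  rewrite -(pFrobenius_autE pA) pFrobenius_autD_comm ?pFrobenius_autE ?vp ?add0r; last exact: mulC.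
  by rewrite exprMn_comm ?cp ?mul0r //; apply: mulC.
have eps_y := eps_nilp yp; have eps_c := eps_nilp cp.
have Cuv : GRing.comm u v by apply: mulC.
pose S := \sum_(i < p.-1) u ^+ (p.-2 - i) * v ^+ i.
have uv : u - v = c * y by rewrite /u addrC addKr.
(* The sum is [(u - v)^(p-1) = (c y)^(p-1)], so [c] times it contains [c^p = 0]. *)
have cT : c * \sum_(i < p) u ^+ (p.-1 - i) * v ^+ i = 0.
  rewrite (geom_sum_pchar pA Cuv) uv exprMn_comm; last exact: mulC.
  by rewrite mulrA -exprS prednK // cp mul0r.
have uS : u * S + v ^+ p.-1 = \sum_(i < p) u ^+ (p.-1 - i) * v ^+ i.
  rewrite /S -[in RHS](prednK p_gt0) big_ord_recr /= subnn mul1r mulr_sumr.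
  congr (_ + _); apply: eq_bigr => i _; rewrite mulrA -exprS; congr (_ ^+ _ * _).
  by rewrite -subSn ?p2S // -ltnS p2S ltn_ord.
have vS : u ^+ p.-1 + v * S = \sum_(i < p) u ^+ (p.-1 - i) * v ^+ i.
  rewrite /S -[in RHS](prednK p_gt0) big_ord_recl /= subn0 mulr1 mulr_sumr.
  congr (_ + _); apply: eq_bigr => i _; rewrite /bump leq0n add1n [v * _]mulC -mulrA -exprSr.
  by congr (_ ^+ _ * _); rewrite subnS predn_sub.
(* The coefficients have to satisfy [e y = u - v] in odd degrees and [e y = u^(p-1) - v^(p-1)] in
   even ones; [S] is the quotient of the latter by [u - v]. The compatibility of signs then reduces
   to [cT]. *)
pose e i := if i is 0 then 0 else if odd i then c else c * S.
have e0 : eps 0 = 0.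
  by have := eps_lin (-1) 0 0; rewrite scaler0 addr0 mulN1r addNr.
rewrite /pcyc (@cocycle_cyc_shift _ _ _ eps_lin eps1 epsM y (pdiff v)
  (complex_pdiff vp) eps_y _ (pdiff u) e) //.
- exact: complex_pdiff.
- move=> i; rewrite /e /pdiff /=; case: (odd i) => //=.
  by rewrite -mulrA [S * y]mulC mulrA -uv -subrXX_comm // addrC subrK.
- move=> i; apply/eqP; rewrite -addr_eq0 /e /pdiff /=; case: (odd i) => /=.
    by rewrite mulrA [u * c]mulC -mulrA -mulrDr uS cT.
  by rewrite -mulrA -[_ * c]mulC -mulrDr [S * v]mulC vS cT.
- by case=> // i; rewrite /e; case: (odd _); rewrite // epsM eps_c mul0r.
Qed.

End PowerCycles.

(** * The algebra K[t]/t^p *)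

Section TruncPoly.
Variables (K : fieldType) (p : nat).
Hypothesis p_gt2 : (2 < p)%N.
Local Notation R := (trunc_poly K p).
Implicit Types (q : R) (s : seq R).

Definition tX : R := 'qX.

Let p_gt1 : (1 < p)%N. Proof. exact: ltnW. Qed.
Let p_gt0 : (0 < p)%N. Proof. exact: ltnW. Qed.

Lemma mk_monic_trunc : mk_monic ('X^p : {poly K}) = 'X^p.
Proof. by rewrite mk_monic_Xn prednK. Qed.

Lemma coef_in_trunc (q : {poly K}) i :
  (in_qpoly 'X^p q : R)`_i = if (i < p)%N then q`_i else 0.
Proof. by rewrite /= mk_monic_trunc -Pdiv.RingMonic.take_poly_rmodp coef_take_poly. Qed.

Lemma coef_truncM q (r : R) i :
  (q * r)`_i = if (i < p)%N then ((q : {poly K}) * r)`_i else 0.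
Proof. exact: coef_in_trunc. Qed.

Lemma coef_trunc_ge q i : (p <= i)%N -> q`_i = 0.
Proof. by move=> pi; rewrite big_coef_npoly // mk_monic_trunc size_polyXn. Qed.

Lemma truncP q (r : R) : (forall i, (i < p)%N -> q`_i = r`_i) -> q = r.
Proof.
move=> e; apply/npolyP => i; have [/e //|ip] := ltnP i p.
by rewrite !coef_trunc_ge.
Qed.

Lemma tXE : tX = 'X :> {poly K}.
Proof. by rewrite /tX in_qpoly_small // mk_monic_trunc size_polyX size_polyXn ltnS. Qed.

Lemma coef_tXM q i : (i < p)%N -> (tX * q)`_i = if i is j.+1 then q`_j else 0.
Proof. by move=> ip; rewrite coef_truncM ip tXE coefXM; case: i ip. Qed.

Lemma coef_tXnM n q i : (i < p)%N ->
  (tX ^+ n * q)`_i = if (i < n)%N then 0 else q`_(i - n).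
Proof.
elim: n i => [|n IH] i ip; first by rewrite expr0 mul1r subn0.
rewrite exprS -mulrA coef_tXM //; case: i ip => // i ip.
by rewrite IH ?ltnS ?subSS // ltnW.
Qed.

Lemma coef_trunc1 i : (1 : R)`_i = (i == 0)%:R.
Proof. by rewrite -[LHS]/((1%:P : {poly K})`_i) coefC; case: eqP. Qed.

Lemma coef_tXn n i : (i < p)%N -> (tX ^+ n)`_i = (i == n)%:R.
Proof.
move=> ip; rewrite -[tX ^+ n]mulr1 coef_tXnM // coef_trunc1.
by case: ltngtP => [//|ni|->]; rewrite ?subnn // subn_eq0 leqNgt ni.
Qed.

Lemma tX_nilp : tX ^+ p = 0.
Proof.
by apply: truncP => i ip; rewrite coef_tXn // ltn_eqF // coef0.
Qed.

Lemma trunc_sum q : q = \sum_(i < p) q`_i *: tX ^+ i.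
Proof.
apply: truncP => i ip; rewrite coefn_sum (bigD1 (Ordinal ip)) //= big1.
  by rewrite addr0 coefZ coef_tXn // eqxx mulr1.
by move=> j ji; rewrite coefZ coef_tXn // [_ == _]negbTE ?mulr0 // eq_sym.
Qed.

Lemma trunc_eps_lin c q (r : R) :
  trunc_eps (c *: q + r) = c * trunc_eps q + trunc_eps r :> K.
Proof. by rewrite /trunc_eps coefD coefZ. Qed.

Lemma trunc_eps1 : trunc_eps (1 : R) = 1 :> K.
Proof. by rewrite /trunc_eps -[1](expr0 tX) coef_tXn ?eqxx. Qed.

Lemma trunc_epsM q (r : R) : trunc_eps (q * r) = trunc_eps q * trunc_eps r :> K.
Proof. by rewrite /trunc_eps coef_truncM p_gt0 coefM big_ord1. Qed.

Definition trunc_shift q : R := in_qpoly 'X^p (drop_poly 1 q).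

Definition trunc_top q : R := (q`_p.-1)%:A.

Lemma coef_trunc_shift q i : (i < p)%N -> (trunc_shift q)`_i = q`_i.+1.
Proof. by move=> ip; rewrite coef_in_trunc ip coef_drop_poly addn1. Qed.

Lemma coef_truncC (c : K) i : (c%:A : R)`_i = c * (i == 0)%:R.
Proof. by rewrite coefZ coef_trunc1. Qed.

Lemma trunc_shift_lin : linear trunc_shift.
Proof.
by move=> c q r; apply: truncP => i ip; rewrite coefD coefZ !coef_trunc_shift // coefD coefZ.
Qed.

Lemma trunc_top_lin : linear trunc_top.
Proof. by move=> c q r; rewrite /trunc_top coefD coefZ scalerDl scalerA. Qed.

Lemma tX_shift q : tX * trunc_shift q = q - (trunc_eps q)%:A.
Proof.
apply: truncP => i ip; rewrite -[tX]expr1 coef_tXnM // coefB coef_truncC.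
case: i ip => [|i] ip /=; first by rewrite mulr1 subrr.
by rewrite subn1 coef_trunc_shift ?mulr0 ?subr0 // ltnW.
Qed.

Lemma tXp1_top q : tX ^+ p.-1 * trunc_top q = q - trunc_shift (tX * q).
Proof.
apply: truncP => i ip; rewrite coef_tXnM // coefB coef_trunc_shift //.
rewrite coef_truncC.
have [ip1|ip1] := ltnP i p.-1.
  by rewrite -[tX]expr1 coef_tXnM ?subn1 ?subrr // -(prednK p_gt0) ltnS.
have -> : i = p.-1 by apply/eqP; rewrite eqn_leq ip1 -ltnS prednK // ip.
by rewrite subnn mulr1 prednK // (coef_trunc_ge (tX * q)) // subr0.
Qed.

Lemma tX_shift_top q : tX * trunc_shift q = q - trunc_top (tX ^+ p.-1 * q).
Proof.
by rewrite tX_shift /trunc_top coef_tXnM ?ltnn ?subnn ?prednK.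
Qed.

(* The contracting homotopy of the periodic resolution of [K] over [K[t]/t^p]. *)
Definition trunc_htpy n q : R := if odd n then trunc_top q else trunc_shift q.

(** The comparison map from the bar to the periodic resolution, at [1[s]]. Of the boundary of
    [1[a | s]] only [a[s]] contributes, since the homotopy composed with itself is zero and
    [trunc_shift] kills constants. *)
Fixpoint trunc_cmp s : R := if s is a :: s' then trunc_htpy (size s') (a * trunc_cmp s') else 1.

Lemma trunc_htpy_lin n : linear (trunc_htpy n).
Proof.
move=> c q r; rewrite /trunc_htpy; case: (odd n).
  exact: trunc_top_lin.
exact: trunc_shift_lin.
Qed.

Lemma trunc_htpyP n q : pdiff p tX n.+1 * trunc_htpy n.+1 q =
  q - trunc_htpy n (pdiff p tX n * q).
Proof.
rewrite /trunc_htpy /pdiff /=; case: (odd n) => /=; first exact: tX_shift_top.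
exact: tXp1_top.
Qed.

Lemma multilinear_trunc_cmp n : multilinear n trunc_cmp.
Proof.
elim: n => //= n IH; split=> [c a b s ss|a].
  by rewrite mulrDl -scalerAl trunc_htpy_lin.
apply: (@multilinear_ext _ _ _ _ (fun s => trunc_htpy n (a * trunc_cmp s))) => [s <- //|].
apply: (multilinear_comp (h := fun x => trunc_htpy n (a * x)) _ IH) => c x y.
by rewrite mulrDr -scalerAr trunc_htpy_lin.
Qed.

(** The chain map property, tested against a linear form [g]; the form is arbitrary so that the
    induction can pass from [g] to [x |-> g (a * trunc_htpy n x)]. *)
Lemma trunc_cmp_chain n (g : R -> K) a s :
  (forall c x y, g (c *: x + y) = c * g x + g y) -> size s = n.+1 ->
  bar_tail (@trunc_eps K p) (fun r => g (head 0 r * trunc_cmp (behead r))) a s =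
  g (a * (pdiff p tX n * trunc_cmp s)).
Proof.
elim: n g a s => [|n IH] g a [|b s] // gl [ss].
  case: s ss => //= _; rewrite /trunc_htpy /pdiff /= tX_shift !mulr1.
  have := gl (- trunc_eps b) a (a * b).
  rewrite mulrBr -scalerAr mulr1 scaleNr addrC => ->.
  by rewrite mulrC; ring.
rewrite [LHS]/= (@eq_bar_tail _ _ _ _ (fun r => g (a * trunc_htpy n (head 0 r * trunc_cmp (behead r))))); last first.
  by case=> [|c r]; rewrite ss => //= -[<-].
rewrite (IH (fun x => g (a * trunc_htpy n x))) //; last first.
  by move=> c x y; rewrite trunc_htpy_lin mulrDr -scalerAr gl.
rewrite [trunc_cmp (b :: s)]/= ss trunc_htpyP [b * (_ * _)]mulrCA mulrBr.
have := gl (-1) (a * trunc_htpy n (pdiff p tX n * (b * trunc_cmp s))) (a * (b * trunc_cmp s)).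
by rewrite scaleN1r addrC => ->; rewrite !mulrA mulN1r addrC.
Qed.

Lemma complex_tX : complex (@trunc_eps K p) (pdiff p tX).
Proof. exact: (complex_pdiff trunc_eps_lin trunc_eps1 trunc_epsM p_gt2 tX_nilp). Qed.

Lemma trunc_coboundary n F : cocycle (@trunc_eps K p) n F ->
  F (pcyc p tX n) = 0 -> coboundary (@trunc_eps K p) n F.
Proof.
apply: (@coboundary_of_eq0 _ _ _ trunc_eps_lin trunc_eps1 trunc_epsM trunc_cmp (pcyc p tX)) => //.
- exact: multilinear_trunc_cmp.
- exact: size_cyc.
move=> {}n f s fm ss.
have [fl _] := fm.
rewrite /= (trunc_cmp_chain (g := fun x => f (x :: pcyc p tX n)) 1 _ ss); last first.
  by move=> c x y; rewrite fl // size_cyc.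
by have /= -> := resd_cyc (trunc_cmp s) complex_tX fm; rewrite mul1r mulrC.
Qed.

(** These cocycles represent generators of the cohomology of [K[t]/t^p]; they later supply classes
    that do not vanish at a point. *)
Lemma cocycle_trunc_cmp n :
  cocycle (@trunc_eps K p) n (fun s => trunc_eps (trunc_cmp s)).
Proof.
split=> [|[|a s] // [ss]].
  apply/cochainP; apply: (multilinear_comp (W := K^o) _ (multilinear_trunc_cmp n)).
  exact: trunc_eps_lin.
have as_ : size (a :: s) = n.+1 by rewrite /= ss.
have := trunc_cmp_chain 1 trunc_eps_lin as_.
rewrite mul1r [RHS]trunc_epsM complex_tX.2 mul0r /= !mul1r trunc_epsM bar_diffE => <-.
by congr (_ - _); apply: eq_bar_tail => r _; rewrite mul1r.
Qed.

Lemma trunc_shift_tX : trunc_shift tX = 1.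
Proof.
apply: truncP => i ip; rewrite coef_trunc_shift // coef_trunc1 -[tX]mulr1.
have [ip1|ip1] := ltnP i.+1 p; first by rewrite coef_tXM // coef_trunc1.
by rewrite coef_trunc_ge //; case: i ip ip1 => // _; rewrite leqNgt p_gt1.
Qed.

Lemma trunc_cmp_pcyc2 : trunc_cmp (pcyc p tX 2) = 1.
Proof.
rewrite /= /pdiff /trunc_htpy /= mulr1 trunc_shift_tX.
by rewrite mulr1 /trunc_top coef_tXn ?eqxx ?scale1r // ltn_predL.
Qed.

End TruncPoly.

(** * Base change *)

Section Augmentation.
Variables (k : fieldType) (A : algType k) (eps : {lrmorphism A -> k^o}).

Lemma aug_lin (c : k) a b : (eps (c *: a + b) : k) = c * eps a + eps b.
Proof. by rewrite linearP. Qed.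

Lemma aug1 : (eps 1 : k) = 1. Proof. exact: rmorph1. Qed.

Lemma augM a b : (eps (a * b) : k) = eps a * eps b. Proof. exact: rmorphM. Qed.

Lemma augD a b : (eps (a + b) : k) = eps a + eps b. Proof. exact: linearD. Qed.

Lemma aug_scalar (c : k) : (eps c%:A : k) = c.
Proof. by rewrite linearZ /= rmorph1 /GRing.scale /= mulr1. Qed.

Lemma cocycle_const (c : k) : cocycle eps 0 (fun=> c).
Proof.
split=> [|[|a []] // _]; first exact/cochainP.
by rewrite bar_diffE /= mulrC subrr.
Qed.

Lemma cocycle_cupX n f m : cocycle eps n f -> cocycle eps (m * n) (cupX n f m).
Proof.
move=> fc; elim: m => [|m IH]; first exact: cocycle_const.
by rewrite mulSn; apply: cocycle_cup.
Qed.

End Augmentation.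

Lemma cocycle_comp (k : fieldType) (A B : algType k) (epsA : A -> k) (epsB : B -> k)
    (h : {lrmorphism A -> B}) n (F : seq B -> k) :
  (forall a, epsB (h a) = epsA a) -> cocycle epsB n F ->
  cocycle epsA n (fun s => F (map h s)).
Proof.
move=> eh [/cochainP Fm Fd]; split.
  apply/cochainP; elim: n F Fm {Fd} => //= m IH F [Fl Fa].
  split=> [c a b s ss|a]; first by rewrite linearP Fl // size_map.
  exact: (IH (fun r => F (_ :: r))).
case=> // q s [ss]; have := Fd (map h (q :: s)).
rewrite /= size_map ss => /(_ erefl) <-; rewrite !bar_diffE eh; congr (_ - _).
elim: s q F {ss Fm Fd} => [|r s IH] q F /=; first by rewrite eh.
by rewrite rmorphM (IH _ (fun r => F (_ :: r))).
Qed.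

Section CycCup.
Variables (k : fieldType) (A : algType k).
Implicit Types (d : nat -> A) (F G : seq A -> k).

Lemma take_cyc d m n : take m (cyc d (m + n)) = cyc (fun i => d (i + n)%N) m.
Proof. by elim: m => [|m IH]; rewrite ?take0 //= IH. Qed.

Lemma drop_cyc d m n : drop m (cyc d (m + n)) = cyc d n.
Proof. by elim: m => [|m IH]; rewrite ?drop0 //= IH. Qed.

Lemma eq_cyc d d' n : d =1 d' -> cyc d n = cyc d' n.
Proof. by move=> e; elim: n => //= n ->; rewrite e. Qed.

Lemma cup_cyc d m n F G :
  cup m F G (cyc d (m + n)) = F (cyc (fun i => d (i + n)%N) m) * G (cyc d n).
Proof. by rewrite /cup take_cyc drop_cyc. Qed.

Lemma cup_pcyc p u m n F G : ~~ odd n ->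
  cup m F G (pcyc p u (m + n)) = F (pcyc p u m) * G (pcyc p u n).
Proof.
move=> n_even; rewrite /pcyc cup_cyc; congr (F _ * _).
by apply: eq_cyc => i; rewrite /pdiff oddD (negPf n_even) addbF.
Qed.

Lemma cup_pcyc_odd p u m n F G : odd n ->
  cup m F G (pcyc p u (m + n)) = F (cyc (fun i => pdiff p u i.+1) m) * G (pcyc p u n).
Proof.
move=> n_odd; rewrite /pcyc cup_cyc; congr (F _ * _).
by apply: eq_cyc => i; rewrite /pdiff oddD n_odd addbT.
Qed.

Lemma cupX_pcyc p u n F m : ~~ odd n ->
  cupX n F m (pcyc p u (m * n)) = F (pcyc p u n) ^+ m.
Proof.
move=> n_even; elim: m => //= m IH.
by rewrite mulSn cup_pcyc ?oddM ?(negPf n_even) ?andbF // IH exprS.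
Qed.

End CycCup.

Section BaseChange.
Variables (k K : fieldType) (iota : {rmorphism k -> K}).
Variables (A : falgType k) (B : falgType K) (j : {lrmorphism A -> B | iota \; *:%R}).
Hypothesis jbasis : basis_of {:B} (map j (vbasis {:A})).
Implicit Types (f : seq A -> k) (F : seq B -> K).

Local Notation e := (vbasis {:A}).

Lemma base_change_scale (c : k) (a : A) : j (c *: a) = iota c *: j a.
Proof. exact: linearZ. Qed.

Lemma base_change_sum (a : A) : j a = \sum_(i < \dim {:A}) iota (coord e i a) *: j e`_i.
Proof.
rewrite {1}(coord_vbasis (memvf a)) linear_sum; apply: eq_bigr => i _.
exact: base_change_scale.
Qed.

Lemma base_change_span (b : B) :
  exists c : 'I_(\dim {:A}) -> K, b = \sum_i c i *: j e`_i.
Proof.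
have /= := coord_basis (X := [tuple of map j e]) jbasis (memvf b).
set X := [tuple of _] => E; exists (fun i => coord X i b).
by rewrite {1}E; apply: eq_bigr => i _; rewrite (nth_map 0) // size_tuple.
Qed.

Fixpoint ext_cochain f (s : seq B) : K :=
  if s is a :: s' then
    \sum_(i < \dim {:A}) coord [tuple of map j e] i a * ext_cochain (fun r => f (e`_i :: r)) s'
  else iota (f [::]).

Lemma multilinear_ext_cochain n f : multilinear (V := K^o) n (ext_cochain f).
Proof.
elim: n f => //= n IH f; split=> [c a b s _|a].
  rewrite /GRing.scale /= mulr_sumr -big_split /=; apply: eq_bigr => i _.
  by rewrite linearP /= mulrDl mulrA.
by apply: (multilinear_sumf (V := K^o)) => i; apply: IH.
Qed.

Lemma multilinear_base_change_eq n F F' :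
  multilinear (V := K^o) n F -> multilinear (V := K^o) n F' ->
  (forall s, size s = n -> F (map j s) = F' (map j s)) ->
  forall s, size s = n -> F s = F' s.
Proof.
elim: n F F' => [|n IH] F F' Fm Fm' E [|b s] // ss; first exact: (E [::]).
have [c ->] := base_change_span b; case: ss => ss.
rewrite (multilinear_sum (V := K^o) _ _ _ Fm) // (multilinear_sum (V := K^o) _ _ _ Fm') //.
apply: eq_bigr => i _; apply: congr1.
apply: (IH (fun r => F (_ :: r)) (fun r => F' (_ :: r))) => //.
- exact: multilinear_cons.
- exact: multilinear_cons.
- by move=> r rs; apply: (E (_ :: r)); rewrite /= rs.
Qed.

Lemma ext_cochainE n f s : multilinear (V := k^o) n f -> size s = n ->
  ext_cochain f (map j s) = iota (f s).
Proof.
elim: n f s => [|n IH] f [|a s] // fm [ss] /=.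
rewrite {2}(coord_vbasis (memvf a)) (multilinear_sum (V := k^o) _ _ _ fm) // rmorph_sum.
apply: eq_bigr => i _; rewrite (IH _ _ (multilinear_cons _ fm)) // rmorphM; congr (_ * _).
set X := [tuple of _].
have XE l : (l < \dim {:A})%N -> j e`_l = X`_l.
  by move=> ll; rewrite (nth_map 0) // size_tuple.
rewrite base_change_sum (eq_bigr (fun l : 'I_(\dim {:A}) => iota (coord e l a) *: X`_l)).
  by rewrite coord_sum_free //; apply: basis_free jbasis.
by move=> l _; rewrite XE.
Qed.

Section Augmented.
Variables (eps : {lrmorphism A -> k^o}) (epsB : {lrmorphism B -> K^o}).
Hypothesis epsBj : forall a, epsB (j a) = iota (eps a).

Lemma bar_tail_base_change F f a s :
  (forall r, size r = size s -> F (map j r) = iota (f r)) ->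
  bar_tail epsB F (j a) (map j s) = iota (bar_tail eps f a s).
Proof.
elim: s F f a => [|b s IH] F f a E /=.
  by rewrite (E [::]) // epsBj -rmorphM.
rewrite -[j a * j b](rmorphM j) -map_cons E // rmorphB; congr (_ - _).
by apply: (IH (fun r => F (_ :: r)) (fun r => f (_ :: r))) => r rs; rewrite -map_cons E /= ?rs.
Qed.

(** The differential of a multilinear map is multilinear, so it is enough to test on sequences that
    come from [A]. *)
Lemma cocycle_ext_cochain n f : cocycle eps n f -> cocycle epsB n (ext_cochain f).
Proof.
move=> [/cochainP fm fd].
have Fm := multilinear_ext_cochain n f.
split=> [|s ss]; first exact/cochainP.
apply: (@multilinear_base_change_eq n.+1 _ (fun=> 0)) ss.
- exact: (multilinear_bar_diff (aug_lin epsB) Fm).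
- exact: multilinear_cst0.
case=> // a r [rs]; rewrite /= bar_diffE.
have E r' : size r' = n -> ext_cochain f (map j r') = iota (f r') by apply: ext_cochainE.
rewrite E // (bar_tail_base_change (f := f)) ?rs // epsBj -rmorphM -rmorphB -bar_diffE.
by rewrite fd ?rmorph0 //= rs.
Qed.

End Augmented.
End BaseChange.

(** * The ideal of a pi-point in terms of values on a cycle *)

Section PiPoint.
Variables (p : nat) (k : fieldType) (A : falgType k).
Variables (eps : {lrmorphism A -> k^o}) (G : group_scheme eps).
Variable alpha : pi_point p G.
Hypothesis p_gt2 : (2 < p)%N.

Local Notation K := (ext_field alpha).
Local Notation B := (ext_alg alpha).
Local Notation epsB := (ext_eps alpha).

Hypothesis mulC : forall a b : B, a * b = b * a.

Definition pi_elt : B := pi_map alpha (tX K p).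

Definition pi_value n (f : seq A -> k) : K :=
  ext_cochain (ext_map alpha) f (pcyc p pi_elt n).

Lemma pi_elt_nilp : pi_elt ^+ p = 0.
Proof. by rewrite -rmorphXn tX_nilp // rmorph0. Qed.

Lemma pi_elt_eps : epsB pi_elt = 0.
Proof.
exact: (eps_nilp (aug_lin epsB) (aug1 epsB) (augM epsB) pi_elt_nilp).
Qed.

Lemma pi_map_eps q : epsB (pi_map alpha q) = trunc_eps q.
Proof.
rewrite (trunc_sum p_gt2 q) linear_sum linear_sum /= -(trunc_sum p_gt2 q).
have p0 : (0 < p)%N by case: p p_gt2.
rewrite (bigD1 (Ordinal p0)) //= big1 ?addr0.
  by rewrite expr0 linearZ /= rmorph1 linearZ /= rmorph1 /GRing.scale /= mulr1.
have tXi i : epsB (pi_map alpha (tX K p ^+ i)) = 0 ^+ i.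
  by rewrite (rmorphXn (pi_map alpha)) (rmorphXn epsB) /= [X in X ^+ _]pi_elt_eps.
move=> i i0; rewrite linearZ linearZ /= tXi expr0n.
by rewrite (negbTE (_ : nat_of_ord i != 0)%N) ?scaler0.
Qed.

Lemma map_pcyc n : map (pi_map alpha) (pcyc p (tX K p) n) = pcyc p pi_elt n.
Proof.
elim: n => //= n ->; congr (_ :: _); rewrite /pdiff; case: (odd n) => //.
by rewrite rmorphXn.
Qed.

(** Coboundaries vanish on the cycle of [t], and by [trunc_coboundary] nothing else does among
    cocycles. The extension [F] in [pi_kernel] is unique on sequences of length [n]. *)
Lemma pi_kernelP n f : cocycle eps n f ->
  pi_kernel alpha n f <-> pi_value n f = 0.
Proof.
move=> fc; have [/cochainP fm _] := fc.
have Fc := cocycle_ext_cochain (ext_basis alpha) (ext_eps_map alpha) fc.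
have [/cochainP Fm _] := Fc.
have tP := complex_tX K p_gt2.
split=> [[F [/cochainP Fm' FE Fb]]|f0].
  rewrite /pi_value -(multilinear_base_change_eq (ext_basis alpha) Fm' Fm).
  - by have := coboundary_cyc tP Fb; rewrite map_pcyc.
  - by move=> s ss; rewrite FE // (ext_cochainE (ext_basis alpha) fm).
  - exact: size_cyc.
exists (ext_cochain (ext_map alpha) f); split.
- exact/cochainP.
- by move=> s ss; apply: (ext_cochainE (ext_basis alpha) fm).
apply: trunc_coboundary => //; last by rewrite map_pcyc.
exact: (cocycle_comp pi_map_eps Fc).
Qed.

Lemma cupX_map n m f F s : (forall s, size s = n -> F (map (ext_map alpha) s) = ext_in alpha (f s)) ->
  size s = (m * n)%N -> cupX n F m (map (ext_map alpha) s) = ext_in alpha (cupX n f m s).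
Proof.
move=> FE; elim: m s => [|m IH] s ss /=; first by rewrite rmorph1.
rewrite /cup -map_take -map_drop rmorphM FE ?IH // ?size_drop ?ss ?mulSn ?addKn //.
by rewrite size_takel // ss mulSn leq_addr.
Qed.

Lemma pi_value_cupX n m f : cocycle eps n f ->
  pi_value (m * n) (cupX n f m) =
  cupX n (ext_cochain (ext_map alpha) f) m (pcyc p pi_elt (m * n)).
Proof.
move=> fc; have [/cochainP fm _] := fc.
have [/cochainP fXm _] := cocycle_cupX m fc.
have Fc := cocycle_ext_cochain (ext_basis alpha) (ext_eps_map alpha) fc.
have [/cochainP FXm _] := cocycle_cupX m Fc.
apply: (multilinear_base_change_eq (ext_basis alpha) _ FXm); last exact: size_cyc.
  exact: (multilinear_ext_cochain (ext_map alpha) (m * n)).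
move=> s ss; rewrite (ext_cochainE (ext_basis alpha) fXm) //; symmetry.
by apply: cupX_map ss => r rs; apply: (ext_cochainE (ext_basis alpha) fm).
Qed.

(** In even degree the value of a power is the power of the value, in a field, so taking the radical
    adds nothing. *)
Lemma pi_idealP n f :
  pi_ideal alpha n f <-> cocycle eps n f /\ (odd n \/ pi_value n f = 0).
Proof.
split=> [[fc [m fm]]|[fc f0]]; (split; first exact: fc).
  move: fm => /(pi_kernelP (cocycle_cupX m fc)); rewrite pi_value_cupX //.
  case: (boolP (odd n)) => n_odd; first by left.
  rewrite cupX_pcyc // => /eqP; rewrite expf_eq0 => /andP[_ /eqP f0].
  by right; exact: f0.
case: (boolP (odd n)) f0 => n_odd f0.
  (* The square of an odd class vanishes: cutting the cycle at the odd position leaves a shifted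
     cycle as its first half. *)
  exists 2%N; apply/(pi_kernelP (cocycle_cupX 2 fc)); rewrite pi_value_cupX //.
  rewrite [cupX _ _ _]/= mulSn cup_pcyc_odd; last by rewrite mul1n.
  rewrite (cocycle_pcyc_odd (aug_lin epsB) (aug1 epsB) (augM epsB) p_gt2 mulC pi_elt_nilp n_odd) ?mul0r //.
  exact (cocycle_ext_cochain (ext_basis alpha) (ext_eps_map alpha) fc).
case: f0 => [//|f0]; exists 1%N; apply/(pi_kernelP (cocycle_cupX 1 fc)); rewrite pi_value_cupX //.
by rewrite cupX_pcyc // -/(pi_value n f) f0 expr1.
Qed.

End PiPoint.

(** * The algebra k[x, y]/(x^p, y^p) *)

Lemma exprDn_comm_pchar (S : nzRingType) p (a b : S) : p \in [pchar S] ->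
  GRing.comm a b -> (a + b) ^+ p = a ^+ p + b ^+ p.
Proof.
by move=> pS ab; rewrite -!(pFrobenius_autE pS) pFrobenius_autD_comm.
Qed.

(* [A] is the algebra generated by two commuting elements [x] and [y] subject
   to [x ^+ p = y ^+ p = 0]. *)
Record trunc_gens (k : fieldType) (p : nat) (A : falgType k) (x y : A) : Prop := TruncGens {
  tg_comm : x * y = y * x;
  tg_nilpx : x ^+ p = 0;
  tg_nilpy : y ^+ p = 0;
  tg_map : forall (B : algType k) (b c : B), b * c = c * b -> b ^+ p = 0 -> c ^+ p = 0 ->
    exists h : {lrmorphism A -> B}, h x = b /\ h y = c;
  tg_uniq : forall (B : algType k) (h h' : {lrmorphism A -> B}),
    h x = h' x -> h y = h' y -> h =1 h'
}.

Section TruncGens.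
Variables (k : fieldType) (p : nat) (A : falgType k) (x y : A).
Hypothesis pk : p \in [pchar k].
Hypothesis xyP : trunc_gens p x y.

Let pA : p \in [pchar A]. Proof. by rewrite pchar_lalg. Qed.
Let p_gt0 : (0 < p)%N. Proof. exact: prime_gt0 (pcharf_prime pk). Qed.

(** The universal property gives a map from [A] to the subalgebra [T]; followed by the inclusion it
    fixes [x] and [y], hence is the identity. *)
Lemma tg_full (T : {vspace A}) : 1 \in T ->
  (forall a b, a \in T -> b \in T -> a * b \in T) -> x \in T -> y \in T ->
  forall a, a \in T.
Proof.
move=> T1 TM Tx Ty.
have Ta : is_aspace T by rewrite /is_aspace has_algid1 //=; apply/prodvP.
pose T' := ASpace Ta.
pose i : {lrmorphism subvs_of T' -> A} :=
  HB.pack_for {lrmorphism subvs_of T' -> A} (@vsval k A T')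
   (GRing.isMonoidMorphism.Build (subvs_of T') A (@vsval k A T')
     (conj (eqP (etrans (algid_eq1 T') T1)) (fun a b => erefl))).
have iX (a : subvs_of T') n : i (a ^+ n) = (i a) ^+ n by rewrite rmorphXn.
have [] := tg_map xyP (b := Subvs Tx : subvs_of T') (c := Subvs Ty : subvs_of T').
- by apply: val_inj; apply: (tg_comm xyP).
- apply: val_inj; rewrite -[LHS]/(i _) -[RHS]/(i _) iX rmorph0; exact: (tg_nilpx xyP).
- apply: val_inj; rewrite -[LHS]/(i _) -[RHS]/(i _) iX rmorph0; exact: (tg_nilpy xyP).
move=> h [hx hy] a.
have := tg_uniq xyP (h := i \o h) (h' := idfun).
rewrite /= hx hy /= => /(_ erefl erefl a) /= <-.
exact: subvsP.
Qed.

(** The centralizer of an element, as the kernel of left minus right multiplication, is a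
    subalgebra, so [tg_full] applies. *)
Lemma tg_commx a : x * a = a * x.
Proof.
have := @tg_full (lker (amull x - amulr x)).
suff H : forall b, (b \in lker (amull x - amulr x)) = (x * b == b * x).
  move=> /(_ _ _ _ _ a); rewrite !H => H'; apply/eqP/H'; rewrite ?mul1r ?mulr1 ?(tg_comm xyP) //.
  by move=> b c; rewrite !H => /eqP E /eqP E'; rewrite mulrA E -mulrA E' mulrA.
by move=> b; rewrite memv_ker add_lfunE opp_lfunE !lfunE /= subr_eq0.
Qed.

Lemma tg_commy a : y * a = a * y.
Proof.
have := @tg_full (lker (amull y - amulr y)).
suff H : forall b, (b \in lker (amull y - amulr y)) = (y * b == b * y).
  move=> /(_ _ _ _ _ a); rewrite !H => H'; apply/eqP/H'; rewrite ?mul1r ?mulr1 ?(tg_comm xyP) //.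
  by move=> b c; rewrite !H => /eqP E /eqP E'; rewrite mulrA E -mulrA E' mulrA.
by move=> b; rewrite memv_ker add_lfunE opp_lfunE !lfunE /= subr_eq0.
Qed.

Lemma tg_mulC (a b : A) : a * b = b * a.
Proof.
have := @tg_full (lker (amull a - amulr a)).
suff H : forall b, (b \in lker (amull a - amulr a)) = (a * b == b * a).
  move=> /(_ _ _ _ _ b); rewrite !H => H'; apply/eqP/H'; rewrite ?mul1r ?mulr1 ?tg_commx ?tg_commy //.
  by move=> c d; rewrite !H => /eqP E /eqP E'; rewrite mulrA E -mulrA E' mulrA.
by move=> c; rewrite memv_ker add_lfunE opp_lfunE !lfunE /= subr_eq0.
Qed.

Lemma tg_decomp (a : A) : exists c r s, a = c%:A + x * r + y * s.
Proof.
have := @tg_full (<[1]> + limg (amull x) + limg (amull y))%VS.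
set T := (_ + _ + _)%VS.
have TP b : reflect (exists c r s, b = c%:A + x * r + y * s) (b \in T).
  apply: (iffP memv_addP) => [[u /memv_addP[u1 /vlineP[c ->] [_ /memv_imgP[r _ ->] ->]]
    [_ /memv_imgP[s _ ->] ->]]|[c [r [s ->]]]].
    by exists c, r, s; rewrite !lfunE.
  exists (c%:A + x * r); last first.
    by exists (y * s) => //; apply/memv_imgP; exists s; rewrite ?memvf ?lfunE.
  apply/memv_addP; exists c%:A; first by rewrite memvZ ?memv_line.
  by exists (x * r) => //; apply/memv_imgP; exists r; rewrite ?memvf ?lfunE.
move=> H; apply/TP/H.
- by apply/TP; exists 1, 0, 0; rewrite scale1r !mulr0 !addr0.
- move=> _ b /TP[c [r [s ->]]] /[dup] /TP[c' [r' [s' bE]]] _; apply/TP.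
  exists (c * c'), (c *: r' + r * b), (c *: s' + s * b).
  rewrite !mulrDl !mulrDr mulr_algl -!mulrA -!scalerAr.
  have -> : c *: b = c *: (c'%:A + x * r' + y * s') by rewrite -bE.
  rewrite !scalerDr scalerA -!addrA; congr (_ + (_ + _)).
  by rewrite addrCA.
- by apply/TP; exists 0, 1, 0; rewrite scale0r add0r mulr1 mulr0 addr0.
- by apply/TP; exists 0, 0, 1; rewrite scale0r add0r mulr1 mulr0 add0r.
Qed.

(** The substitution is invertible: to send [x + c y^2] to [b] and [y] to [d], send [x] to
    [b - c d^2]. Frobenius gives the nilpotency of both elements. *)
Lemma tg_shift (c : k) : (2 < p)%N -> trunc_gens p (x + c *: y ^+ 2) y.
Proof.
move=> p_gt2; have y2p : (c *: y ^+ 2) ^+ p = 0.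
  by rewrite exprZn -exprM mulnC exprM (tg_nilpy xyP) expr0n /= scaler0.
split; rewrite ?(tg_nilpy xyP) //.
- exact: tg_mulC.
- by rewrite exprDn_comm_pchar ?(tg_nilpx xyP) ?y2p ?addr0 //; apply: tg_mulC.
- move=> B b d bd bp dp.
  have pB : p \in [pchar B] by rewrite pchar_lalg.
  have bd2 : GRing.comm b (- (c *: d ^+ 2)).
    by apply: commrN; rewrite /GRing.comm -scalerAr -scalerAl; congr (_ *: _); apply: commrX.
  have [] := tg_map xyP (b := b - c *: d ^+ 2) (c := d) _ _ dp.
  - rewrite mulrBl mulrBr bd -scalerAl -scalerAr; congr (_ - _ *: _).
    by rewrite -exprS -exprSr.
  - rewrite exprDn_comm_pchar // bp add0r exprNn exprZn -exprM mulnC exprM dp.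
    by rewrite expr0n /= scaler0 mulr0.
  move=> h [hx hy]; exists h; split=> //; rewrite linearD linearZ /= (rmorphXn h) hx /= hy.
  by rewrite subrK.
move=> B h h' hx hy; apply: (tg_uniq xyP) => //.
by move: hx; rewrite !linearD !linearZ /= (rmorphXn h) (rmorphXn h') /= hy => /addIr.
Qed.

Definition monomials (m : 'M[k]_p) : A := \sum_i \sum_j m i j *: (x ^+ i * y ^+ j).

Lemma monomials_linear : linear monomials.
Proof.
move=> c m n; rewrite /monomials scaler_sumr -big_split; apply: eq_bigr => i _.
rewrite scaler_sumr -big_split; apply: eq_bigr => j _.
by rewrite !mxE scalerDl scalerA.
Qed.
HB.instance Definition _ := GRing.isLinear.Build k 'M[k]_p A _ monomials monomials_linear.

Lemma monomials_surj a : exists m, a = monomials m.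
Proof.
have := @tg_full (limg (linfun monomials)); set T := limg _.
have Tm i j : x ^+ i * y ^+ j \in T.
  have [ip|pi] := ltnP i p; last first.
    by rewrite -(subnK pi) exprD (tg_nilpx xyP) mulr0 mul0r mem0v.
  have [jp|pj] := ltnP j p; last first.
    by rewrite -(subnK pj) exprD (tg_nilpy xyP) !mulr0 mem0v.
  apply/memv_imgP; exists (delta_mx (Ordinal ip) (Ordinal jp)); rewrite ?memvf // lfunE /=.
  rewrite /monomials (bigD1 (Ordinal ip)) //= (bigD1 (Ordinal jp)) //= !mxE !eqxx scale1r.
  rewrite !big1 ?addr0 // => [i' i'i|j' j'j]; last by rewrite !mxE (negPf j'j) andbF scale0r.
  by apply: big1 => j' _; rewrite !mxE (negPf i'i) scale0r.
move=> H; have /memv_imgP[m _ ->] : a \in T; last by exists m; rewrite lfunE.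
apply: H.
- by have := Tm 0%N 0%N; rewrite !expr0 mulr1.
- move=> _ _ /memv_imgP[m _ ->] /memv_imgP[n _ ->]; rewrite !lfunE /= /monomials.
  rewrite mulr_suml memv_suml // => i _; rewrite mulr_suml memv_suml // => j _.
  rewrite mulr_sumr memv_suml // => i' _; rewrite mulr_sumr memv_suml // => j' _.
  rewrite -scalerAl -scalerAr !memvZ //.
  have -> : x ^+ i * y ^+ j * (x ^+ i' * y ^+ j') = x ^+ (i + i') * y ^+ (j + j').
    by rewrite !exprD -!mulrA; congr (_ * _); rewrite mulrA [y ^+ _ * _]tg_mulC -mulrA.
  exact: Tm.
- by have := Tm 1%N 0%N; rewrite expr0 expr1 mulr1.
- by have := Tm 0%N 1%N; rewrite expr0 expr1 mul1r.
Qed.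

End TruncGens.

(** * Hopf structures *)

(** With zero bracket and zero restriction, a linear map on [g] extends to [u(g)] when its values
    commute and have zero [p]-th power; by Frobenius this can be tested on a basis. *)
Lemma envelope_trunc_gens (k : fieldType) (p : nat) (g : restrictedLie k p)
    (A : envelope g) : p \in [pchar k] -> \dim {:g} = 2%N ->
    (forall x y : g, lie_br x y = 0) -> (forall x : g, lie_pmap x = 0) ->
  exists z w : g, trunc_gens p (env_in A z) (env_in A w).
Proof.
move=> pk dimg br0 pmap0; have p_gt0 := prime_gt0 (pcharf_prime pk).
have [X Xb] : exists X : 2.-tuple g, basis_of {:g} X.
  move: (vbasisP {:g}); move: (vbasis {:g}); rewrite dimg => X Xb; by exists X.
have Xsum z : z = coord X 0 z *: X`_0 + coord X 1 z *: X`_1.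
  rewrite {1}(coord_basis Xb (memvf z)) !big_ord_recl big_ord0 addr0.
  by congr (_ + coord X _ z *: _); apply: val_inj.
have coordX i (l : 'I_2) : coord X i X`_l = (i == l)%:R.
  by rewrite coord_free ?(basis_free Xb) // eq_sym.
exists X`_0, X`_1; split.
- by apply/eqP; rewrite -subr_eq0 -env_in_br br0 linear0.
- by rewrite -env_in_pmap pmap0 linear0.
- by rewrite -env_in_pmap pmap0 linear0.
- move=> B b c bc bp cp.
  have pB : p \in [pchar B] by rewrite pchar_lalg.
  pose f (z : g) : B := coord X 0 z *: b + coord X 1 z *: c.
  have fl : linear f.
    move=> a z w; rewrite /f (linearP (coord X 0)) (linearP (coord X 1)) /=.
    by rewrite !scalerDl scalerDr !scalerA addrACA.
  pose f' : {linear g -> B} := HB.pack_for {linear g -> B} f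
    (GRing.isLinear.Build k g B _ f fl).
  have fC z w : f z * f w = f w * f z.
    rewrite /f !mulrDl !mulrDr -!scalerAl -!scalerAr !scalerA bc.
    rewrite ![_ * coord X _ z]mulrC; rewrite -!addrA; congr (_ + _).
    by rewrite !addrA; congr (_ + _); rewrite addrC.
  have [] := @env_ex _ _ _ A B f'.
  - by move=> z w; rewrite br0 linear0 /= fC subrr.
  - move=> z; rewrite pmap0 linear0 /= /f exprDn_comm_pchar //.
      by rewrite !exprZn bp cp !scaler0 addr0.
    by rewrite /GRing.comm -!scalerAl -!scalerAr bc !scalerA mulrC.
  move=> h hf; exists h; rewrite !hf /= /f.
  have := coordX 0 ord0; have := coordX 1 ord0; have := coordX 0 ord_max; have := coordX 1 ord_max.
  by move=> /= -> -> -> ->; rewrite /= !scale1r !scale0r addr0 add0r.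
move=> B h h' h0 h1; apply: env_uniq => z.
by rewrite (Xsum z) !linearD !linearZ /= h0 h1.
Qed.

Section TensorMaps.
Variable F : fieldType.

Lemma eq_tlift (U V T : vectType F) (f h : U -> V -> T) X :
  (forall u v, f u v = h u v) -> tlift f X = tlift h X.
Proof.
by move=> e; rewrite /tlift; apply: eq_bigr => i _; apply: eq_bigr => j _; rewrite e.
Qed.

Lemma linear_tlift (U V T T' : vectType F) (f : U -> V -> T) (h : {linear T -> T'}) X :
  h (tlift f X) = tlift (fun u v => h (f u v)) X.
Proof.
rewrite /tlift linear_sum; apply: eq_bigr => i _; rewrite linear_sum.
by apply: eq_bigr => j _; rewrite linearZ.
Qed.

Lemma tlift_tmap (U V U' V' T : vectType F) (f : U' -> V' -> T) (a : 'Hom(U, U'))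
    (b : 'Hom(V, V')) X : bilin f ->
  tlift f (tmap a b X) = tlift (fun u v => f (a u) (b v)) X.
Proof.
move=> fB; move: X; apply: tens_ext => [c X Y|c X Y|u v]; rewrite ?linearP //.
rewrite tmapE !tliftE //; split=> [v' c w w'|u' c w w']; rewrite linearP.
  exact: fB.1.
exact: fB.2.
Qed.

Lemma tmap_comp (U V U' V' U'' V'' : vectType F) (a : 'Hom(U, U')) (b : 'Hom(V, V'))
    (a' : 'Hom(U', U'')) (b' : 'Hom(V', V'')) X :
  tmap a' b' (tmap a b X) = tmap (a' \o a)%VF (b' \o b)%VF X.
Proof.
move: X; apply: tens_ext => [c X Y|c X Y|u v]; rewrite ?linearP //.
by rewrite !tmapE !comp_lfunE.
Qed.

Lemma tassoc_bilin (U V W : vectType F) :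
  bilin (fun (x : tens U V) (w : W) => tlift (fun u v => tpure u (tpure v w)) x).
Proof.
split=> [w|x c w w']; first exact: tlift_is_linear.
have [_ pr] := tpure_bilin V W; have [_ pr'] := tpure_bilin U (tens V W).
rewrite /tlift scaler_sumr -big_split; apply: eq_bigr => i _ /=.
rewrite scaler_sumr -big_split; apply: eq_bigr => j _ /=.
by rewrite pr pr' scalerDr !scalerA mulrC.
Qed.

Lemma tassoc_linear (U V W : vectType F) : linear (@tassoc F U V W).
Proof. exact: tlift_is_linear. Qed.

Lemma tassocE (U V W : vectType F) (u : U) (v : V) (w : W) :
  tassoc (tpure (tpure u v) w) = tpure u (tpure v w).
Proof.
rewrite /tassoc tliftE; last exact: tassoc_bilin.
rewrite tliftE //; have [pl pr] := tpure_bilin U (tens V W).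
have [ql qr] := tpure_bilin V W.
by split=> [v' c a a'|u' c a a']; rewrite ?pl // ql pr.
Qed.

Lemma tassoc_tmap (U V W U' V' W' : vectType F) (a : 'Hom(U, U')) (b : 'Hom(V, V'))
    (c : 'Hom(W, W')) X :
  tassoc (tmap (tmap a b) c X) = tmap a (tmap b c) (tassoc X).
Proof.
move: X; apply: tens_ext => [e X Y|e X Y|X w]; rewrite ?linearP ?tassoc_linear ?linearP //.
rewrite tmapE; move: X; apply: tens_ext => [e X Y|e X Y|u v].
- by rewrite linearP (tpure_bilin _ _).1 tassoc_linear.
- by rewrite (tpure_bilin _ _).1 tassoc_linear linearP.
by rewrite tmapE !tassocE !tmapE.
Qed.

Lemma tswapE (U V : vectType F) (u : U) (v : V) : tswap (tpure u v) = tpure v u.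
Proof.
rewrite /tswap tliftE //; have [pl pr] := tpure_bilin V U.
by split=> [v' c a a'|u' c a a']; rewrite ?pl ?pr.
Qed.

Lemma tswap_linear (U V : vectType F) : linear (@tswap F U V).
Proof. exact: tlift_is_linear. Qed.

Lemma tswap_tmap (U V U' V' : vectType F) (a : 'Hom(U, U')) (b : 'Hom(V, V')) X :
  tswap (tmap a b X) = tmap b a (tswap X).
Proof.
move: X; apply: tens_ext => [e X Y|e X Y|u v]; rewrite ?linearP ?tswap_linear ?linearP //.
by rewrite tmapE !tswapE tmapE.
Qed.

Lemma tmap_tmul (A B : falgType F) (f : {lrmorphism A -> B}) X Y :
  tmap (linfun f) (linfun f) (tmul X Y) =
  tmul (tmap (linfun f) (linfun f) X) (tmap (linfun f) (linfun f) Y).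
Proof.
have [ml mr] := tmul_bilin A; have [ml' mr'] := tmul_bilin B.
move: X; apply: tens_ext => [e X X'|e X X'|a b]; rewrite ?ml ?linearP ?ml' //.
move: Y; apply: tens_ext => [e Y Y'|e Y Y'|c d]; rewrite ?mr ?linearP ?mr' //.
by rewrite tmulE !tmapE tmulE !lfunE /= !rmorphM.
Qed.

End TensorMaps.

Section Twist.
Variables (k : fieldType) (A : falgType k) (eps : {lrmorphism A -> k^o}).
Variables (G : group_scheme eps) (f g : {lrmorphism A -> A}).
Hypotheses (fK : cancel f g) (gK : cancel g f).
Hypothesis eps_f : forall a, eps (f a) = eps a.

Local Notation lf := (linfun f).
Local Notation lg := (linfun g).

Definition twist_comul : 'Hom(A, tens A A) := (tmap lf lf \o comul G \o lg)%VF.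

Definition twist_antipode : 'End(A) := (lf \o antipode G \o lg)%VF.

Lemma twist_comulE a : twist_comul a = tmap lf lf (comul G (g a)).
Proof. by rewrite /twist_comul !comp_lfunE [lg a]lfunE. Qed.

Lemma twist_antipodeE a : twist_antipode a = f (antipode G (g a)).
Proof. by rewrite /twist_antipode !comp_lfunE !lfunE. Qed.

Lemma twist_comul1 : twist_comul 1 = tpure 1 1.
Proof. by rewrite twist_comulE rmorph1 comul1 tmapE lfunE /= rmorph1. Qed.

Lemma twist_comulM a b : twist_comul (a * b) = tmul (twist_comul a) (twist_comul b).
Proof. by rewrite !twist_comulE rmorphM comulM tmap_tmul. Qed.

Lemma twist_comulA a : tassoc (tmap twist_comul \1%VF (twist_comul a)) =
  tmap \1%VF twist_comul (twist_comul a).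
Proof.
have E : (twist_comul \o lf)%VF = (tmap lf lf \o comul G)%VF.
  by apply/lfunP => b; rewrite comp_lfunE twist_comulE comp_lfunE [lf b]lfunE /= fK.
rewrite !twist_comulE !tmap_comp E !comp_lfun1l.
have -> X : tmap (tmap lf lf \o comul G)%VF lf X = tmap (tmap lf lf) lf (tmap (comul G) \1%VF X).
  by rewrite tmap_comp comp_lfun1r.
by rewrite tassoc_tmap comulA tmap_comp comp_lfun1r.
Qed.

Lemma twist_counitl a : tlift (fun x y : A => eps x *: y) (twist_comul a) = a.
Proof.
rewrite twist_comulE tlift_tmap; last first.
  split=> [v c u u'|u c v v']; first by rewrite linearP scalerDl -scalerA.
  by rewrite scalerDr !scalerA mulrC.
rewrite -[RHS](gK a) -[in RHS](counitl G (g a)) linear_tlift.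
by apply: eq_tlift => u v; rewrite !lfunE /= linearZ /= eps_f.
Qed.

Lemma twist_counitr a : tlift (fun x y : A => eps y *: x) (twist_comul a) = a.
Proof.
rewrite twist_comulE tlift_tmap; last first.
  split=> [v c u u'|u c v v']; last by rewrite linearP scalerDl -scalerA.
  by rewrite scalerDr !scalerA mulrC.
rewrite -[RHS](gK a) -[in RHS](counitr G (g a)) linear_tlift.
by apply: eq_tlift => u v; rewrite !lfunE /= linearZ /= eps_f.
Qed.

Lemma twist_antipodel a :
  tlift (fun x y : A => twist_antipode x * y) (twist_comul a) = eps a *: 1.
Proof.
rewrite twist_comulE tlift_tmap; last first.
  split=> [v c u u'|u c v v']; first by rewrite linearP mulrDl -scalerAl.
  by rewrite mulrDr -scalerAr.
have eps_g : eps (g a) = eps a by rewrite -[in RHS](gK a) eps_f.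
rewrite -eps_g -[in RHS](rmorph1 f) -linearZ -(antipodel G) linear_tlift.
by apply: eq_tlift => u v; rewrite twist_antipodeE !lfunE /= fK rmorphM.
Qed.

Lemma twist_antipoder a :
  tlift (fun x y : A => x * twist_antipode y) (twist_comul a) = eps a *: 1.
Proof.
rewrite twist_comulE tlift_tmap; last first.
  split=> [v c u u'|u c v v']; first by rewrite mulrDl -scalerAl.
  by rewrite linearP mulrDr -scalerAr.
have eps_g : eps (g a) = eps a by rewrite -[in RHS](gK a) eps_f.
rewrite -eps_g -[in RHS](rmorph1 f) -linearZ -(antipoder G) linear_tlift.
by apply: eq_tlift => u v; rewrite twist_antipodeE !lfunE /= fK rmorphM.
Qed.

Lemma twist_comulC a : tswap (twist_comul a) = twist_comul a.
Proof. by rewrite !twist_comulE tswap_tmap comulC. Qed.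

Definition twist : group_scheme eps :=
  GroupScheme twist_comul1 twist_comulM twist_comulA twist_counitl twist_counitr
    twist_antipodel twist_antipoder twist_comulC.

End Twist.

(** * Modules *)

Lemma tpure_neq0 (F : fieldType) (U V : vectType F) (u : U) (v : V) :
  u != 0 -> v != 0 -> tpure u v != 0.
Proof.
have coord0 (W : vectType F) (w : W) : w != 0 -> exists i, coord (vbasis {:W}) i w != 0.
  move=> w0; apply/existsP; apply: contraNT w0; rewrite negb_exists => /forallP c0.
  rewrite (coord_vbasis (memvf w)) big1 // => i _.
  by have := c0 i; rewrite negbK => /eqP ->; rewrite scale0r.
move=> /coord0[i ui] /coord0[j vj]; apply/eqP => /matrixP/(_ i j)/eqP.
by rewrite !mxE mulf_eq0 (negPf ui) (negPf vj).
Qed.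

Section ModuleFacts.
Variables (k : fieldType) (A : algType k) (M : module A).

Lemma mod_actD a b m : mod_act M (a + b) m = mod_act M a m + mod_act M b m.
Proof. by rewrite -[a]scale1r mod_act_linear scale1r add_lfunE scale1r. Qed.

Lemma mod_act0 m : mod_act M 0 m = 0.
Proof. by have := mod_actD 0 0 m; rewrite addr0 => /eqP; rewrite -subr_eq0 opprD addNKr oppr_eq0 => /eqP. Qed.

Lemma mod_actZ c a m : mod_act M (c *: a) m = c *: mod_act M a m.
Proof. by rewrite -[c *: a]addr0 mod_act_linear add_lfunE scale_lfunE mod_act0 addr0. Qed.

Lemma mod_actMv a b m : mod_act M (a * b) m = mod_act M a (mod_act M b m).
Proof. by rewrite mod_actM comp_lfunE. Qed.

Lemma mod_act1v m : mod_act M 1 m = m.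
Proof. by rewrite mod_act1 id_lfunE. Qed.

Lemma mod_act_sum (I : Type) (r : seq I) (F : I -> A) m :
  mod_act M (\sum_(i <- r) F i) m = \sum_(i <- r) mod_act M (F i) m.
Proof.
elim: r => [|i r IH]; first by rewrite !big_nil mod_act0.
by rewrite !big_cons mod_actD IH.
Qed.

End ModuleFacts.

Section TruncModules.
Variables (K : fieldType) (p : nat).
Hypothesis p_gt2 : (2 < p)%N.
Local Notation R := (trunc_poly K p).
Local Notation t := (tX K p).

Let p_gt0 : (0 < p)%N. Proof. exact: ltnW (ltnW p_gt2). Qed.

Definition trunc_mul (q r : R) : R := q * r.

Lemma trunc_mul_linear q : linear (trunc_mul q).
Proof. by move=> c r s; rewrite /trunc_mul mulrDr scalerAr. Qed.
HB.instance Definition _ q := GRing.isLinear.Build K R R _ (trunc_mul q) (trunc_mul_linear q).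

Definition trunc_act q : 'End(R) := linfun (trunc_mul q).

Lemma trunc_actE q r : trunc_act q r = q * r. Proof. by rewrite lfunE. Qed.

Lemma trunc_act_linear : linear trunc_act.
Proof.
move=> c q r; apply/lfunP => s; rewrite add_lfunE scale_lfunE !trunc_actE.
by rewrite mulrDl scalerAl.
Qed.

Lemma trunc_act1 : trunc_act 1 = \1%VF.
Proof. by apply/lfunP => r; rewrite trunc_actE id_lfunE mul1r. Qed.

Lemma trunc_actM q r : trunc_act (q * r) = (trunc_act q \o trunc_act r)%VF.
Proof. by apply/lfunP => s; rewrite comp_lfunE !trunc_actE mulrA. Qed.

Definition trunc_regular : module R := Module trunc_act_linear trunc_act1 trunc_actM.

Lemma tXp1_neq0 : t ^+ p.-1 != 0.
Proof.
apply/eqP => /(congr1 (fun q : R => q`_p.-1)).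
by rewrite coef_tXn ?ltn_predL // eqxx coef0 => /eqP; rewrite oner_eq0.
Qed.

Lemma mul_tXp1 (r : R) : r * t ^+ p.-1 = trunc_eps r *: t ^+ p.-1.
Proof.
rewrite -[r in LHS](subrK (trunc_eps r)%:A) -tX_shift // mulrDl mulr_algl.
by rewrite mulrAC -exprS prednK // tX_nilp // mul0r add0r.
Qed.

(* Such a module is free of rank one. *)
Lemma cyclic_projective (P : module R) (v : P) :
  \dim {:P} = p -> mod_act P (t ^+ p.-1) v != 0 -> projective P.
Proof.
move=> dimP v0; pose E := [tuple mod_act P (t ^+ i) v | i < p].
have nthE (i : 'I_p) : E`_i = mod_act P (t ^+ i) v.
  by rewrite -tnth_nth tnth_mktuple.
have Efree : free E.
  apply/freeP => c c0.
  have {}c0 : mod_act P (\sum_i c i *: t ^+ i) v = 0.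
    by rewrite mod_act_sum -[RHS]c0; apply: eq_bigr => i _; rewrite mod_actZ nthE.
  (* Induction on [i]: multiplying by [t^(p-1-i)] kills the later terms, and the earlier
     coefficients are already zero. *)
  suff cz n (i : 'I_p) : (i < n)%N -> c i = 0 by move=> i; apply: (cz p).
  elim: n i => [//|n IH] i; rewrite ltnS => ile.
  have := congr1 (mod_act P (t ^+ (p.-1 - i))) c0; rewrite linear0 -mod_actMv mulr_sumr.
  rewrite mod_act_sum (bigD1 i) //= big1 ?addr0 => [|j ji].
    rewrite -scalerAr -exprD subnK ?mod_actZ; last by rewrite -ltnS prednK.
    by move/eqP; rewrite scaler_eq0 (negPf v0) orbF => /eqP.
  have [ltji|leij] := ltnP j i.
    by rewrite IH ?scale0r ?mulr0 ?mod_act0 // (leq_trans ltji).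
  have ltij : (i < j)%N by rewrite ltn_neqAle leij andbT eq_sym.
  rewrite -scalerAr -exprD mod_actZ (_ : t ^+ _ = 0) ?mod_act0 ?scaler0 //.
  have le : (p <= p.-1 - i + j)%N.
    have il : (i <= p.-1)%N by rewrite -ltnS prednK.
    by rewrite -[X in (X <= _)%N](prednK p_gt0) -[X in (X.+1 <= _)%N](subnK il) -addnS leq_add2l.
  by rewrite -(subnK le) exprD tX_nilp // mulr0.
have Eb : basis_of {:P} E.
  by rewrite basisEfree Efree subvf size_tuple dimP /=.
have Pcyc w : exists r, w = mod_act P r v.
  rewrite (coord_basis Eb (memvf w)); exists (\sum_i coord E i w *: t ^+ i).
  by rewrite mod_act_sum; apply: eq_bigr => i _; rewrite mod_actZ nthE.
move=> M N q f qh fh q_surj; have [m0 qm0] := q_surj (f v).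
pose h (w : P) : M := \sum_i coord E i w *: mod_act M (t ^+ i) m0.
have hl : linear h.
  move=> c a b; rewrite /h scaler_sumr -big_split; apply: eq_bigr => i _ /=.
  by rewrite linearP scalerDl scalerA.
pose h' := HB.pack_for {linear P -> M} h (GRing.isLinear.Build K P M _ h hl).
have hE (r : R) : h (mod_act P r v) = mod_act M r m0.
  rewrite (trunc_sum p_gt2 r) !mod_act_sum -[LHS]/(h' _) linear_sum.
  apply: eq_bigr => i _; rewrite !mod_actZ linearZ /= -nthE; congr (_ *: _).
  rewrite /h (bigD1 i) //= coord_free // eqxx scale1r big1 ?addr0 // => j ji.
  by rewrite coord_free // eq_sym (negPf ji) scale0r.
exists (linfun h'); split=> [r w|w]; rewrite !lfunE /=.
  by have [s ->] := Pcyc w; rewrite -mod_actMv !hE mod_actMv.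
by have [s ->] := Pcyc w; rewrite hE qh qm0 -fh.
Qed.

End TruncModules.

Definition primitive (k : fieldType) (A : falgType k) (eps : {lrmorphism A -> k^o})
    (G : group_scheme eps) (a : A) : Prop :=
  comul G a = tpure a 1 + tpure 1 a.

Lemma linear_sum_fun (k : pzRingType) (U V : lmodType k) (h : U -> V) (I : Type)
    (r : seq I) (F : I -> U) : linear h ->
  h (\sum_(i <- r) F i) = \sum_(i <- r) h (F i).
Proof.
move=> hl; elim: r => [|i r IH].
  by rewrite !big_nil; have := hl (-1) 0 0; rewrite scaler0 addr0 scaleN1r addNr.
by rewrite !big_cons -IH -[F i]scale1r hl !scale1r.
Qed.

Section Balanced.
Variables (k : fieldType) (A : algType k) (M N : module A).

Lemma balanced0 : balanced (M := M) (N := N) 0.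
Proof. by exists [::]; rewrite big_nil. Qed.

Lemma balanced_lincomb c (X Y : tens M N) :
  balanced (M := M) (N := N) X -> balanced (M := M) (N := N) Y -> balanced (M := M) (N := N) (c *: X + Y).
Proof.
move=> [s ->] [s' ->]; exists ([seq (c *: r.1.1, r.1.2, r.2) | r <- s] ++ s').
rewrite big_cat big_map scaler_sumr; congr (_ + _); apply: eq_bigr => r _ /=.
have [pl _] := tpure_bilin M N.
have plZ u v : tpure (c *: u) v = c *: tpure u v :> tens M N.
  have pl0 : tpure 0 v = 0 :> tens M N.
    by have := pl v (-1) 0 0; rewrite scaler0 addr0 scaleN1r addNr.
  by have := pl v c u 0; rewrite addr0 pl0 addr0.
by rewrite linearZ /= !plZ scalerBr.
Qed.

Lemma balanced_sum (I : Type) (s : seq I) (F : I -> tens M N) :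
  (forall i, balanced (M := M) (N := N) (F i)) -> balanced (M := M) (N := N) (\sum_(i <- s) F i).
Proof.
move=> Fb; elim: s => [|i s IH]; first by rewrite big_nil; apply: balanced0.
by rewrite big_cons -[F i]scale1r; apply: balanced_lincomb.
Qed.

Lemma balanced_gen a m n :
  balanced (M := M) (N := N) (tpure (mod_act M a m) n - tpure m (mod_act N a n)).
Proof. by exists [:: (m, a, n)]; rewrite big_seq1. Qed.

Lemma balanced_opp (X : tens M N) : balanced (M := M) (N := N) X -> balanced (M := M) (N := N) (- X).
Proof. by move=> Xb; rewrite -[- X]addr0 -scaleN1r; apply: balanced_lincomb Xb balanced0. Qed.

End Balanced.

(** * The monomial basis, and flatness over the subalgebra generated by [x] *)

Section Monomials.
Variables (k : fieldType) (p : nat) (A : falgType k) (x y : A).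
Hypothesis pk : p \in [pchar k].
Hypothesis p_gt2 : (2 < p)%N.
Hypothesis xyP : trunc_gens p x y.
Local Notation R := (trunc_poly k p).
Local Notation t := (tX k p).

Let p_gt0 : (0 < p)%N. Proof. exact: ltnW (ltnW p_gt2). Qed.

(** As [A] is given by a universal property, non-vanishing has to be seen in a module. On the tensor
    product of [A/(y)] and [A/(x)], both copies of [k[t]/t^p], primitivity makes [x] act as
    [t (x) 1] and [y] as [1 (x) t]. *)
Lemma top_monomial_neq0 (eps : {lrmorphism A -> k^o}) (G : group_scheme eps) :
  primitive G x -> primitive G y -> x ^+ p.-1 * y ^+ p.-1 != 0.
Proof.
move=> xprim yprim.
have t0 : t * 0 = 0 * t by rewrite mulrC.
have zp : (0 : R) ^+ p = 0 by rewrite expr0n gtn_eqF.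
have [h1 [h1x h1y]] := tg_map xyP t0 (tX_nilp k p_gt2) zp.
have [h2 [h2x h2y]] := tg_map xyP (esym t0) zp (tX_nilp k p_gt2).
pose V1 := mod_pullback h1 (trunc_regular k p).
pose V2 := mod_pullback h2 (trunc_regular k p).
pose M := mod_tens G V1 V2.
have tpure0r (u : V1) : tpure u (0 : V2) = 0.
  have := (tpure_bilin V1 V2).2 u (-1) 0 0.
  by rewrite scaler0 addr0 scaleN1r addNr.
have tpure0l (v : V2) : tpure (0 : V1) v = 0.
  have := (tpure_bilin V1 V2).1 v (-1) 0 0.
  by rewrite scaler0 addr0 scaleN1r addNr.
have Mprim a (u : V1) (v : V2) : primitive G a ->
    mod_act M a (tpure u v) = tpure (h1 a * u : V1) v + tpure u (h2 a * v : V2).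
  move=> ap; rewrite -[mod_act M a]/(tens_act2 V1 V2 (comul G a)) ap.
  have -> X Y : tens_act2 V1 V2 (X + Y) = tens_act2 V1 V2 X + tens_act2 V1 V2 Y.
    by rewrite /tens_act2 linearD.
  by rewrite add_lfunE !tens_act2E !tmapE !mod_act1 !id_lfunE /= !trunc_actE.
have Mx u v : mod_act M x (tpure u v) = tpure (t * u : V1) v.
  by rewrite Mprim // h1x h2x mul0r tpure0r addr0.
have My u v : mod_act M y (tpure u v) = tpure u (t * v : V2).
  by rewrite Mprim // h1y h2y mul0r tpure0l add0r.
have Mxn n u v : mod_act M (x ^+ n) (tpure u v) = tpure (t ^+ n * u : V1) v.
  elim: n u v => [|n IH] u v; first by rewrite !expr0 mod_act1v mul1r.
  by rewrite !exprS mod_actMv IH Mx mulrA.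
have Myn n u v : mod_act M (y ^+ n) (tpure u v) = tpure u (t ^+ n * v : V2).
  elim: n u v => [|n IH] u v; first by rewrite !expr0 mod_act1v mul1r.
  by rewrite !exprS mod_actMv IH My mulrA.
apply/eqP => top0; have := mod_act0 (M := M) (tpure (1 : R) (1 : R)).
rewrite -top0 mod_actMv Myn Mxn !mulr1 => /eqP; apply/negP.
by apply: tpure_neq0; apply: tXp1_neq0.
Qed.

(** Lexicographic induction: multiplying by [x^(p-1-i) y^(p-1-j)] turns the term [(i, j)] into the
    top monomial, and every other term has a coefficient already known to be zero or an exponent at
    least [p]. *)
Lemma monomials_eq0 m : x ^+ p.-1 * y ^+ p.-1 != 0 -> monomials x y m = 0 -> m = 0 :> 'M[k]_p.
Proof.
move=> top0 m0; apply/matrixP => i j; rewrite mxE.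
have mulC := tg_mulC xyP.
have mulCA (a b c : A) : a * (b * c) = b * (a * c).
  by rewrite mulrA (mulC a) -mulrA.
have big_nilp (z : A) (a b : 'I_p) : z ^+ p = 0 -> (a < b)%N -> z ^+ (b + (p.-1 - a)) = 0.
  move=> zp ab; have le : (p <= b + (p.-1 - a))%N.
    have ap : (a <= p.-1)%N by rewrite -ltnS prednK.
    by rewrite addnC -[X in (X <= _)%N](prednK p_gt0) -[X in (X.+1 <= _)%N](subnK ap) -addnS leq_add2l.
  by rewrite -(subnK le) exprD zp mulr0.
have pred_addK (a : 'I_p) : (a + (p.-1 - a) = p.-1)%N.
  by rewrite subnKC // -ltnS prednK.
move: {1}(i : nat) (erefl (i : nat)) j => n; elim/ltn_ind: n i => n IHi i ni.
move=> j; move: {1}(j : nat) (erefl (j : nat)) => n'; elim/ltn_ind: n' j => n' IHj j nj.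
have : monomials x y m * (x ^+ (p.-1 - i) * y ^+ (p.-1 - j)) = 0 by rewrite m0 mul0r.
have termE a b : m a b *: (x ^+ a * y ^+ b) * (x ^+ (p.-1 - i) * y ^+ (p.-1 - j)) =
    m a b *: (x ^+ (a + (p.-1 - i)) * y ^+ (b + (p.-1 - j))).
  rewrite -scalerAl !exprD -!mulrA; congr (_ *: (_ * _)).
  exact: mulCA.
rewrite mulr_suml (bigD1 i) //= [X in _ + X]big1 ?addr0 => [|a ai].
  rewrite mulr_suml (bigD1 j) //= [X in _ + X]big1 ?addr0 => [|b bj].
    by rewrite termE !pred_addK => /eqP; rewrite scaler_eq0 (negPf top0) orbF => /eqP.
  rewrite termE; have [ltbj|lejb] := ltnP b j.
    by rewrite (IHj b) ?scale0r // nj.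
  by rewrite (big_nilp y) ?mulr0 ?scaler0 ?(tg_nilpy xyP) // ltn_neqAle lejb andbT eq_sym.
rewrite mulr_suml big1 // => b _; rewrite termE; have [ltai|leia] := ltnP a i.
  by rewrite (IHi a) ?scale0r // ni.
by rewrite (big_nilp x) ?mul0r ?scaler0 ?(tg_nilpx xyP) // ltn_neqAle leia andbT eq_sym.
Qed.

Hypothesis top0 : x ^+ p.-1 * y ^+ p.-1 != 0.

(** The powers of [y] form a basis of [A] over the subalgebra generated by [x]. So [N (x) A] over
    that subalgebra is a sum of [p] copies of [N], naturally in [N], with coordinates [tau N j];
    injectivity is checked coordinatewise. *)
Lemma trunc_free_flat (f : {lrmorphism R -> A}) : f t = x ->
  flat (mod_pullback f (mod_regular A)).
Proof.
move=> ft; set M := mod_pullback f (mod_regular A).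
have mulC := tg_mulC xyP.
pose T : 'Hom('M[k]_p, A) := linfun (@monomials k p A x y).
pose co (a : A) := (T^-1)%VF a.
have coK a : monomials x y (co a) = a.
  have [m ->] := monomials_surj xyP a.
  have : T ((T^-1)%VF (T m)) = T m by rewrite limg_lfunVK ?memv_img ?memvf.
  by rewrite !lfunE.
have Kco m : co (monomials x y m) = m.
  apply/eqP; rewrite -subr_eq0; apply/eqP; apply: monomials_eq0 => //.
  by rewrite linearB /= coK subrr.
pose c (j : 'I_p) (a : A) : R := \sum_i co a i j *: t ^+ i.
pose Th (w : 'I_p -> R) : A := \sum_j f (w j) * y ^+ j.
have fE (r : R) : f r = \sum_(i < p) r`_i *: x ^+ i.
  rewrite {1}(trunc_sum p_gt2 r) linear_sum; apply: eq_bigr => i _.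
  by rewrite linearZ /= (rmorphXn f) /= ft.
have ThE w : Th w = monomials x y (\matrix_(i, j) (w j)`_i).
  rewrite /monomials exchange_big; apply: eq_bigr => j _; rewrite fE mulr_suml.
  by apply: eq_bigr => i _; rewrite mxE -scalerAl.
have cTh w j : c j (Th w) = w j.
  rewrite /c ThE Kco [RHS](trunc_sum p_gt2); apply: eq_bigr => i _.
  by rewrite mxE.
have Thc a : Th (c^~ a) = a.
  rewrite -[RHS]coK ThE; congr monomials; apply/matrixP => i j; rewrite mxE /c coefn_sum.
  rewrite (bigD1 i) //= big1 ?addr0 => [|l li]; rewrite coefZ coef_tXn //.
    by rewrite eqxx mulr1.
  by rewrite [_ == _]negbTE ?mulr0 // eq_sym.
have cM r a j : c j (f r * a) = r * c j a.
  rewrite -[a in LHS]Thc -[RHS](cTh (fun j => r * c j a)); congr c.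
  by rewrite /Th mulr_sumr; apply: eq_bigr => l _; rewrite rmorphM mulrA.
have c_lin j : linear (c j).
  move=> e a b; rewrite /c scaler_sumr -big_split; apply: eq_bigr => i _ /=.
  by rewrite /co linearP !mxE scalerDl scalerA.
have tauB (N : module R) j : bilin (fun (n : N) (a : M) => mod_act N (c j a) n).
  split=> [a e n n'|n e a a']; first by rewrite linearP.
  by rewrite c_lin mod_actD mod_actZ.
pose tau (N : module R) j (X : tens N M) : N := tlift (fun (n : N) (a : M) => mod_act N (c j a) n) X.
have tauK (N : module R) j X : balanced (M := N) (N := M) X -> tau N j X = 0.
  move=> [s ->]; rewrite /tau linear_sum big1 // => r _.
  rewrite linearB /= !tliftE //; apply/eqP; rewrite subr_eq0; apply/eqP.
  by rewrite -mod_actMv lfunE /= cM mulrC.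
have tau_nat (N N' : module R) (h : 'Hom(N', N)) j X : mod_hom h ->
    tau N j (tmap h \1%VF X) = h (tau N' j X).
  move=> hh; rewrite /tau tlift_tmap // linear_tlift; apply: eq_tlift => n a.
  by rewrite id_lfunE; apply: esym (hh _ _).
(* Each tensor is congruent to one rebuilt from its coordinates, so it is balanced as soon as they
   all vanish. *)
have tau_rep (N : module R) X : balanced (M := N) (N := M)
    (X - \sum_j tpure (tau N j X) (y ^+ j : M)).
  have [pl pr] := tpure_bilin N M.
  have pureP n a : balanced (M := N) (N := M)
      (tpure n a - \sum_j tpure (tau N j (tpure n a)) (y ^+ j : M)).
    rewrite -{1}(Thc a) /Th (linear_sum_fun _ _ (pr n)) -sumrB; apply: balanced_sum => j.
    rewrite /tau tliftE // -opprB; apply: balanced_opp.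
    have -> : f (c j a) * y ^+ j = mod_act M (c j a) (y ^+ j : M) by rewrite /= lfunE.
    exact: balanced_gen.
  pose phi X := X - \sum_j tpure (tau N j X) (y ^+ j : M).
  have phi_lin : linear phi.
    move=> e Y Z; rewrite /phi scalerBr scaler_sumr addrACA -opprD -big_split /=.
    congr (_ - _); apply: eq_bigr => j _.
    by rewrite /tau linearP pl.
  rewrite -/(phi X) [X in phi X]tens_sumE (linear_sum_fun _ _ phi_lin).
  apply: balanced_sum => i; rewrite (linear_sum_fun _ _ phi_lin); apply: balanced_sum => j.
  have phi0 : phi 0 = 0.
    by have := phi_lin (-1) 0 0; rewrite scaler0 addr0 scaleN1r addNr.
  rewrite -[_ *: _]addr0 phi_lin phi0; apply: balanced_lincomb; last exact: balanced0.
  exact: pureP.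
move=> N' N h hh h_inj X /tauK tau0.
have := tau_rep N' X; rewrite big1 ?subr0 // => j _.
suff -> : tau N' j X = 0.
  have := (tpure_bilin N' M).1 (y ^+ j) (-1) 0 0.
  by rewrite scaler0 addr0 scaleN1r addNr.
by apply: h_inj; rewrite linear0 -tau_nat.
Qed.

End Monomials.

(** * Arbitrary pi-points *)

Section Flatness.
Variables (K : fieldType) (p : nat) (B : falgType K).
Hypothesis p_gt2 : (2 < p)%N.
Local Notation R := (trunc_poly K p).
Local Notation t := (tX K p).
Variable f : {lrmorphism R -> B}.

Definition aug_act (q : R) : 'End(K^o) := trunc_eps q *: \1%VF.

Lemma aug_act_linear : linear aug_act.
Proof. by move=> c q r; rewrite /aug_act trunc_eps_lin scalerDl scalerA. Qed.

Lemma aug_act1 : aug_act 1 = \1%VF.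
Proof. by rewrite /aug_act trunc_eps1 ?scale1r. Qed.

Lemma aug_actM q r : aug_act (q * r) = (aug_act q \o aug_act r)%VF.
Proof.
apply/lfunP => c; rewrite comp_lfunE /aug_act !scale_lfunE !id_lfunE.
by rewrite trunc_epsM // scalerA.
Qed.

Definition aug_module : module R := Module aug_act_linear aug_act1 aug_actM.

(* Tensor the embedding of the trivial module as the socle of [K[t]/t^p]. *)
Lemma flat_kernel a : flat (mod_pullback f (mod_regular B)) ->
  f t ^+ p.-1 * a = 0 -> exists b, a = f t * b.
Proof.
set M := mod_pullback f (mod_regular B) => f_flat a0.
pose h (c : K^o) : trunc_regular K p := c *: t ^+ p.-1.
have hl : linear h by move=> c u v; rewrite /h scalerDl scalerA.
pose h' : 'Hom(aug_module, trunc_regular K p) := linfun (HB.pack_for {linear K^o -> trunc_regular K p} h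
  (GRing.isLinear.Build K K^o (trunc_regular K p) _ h hl)).
have h'E c : h' c = c *: t ^+ p.-1 by rewrite lfunE.
have hh : mod_hom h'.
  move=> r c; rewrite !h'E /= trunc_actE /aug_act scale_lfunE id_lfunE.
  by rewrite -scalerAr mul_tXp1 // scalerA mulrC.
have h_inj : injective h'.
  move=> c d; rewrite !h'E => /eqP; rewrite -subr_eq0 -scalerBl scaler_eq0.
  by rewrite (negPf (tXp1_neq0 K p_gt2)) orbF subr_eq0 => /eqP.
(* The embedding sends [1 (x) a] to the class of [t^(p-1) (x) a], which equals that of
   [1 (x) f(t)^(p-1) a = 0]; flatness pulls this back. *)
have : balanced (M := aug_module) (N := M) (tpure (1 : K^o) a).
  apply: (f_flat _ _ _ hh h_inj); rewrite tmapE h'E id_lfunE scale1r.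
  have := balanced_gen (M := trunc_regular K p) (N := M) (t ^+ p.-1) (1 : R) a.
  rewrite /= trunc_actE mulr1 lfunE /= rmorphXn a0.
  have -> : tpure (1 : R) (0 : B) = 0.
    have := (tpure_bilin (trunc_poly K p) B).2 1 (-1) 0 0.
    by rewrite scaler0 addr0 scaleN1r addNr.
  by rewrite subr0.
move=> [s sE].
have LB : bilin (fun (c : K^o) (b : B) => c *: b).
  split=> [b c u v|c e u v]; first by rewrite scalerDl scalerA.
  by rewrite scalerDr !scalerA mulrC.
have := congr1 (tlift (fun (c : K^o) (b : B) => c *: b)) sE.
rewrite tliftE // scale1r linear_sum /= => ->.
(* Scalar multiplication identifies [K (x) B] over [K[t]/t^p] with the quotient of [B] by [f t]:
   modulo [f t], the element [f q] is the scalar [trunc_eps q]. *)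
suff : \sum_(r <- s) tlift (fun (c : K^o) (b : B) => c *: b)
    (tpure (mod_act aug_module r.1.2 r.1.1) r.2 - tpure r.1.1 (mod_act M r.1.2 r.2))
    \in limg (amull (f t)).
  by move=> /memv_imgP[b _ ->]; exists b; rewrite lfunE.
apply: memv_suml => r _; rewrite linearB /= !tliftE //.
have fE (q : R) : f q = f t * f (trunc_shift q) + (trunc_eps q)%:A.
  rewrite -{1}[q](subrK (trunc_eps q)%:A) -tX_shift // linearD /= rmorphM.
  by rewrite linearZ /= rmorph1.
rewrite /aug_act scale_lfunE id_lfunE lfunE /= (fE r.1.2) mulrDl mulr_algl scalerDr.
rewrite -[trunc_eps _ *: r.1.1]/(trunc_eps r.1.2 * r.1.1) scalerA [X in X *: _ - _]mulrC.
rewrite opprD addrCA subrr addr0.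
apply/memv_imgP; exists (- (r.1.1 *: (f (trunc_shift r.1.2) * r.2))); rewrite ?memvf //.
by rewrite lfunE /= mulrN -scalerAr mulrA.
Qed.

End Flatness.

Section GeneralPiPoint.
Variables (k : fieldType) (p : nat) (A : falgType k) (x y : A).
Hypothesis pk : p \in [pchar k].
Hypothesis p_gt2 : (2 < p)%N.
Hypothesis xyP : trunc_gens p x y.
Variables (eps : {lrmorphism A -> k^o}) (G : group_scheme eps).
Variable alpha : pi_point p G.

Local Notation K := (ext_field alpha).
Local Notation B := (ext_alg alpha).
Local Notation j := (ext_map alpha).
Local Notation epsB := (ext_eps alpha).
Local Notation u := (pi_elt alpha).

Let p_gt0 : (0 < p)%N. Proof. exact: ltnW (ltnW p_gt2). Qed.

Lemma ext_mulC (a b : B) : a * b = b * a.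
Proof.
have [c ->] := base_change_span (ext_basis alpha) a.
have [d ->] := base_change_span (ext_basis alpha) b.
rewrite !mulr_suml; under eq_bigr => i _ do rewrite mulr_sumr.
rewrite exchange_big /=; apply: eq_bigr => i _; rewrite mulr_sumr.
apply: eq_bigr => l _; rewrite -!scalerAl -!scalerAr !scalerA mulrC.
by rewrite -!(rmorphM j) (tg_mulC xyP).
Qed.

Lemma pchar_ext : p \in [pchar K].
Proof. exact: rmorph_pchar (ext_in alpha) _ pk. Qed.

Lemma ext_x_nilp : j x ^+ p = 0.
Proof. by rewrite -rmorphXn (tg_nilpx xyP) rmorph0. Qed.

Lemma ext_y_nilp : j y ^+ p = 0.
Proof. by rewrite -rmorphXn (tg_nilpy xyP) rmorph0. Qed.

Lemma ext_x_eps : epsB (j x) = 0.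
Proof. exact: (eps_nilp (aug_lin epsB) (aug1 epsB) (augM epsB) ext_x_nilp). Qed.

Lemma ext_y_eps : epsB (j y) = 0.
Proof. exact: (eps_nilp (aug_lin epsB) (aug1 epsB) (augM epsB) ext_y_nilp). Qed.

Lemma ext_decomp (b : B) : exists r s, b = (epsB b)%:A + j x * r + j y * s.
Proof.
suff [c [r [s bE]]] : exists c r s, b = c%:A + j x * r + j y * s.
  exists r, s; rewrite [LHS]bE; congr (_%:A + _ + _).
  by rewrite bE !augD !augM aug_scalar ext_x_eps ext_y_eps !mul0r !addr0.
have [d ->] := base_change_span (ext_basis alpha) b.
elim/big_rec: _ => [|i a _ [c [r [s ->]]]].
  by exists 0, 0, 0; rewrite scale0r !mulr0 !addr0.
have [c' [r' [s' ->]]] := tg_decomp xyP (vbasis {:A})`_i.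
exists (d i * ext_in alpha c' + c), (d i *: j r' + r), (d i *: j s' + s).
rewrite !linearD (rmorphM j) (rmorphM j) linearZ /= rmorph1.
by rewrite !mulrDr -!scalerAr scalerA scalerDl addrACA [X in X + _ = _]addrACA.
Qed.

Lemma ext_nilp (b : B) : epsB b = 0 -> b ^+ p = 0.
Proof.
move=> b0; have [r [s ->]] := ext_decomp b; rewrite b0 scale0r add0r.
rewrite exprDn_comm_pchar ?pchar_lalg ?pchar_ext //; last exact: ext_mulC.
rewrite !exprMn_comm ?ext_x_nilp ?ext_y_nilp ?mul0r ?addr0 //; exact: ext_mulC.
Qed.

Lemma trunc_quotient : exists h : {lrmorphism A -> trunc_poly k p}, h x = tX k p /\ h y = 0.
Proof.
apply: (tg_map xyP); first by rewrite mulrC.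
  exact: tX_nilp.
by rewrite expr0n gtn_eqF.
Qed.

Lemma tg_eps (h : {lrmorphism A -> trunc_poly k p}) : h x = tX k p -> h y = 0 ->
  forall a, trunc_eps (h a) = eps a.
Proof.
move=> hx hy a; have [c [r [s ->]]] := tg_decomp xyP a.
have e0 : trunc_eps (0 : trunc_poly k p) = 0 by rewrite /trunc_eps coef0.
have ex : eps x = 0 := eps_nilp (aug_lin eps) (aug1 eps) (augM eps) (tg_nilpx xyP).
have ey : eps y = 0 := eps_nilp (aug_lin eps) (aug1 eps) (augM eps) (tg_nilpy xyP).
rewrite !augD !augM aug_scalar ex ey !mul0r !addr0.
rewrite !linearD linearZ /= rmorph1 !(rmorphM h) /= hx hy mul0r addr0.
have := trunc_eps_lin c (1 : trunc_poly k p) (tX k p * h r) => ->.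
rewrite trunc_epsM // trunc_eps1 // mulr1.
rewrite (_ : trunc_eps (tX k p) = 0) ?mul0r ?addr0 //.
by rewrite /trunc_eps -[tX k p]expr1 coef_tXn.
Qed.

(** Pulled back along the quotient map from [A] to [A/(y)], a copy of [k[t]/t^p]. *)
Lemma x_cocycle n : exists2 f, cocycle eps n f &
  (n = 1%N -> f [:: x] = 1) /\ (n = 2%N -> f (pcyc p x 2) = 1).
Proof.
have [h [hx hy]] := trunc_quotient.
exists (fun s => trunc_eps (trunc_cmp (map h s))).
  apply: (cocycle_comp (F := fun s => trunc_eps (trunc_cmp s)) (tg_eps hx hy)).
  exact: cocycle_trunc_cmp.
split=> _.
  by rewrite /= hx mulr1 /trunc_htpy /= trunc_shift_tX // trunc_eps1.
have -> : map h (pcyc p x 2) = pcyc p (tX k p) 2.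
  by rewrite /= /pdiff /= (rmorphXn h) /= hx.
by rewrite trunc_cmp_pcyc2 // trunc_eps1.
Qed.

(** A cocycle of degree 1 is a derivation into the trivial module; this one reads off the
    coefficient of [x] in the linear part. *)
Lemma x_derivation : exists D : B -> K,
  [/\ forall a b, D (a * b) = epsB a * D b + D a * epsB b,
      forall a b, D (a + b) = D a + D b & D (j x) = 1].
Proof.
have [f fc [/(_ erefl) fx _]] := x_cocycle 1.
have Fc := cocycle_ext_cochain (ext_basis alpha) (ext_eps_map alpha) fc.
have [/cochainP fm _] := fc; have [/cochainP Fm Fd] := Fc.
have Fx := ext_cochainE (ext_basis alpha) fm (erefl : size [:: x] = 1%N).
rewrite fx rmorph1 in Fx; move: (ext_cochain j f) {Fc} Fm Fd Fx => F Fm Fd Fx.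
exists (fun b => F [:: b]); split=> // a b; last exact: (multilinear_add (V := K^o) _ _ Fm).
have := Fd [:: a; b] erefl; rewrite bar_diffE /= => /eqP.
by rewrite opprB addrA subr_eq0 => /eqP ->.
Qed.

Lemma pi_elt_decomp : exists c1 c2, u = j x * c1 + j y * c2.
Proof.
have [r [s uE]] := ext_decomp u; exists r, s.
by rewrite {1}uE pi_elt_eps // scale0r add0r.
Qed.

(** The [n]-th power of the augmentation ideal, through its generators [j x] and [j y]. *)
Fixpoint in_augX (n : nat) (b : B) : Prop :=
  if n is n'.+1 then
    exists b1 b2, [/\ in_augX n' b1, in_augX n' b2 & b = j x * b1 + j y * b2]
  else True.

Lemma in_augX_mull n a b : in_augX n b -> in_augX n (a * b).
Proof.
elim: n b => //= n IH b [b1 [b2 [h1 h2 ->]]].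
exists (a * b1), (a * b2); split; try exact: IH.
by rewrite mulrDr !mulrA ![a * j _]ext_mulC.
Qed.

Lemma in_augXM m n a b : in_augX m a -> in_augX n b -> in_augX (m + n) (a * b).
Proof.
elim: m a => [|m IH] a; first by move=> _; apply: in_augX_mull.
move=> [a1 [a2 [h1 h2 ->]]] hb; exists (a1 * b), (a2 * b); split; try exact: IH.
by rewrite mulrDl !mulrA.
Qed.

Lemma in_augXX m n a : in_augX m a -> in_augX (n * m) (a ^+ n).
Proof.
by move=> ha; elim: n => // n IH; rewrite exprS mulSn; apply: in_augXM.
Qed.

Lemma in_aug1 a : epsB a = 0 -> in_augX 1 a.
Proof.
by move=> a0; have [r [s ->]] := ext_decomp a; exists r, s; rewrite a0 scale0r add0r.
Qed.

(** A monomial in [x] and [y] of degree at least [2p - 1] has an exponent at least [p]. The prefix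
    with exponents [l] and [m] collects the factors during the induction. *)
Lemma in_augX_kill n b l m : in_augX n b -> (p.*2 <= (l + m + n).+1)%N ->
  j x ^+ l * j y ^+ m * b = 0.
Proof.
elim: n b l m => [|n IH] b l m.
  rewrite addn0 => _ le; have [lp|pl] := ltnP l p; last first.
    by rewrite -(subnK pl) exprD ext_x_nilp mulr0 !mul0r.
  have pm : (p <= m)%N.
    by rewrite -(leq_add2l p) addnn (leq_trans le) // -addSn leq_add2r.
  by rewrite -(subnK pm) exprD ext_y_nilp !mulr0 mul0r.
move=> [b1 [b2 [h1 h2 ->]]] le.
have Ex : j x ^+ l * j y ^+ m * (j x * b1) = j x ^+ l.+1 * j y ^+ m * b1.
  by rewrite exprSr mulrA -[_ * _ * j x]mulrA [j y ^+ m * j x]ext_mulC !mulrA.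
have Ey : j x ^+ l * j y ^+ m * (j y * b2) = j x ^+ l * j y ^+ m.+1 * b2.
  by rewrite exprSr !mulrA.
by rewrite mulrDr Ex Ey !IH ?addr0 //; rewrite !(addSn, addnS) in le *.
Qed.

(* If [u] were in the square of the augmentation ideal, its [p-1]-st power would
   be killed by the ideal, so [x] would be a multiple of [u]. *)
Lemma pi_elt_x_neq0 c1 c2 : u = j x * c1 + j y * c2 -> epsB c2 = 0 -> epsB c1 != 0.
Proof.
move=> uE c20; apply/eqP => c10.
have u_kill : u ^+ p.-1 * j x = 0.
  (* The degree is [2(p-1) + 1 = 2p - 1], just beyond the top monomial. *)
  have ux : in_augX (p.-1 * 2 + 1) (u ^+ p.-1 * j x).
    apply: in_augXM; last by apply: in_aug1; apply: ext_x_eps.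
    by apply: in_augXX; exists c1, c2; split=> //; apply: in_aug1.
  have := in_augX_kill (l := 0) (m := 0) ux; rewrite !expr0 !mul1r; apply.
  by rewrite addn1 muln2 -!doubleS prednK.
have [b xE] := flat_kernel p_gt2 (@pi_flat _ _ _ _ _ alpha) u_kill.
have [D [DM DD Dx]] := x_derivation.
(* As [D] vanishes on the square of the augmentation ideal, it kills [u] and then the multiple [x]
   of [u]. *)
have : D (j x) = 0.
  rewrite xE DM -/u pi_elt_eps // mul0r add0r uE DD !DM.
  by rewrite ext_x_eps ext_y_eps c10 c20 !mul0r !mulr0 !addr0 mul0r.
by rewrite Dx => /eqP; rewrite oner_eq0.
Qed.

(** An element of augmentation zero is nilpotent, so [y c2] is dropped by [cocycle_pcyc_add], and
    [c1] is then pulled out as a scalar. *)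
Lemma pi_value_x c1 c2 n f : u = j x * c1 + j y * c2 -> epsB c2 = 0 ->
  cocycle eps n f -> ~~ odd n ->
  pi_value alpha n f = epsB c1 ^+ (p * n./2) * ext_in alpha (f (pcyc p x n)).
Proof.
move=> uE c20 fc n_even.
have Fc := cocycle_ext_cochain (ext_basis alpha) (ext_eps_map alpha) fc.
have [/cochainP fm _] := fc.
have c1xp : (c1 * j x) ^+ p = 0.
  by apply: ext_nilp; rewrite augM ext_x_eps mulr0.
rewrite /pi_value uE [j x * _]ext_mulC [j y * _]ext_mulC.
rewrite (cocycle_pcyc_add (aug_lin epsB) (aug1 epsB) (augM epsB) pchar_ext p_gt2 ext_mulC
  c1xp ext_y_nilp (ext_nilp c20) Fc).
rewrite (cocycle_pcyc_mul (aug_lin epsB) (aug1 epsB) (augM epsB) p_gt2 ext_mulC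
  c1 ext_x_nilp n_even Fc); congr (_ * _).
have -> : pcyc p (j x) n = map j (pcyc p x n).
  elim: (n) => //= m IH; rewrite /pcyc /= -/(pcyc _ _ _) IH; congr (_ :: _).
  by rewrite /pdiff; case: (odd m); rewrite ?rmorphXn.
by rewrite (ext_cochainE (ext_basis alpha) fm) // size_cyc.
Qed.

(** The point of the pi-point [t |-> x] in closed form, over [k] itself. *)
Definition x_point n (f : seq A -> k) : Prop :=
  cocycle eps n f /\ (odd n \/ f (pcyc p x n) = 0).

Lemma pi_ideal_x c1 c2 : u = j x * c1 + j y * c2 -> epsB c2 = 0 ->
  same_point x_point (pi_ideal alpha).
Proof.
move=> uE c20 n f; have c10 := pi_elt_x_neq0 uE c20.
rewrite (pi_idealP p_gt2 ext_mulC); split=> -[fc f0]; (split; first exact: fc).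
  case: (boolP (odd n)) f0 => n_odd [] // f0; try by left.
  by right; rewrite (pi_value_x uE) // f0 rmorph0 mulr0.
case: (boolP (odd n)) f0 => n_odd [] // f0; try by left.
right; move: f0; rewrite (pi_value_x uE) // => /eqP; rewrite mulf_eq0 expf_eq0.
by rewrite (negPf c10) andbF fmorph_eq0 => /eqP.
Qed.

End GeneralPiPoint.

Section ModuleExtension.
Variables (k : fieldType) (A : falgType k) (eps : {lrmorphism A -> k^o}).
Variables (G : group_scheme eps) (E : extension G) (V : module A).
Variable MK : mod_extension E V.

Lemma mod_extension_span (m : MK) :
  exists d : 'I_(\dim {:V}) -> ext_field E, m = \sum_i d i *: mext_map MK (vbasis {:V})`_i.
Proof.
have /= := coord_basis (X := [tuple of map (mext_map MK) (vbasis {:V})]) (mext_basis MK) (memvf m).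
set X := [tuple of _] => mE; exists (fun i => coord X i m).
by rewrite {1}mE; apply: eq_bigr => i _; rewrite (nth_map 0) // size_tuple.
Qed.

Lemma mod_extension_eq0 (v : V) : mext_map MK v = 0 -> v = 0.
Proof.
rewrite {1}(coord_vbasis (memvf v)) linear_sum => v0.
pose X := [tuple of map (mext_map MK) (vbasis {:V})].
have Xfree : free X := basis_free (mext_basis MK).
have {}v0 : \sum_(i < \dim {:V}) ext_in E (coord (vbasis {:V}) i v) *: X`_i = 0.
  rewrite -[RHS]v0; apply: eq_bigr => i _.
  by rewrite linearZ /= (nth_map 0) // size_tuple.
rewrite (coord_vbasis (memvf v)) big1 // => i _.
have := coord_sum_free (fun i : 'I_(\dim {:V}) => ext_in E (coord (vbasis {:V}) i v)) i Xfree.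
rewrite v0 linear0 => /esym/eqP; rewrite fmorph_eq0 => /eqP ->.
by rewrite scale0r.
Qed.

Lemma dim_mod_extension : \dim {:MK} = \dim {:V}.
Proof.
have := mext_basis MK => /[dup] /span_basis <- /basis_free.
by rewrite /free => /eqP ->; rewrite size_map size_tuple.
Qed.

End ModuleExtension.

Section ProjectiveRestriction.
Variables (k : fieldType) (p : nat) (A : falgType k) (x y : A).
Hypothesis pk : p \in [pchar k].
Hypothesis p_gt2 : (2 < p)%N.
Hypothesis xyP : trunc_gens p x y.
Variables (eps : {lrmorphism A -> k^o}) (G : group_scheme eps).
Variables (h : {lrmorphism A -> trunc_poly k p}) (c : k).
Hypotheses (hx : h x = c *: tX k p ^+ 2) (hy : h y = tX k p).
Variable alpha : pi_point p G.
Local Notation V := (mod_pullback h (trunc_regular k p)).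
Variable MK : mod_extension alpha V.

Local Notation B := (ext_alg alpha).
Local Notation j := (ext_map alpha).
Local Notation epsB := (ext_eps alpha).

Let p_gt0 : (0 < p)%N. Proof. exact: ltnW (ltnW p_gt2). Qed.

Lemma mext_actE a (v : trunc_poly k p) :
  mod_act MK (j a) (mext_map MK (v : V)) = mext_map MK (h a * v : V).
Proof. by rewrite -mext_act /= trunc_actE. Qed.

Lemma ext_act_x m : mod_act MK (j x) m = mod_act MK (ext_in alpha c *: j y ^+ 2) m.
Proof.
have [d ->] := mod_extension_span m; rewrite !linear_sum; apply: eq_bigr => i _.
rewrite !linearZ /=; congr (_ *: _); rewrite mod_actZ.
rewrite -(rmorphXn j) !mext_actE hx (rmorphXn h) /= hy -scalerAl.
exact: linearZ.
Qed.

(** On this module [x] acts as a multiple of [y^2], so [y^(p-1)] annihilates the whole augmentation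
    ideal. *)
Lemma ext_act_top (b : B) m :
  mod_act MK (j y ^+ p.-1 * b) m = epsB b *: mod_act MK (j y ^+ p.-1) m.
Proof.
have [r [s {1}->]] := ext_decomp xyP b.
have mulC := ext_mulC xyP (alpha := alpha).
rewrite !mulrDr !mod_actD -scalerAr mulr1 mod_actZ !mulrA -exprSr prednK //.
rewrite (ext_y_nilp xyP) mul0r mod_act0 addr0.
rewrite [j y ^+ _ * j x]mulC -mulrA mod_actMv ext_act_x -mod_actMv.
rewrite -scalerAl mulrA -exprD addSn add1n prednK // exprS (ext_y_nilp xyP) mulr0 mul0r.
by rewrite scaler0 mod_act0 addr0.
Qed.

(** Here [u] acts as [y w] with [eps w = eps c2] nonzero, so [u^(p-1)] moves the vector [1] to a
    nonzero multiple of [t^(p-1)]; in dimension [p] this makes the restriction free of rank one. *)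
Lemma restriction_projective c1 c2 : pi_elt alpha = j x * c1 + j y * c2 ->
  epsB c2 != 0 -> projective (mod_pullback (pi_map alpha) MK).
Proof.
move=> uE c20; pose w := ext_in alpha c *: j y * c1 + c2.
have mulC := ext_mulC xyP (alpha := alpha).
have uact m : mod_act MK (pi_elt alpha) m = mod_act MK (j y * w) m.
  rewrite uE mod_actD mod_actMv ext_act_x -mod_actMv -mod_actD /w mulrDr.
  by rewrite expr2 -!scalerAl -scalerAr mulrA.
have unact n m : mod_act MK (pi_elt alpha ^+ n) m = mod_act MK ((j y * w) ^+ n) m.
  by elim: n m => [|n IH] m; rewrite ?expr0 // !exprS !mod_actMv IH uact mod_actMv.
have epsw : epsB w = epsB c2.
  by rewrite /w augD augM linearZ /= (ext_y_eps xyP) scaler0 mul0r add0r.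
pose v0 := mext_map MK (1 : trunc_poly k p).
apply: (@cyclic_projective _ _ p_gt2 (mod_pullback (pi_map alpha) MK) v0).
  by rewrite dim_mod_extension dim_polyn mk_monic_trunc // size_polyXn.
rewrite /= (rmorphXn (pi_map alpha)) unact exprMn_comm; last exact: mulC.
rewrite ext_act_top (epsX (aug1 epsB) (augM epsB)).
rewrite epsw scaler_eq0 expf_eq0 (negPf c20) andbF /= -(rmorphXn j) mext_actE mulr1.
rewrite (rmorphXn h) /= hy; apply: contraTneq isT => /mod_extension_eq0 /eqP.
by rewrite (negPf (tXp1_neq0 k p_gt2)).
Qed.

End ProjectiveRestriction.

(** * The noble point *)

Section TruncEval.
Variables (k : fieldType) (p : nat) (A : algType k) (x : A).
Hypothesis p_gt2 : (2 < p)%N.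
Hypothesis xp : x ^+ p = 0.
Local Notation R := (trunc_poly k p).

Lemma trunc_eval_ex : exists f : {lrmorphism R -> A}, f (tX k p) = x.
Proof.
pose f (q : R) : A := horner_alg x q.
have fl : linear f.
  move=> c q r; have := linearP (horner_alg x) c (q : {poly k}) (r : {poly k}).
  by rewrite /= mulr_algl.
have fM : monoid_morphism f.
  split=> [|q r]; first exact: (rmorph1 (horner_alg x)).
  have -> : f (q * r) = horner_alg x (take_poly p ((q : {poly k}) * r)).
    by congr horner_alg; apply/polyP => i; rewrite coef_take_poly coef_truncM.
  rewrite /f -rmorphM.
  rewrite -[in RHS](poly_take_drop p ((q : {poly k}) * r)) rmorphD rmorphM rmorphXn /=.
  by rewrite horner_algX xp mulr0 addr0.
exists (HB.pack_for {lrmorphism R -> A} f (GRing.isLinear.Build k R A _ f fl)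
  (GRing.isMonoidMorphism.Build R A f fM)).
by rewrite /= /f tXE // horner_algX.
Qed.

End TruncEval.

Section TrivialExtension.
Variables (k : fieldType) (A : falgType k) (eps : {lrmorphism A -> k^o}).
Variable G : group_scheme eps.

(** The identity under its own name, so that it can carry the structure of a map semilinear over the
    identity of [k]. *)
Definition trivial_map (a : A) : A := a.

Lemma trivial_map_linear : linear_for ((idfun : {rmorphism k -> k}) \; *:%R) trivial_map.
Proof. by []. Qed.

Lemma trivial_map_monoid : monoid_morphism trivial_map.
Proof. by []. Qed.

Definition trivial_lrmorphism : {lrmorphism A -> A | (idfun : {rmorphism k -> k}) \; *:%R} :=
  HB.pack_for {lrmorphism A -> A | (idfun : {rmorphism k -> k}) \; *:%R} trivial_map
    (GRing.isLinear.Build k A A ((idfun : {rmorphism k -> k}) \; *:%R) trivial_map trivial_map_linear)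
    (GRing.isMonoidMorphism.Build A A trivial_map trivial_map_monoid).

Lemma trivial_basis : basis_of {:A} (map trivial_lrmorphism (vbasis {:A})).
Proof. by rewrite map_id_in //; apply: vbasisP. Qed.

Lemma trivial_comul a : comul G (trivial_lrmorphism a) =
  \sum_i \sum_j (idfun : {rmorphism k -> k}) (comul G a i j) *:
      tpure (trivial_lrmorphism (vbasis {:A})`_i) (trivial_lrmorphism (vbasis {:A})`_j).
Proof. exact: tens_sumE. Qed.

Definition trivial_extension : extension G :=
  @Extension k A eps G k idfun A trivial_lrmorphism trivial_basis eps (fun=> erefl) G
    trivial_comul (fun=> erefl).

End TrivialExtension.

Section PrimitivePoint.
Variables (k : fieldType) (p : nat) (A : falgType k) (x y : A).
Hypothesis pk : p \in [pchar k].
Hypothesis p_gt2 : (2 < p)%N.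
Hypothesis xyP : trunc_gens p x y.
Variables (eps : {lrmorphism A -> k^o}) (G : group_scheme eps).
Hypotheses (xprim : primitive G x) (yprim : primitive G y).
Local Notation R := (trunc_poly k p).
Local Notation t := (tX k p).
Variable f : {lrmorphism R -> A}.
Hypothesis ft : f t = x.

Let p_gt0 : (0 < p)%N. Proof. exact: ltnW (ltnW p_gt2). Qed.
Local Notation S := (limg (linfun f)).

Lemma mem_limgP a : reflect (exists q, a = f q) (a \in S).
Proof.
apply: (iffP memv_imgP) => [[q _ ->]|[q ->]]; first by exists q; rewrite lfunE.
by exists q; rewrite ?memvf // lfunE.
Qed.

Lemma limg1 : 1 \in S.
Proof. by apply/mem_limgP; exists 1; rewrite rmorph1. Qed.

Lemma limgM a b : a \in S -> b \in S -> a * b \in S.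
Proof.
by move=> /mem_limgP[q ->] /mem_limgP[r ->]; apply/mem_limgP; exists (q * r); rewrite rmorphM.
Qed.

Lemma limg_x n : x ^+ n \in S.
Proof. by apply/mem_limgP; exists (t ^+ n); rewrite (rmorphXn f) /= ft. Qed.

Lemma limg_sum q : f q = \sum_(i < p) q`_i *: x ^+ i.
Proof.
rewrite {1}(trunc_sum p_gt2 q) linear_sum; apply: eq_bigr => i _.
by rewrite linearZ /= (rmorphXn f) /= ft.
Qed.

Lemma tens_subP (T : {vspace A}) a b : a \in T -> b \in T -> tpure a b \in tens_sub T.
Proof.
move=> Ta Tb; have [pl pr] := tpure_bilin A A.
rewrite (coord_vbasis Ta) (coord_vbasis Tb) (bilin_sum _ _ _ _ (tpure_bilin A A)).
apply: memv_suml => i _; apply: memv_suml => j _; apply: memvZ; apply: memv_span.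
by apply/allpairsP; exists ((vbasis T)`_i, (vbasis T)`_j); rewrite /= !mem_nth ?size_tuple.
Qed.

(** Only the triangular shape of the binomial expansion is recorded: a leading term [x^n (x) 1], and
    lower powers of [x] on the left elsewhere. This is what the recursion for the antipode uses. *)
Lemma comul_primitive_exp n : exists b : nat -> A,
  [/\ forall i, b i \in S, b n = 1, forall i, (n < i)%N -> b i = 0 &
      comul G (x ^+ n) = \sum_(i < n.+1) tpure (x ^+ i) (b i)].
Proof.
have [pl pr] := tpure_bilin A A; have [ml mr] := tmul_bilin A.
have tpure0 a : tpure a (0 : A) = 0 :> tens A A.
  by have := pr a (-1) 0 0; rewrite scaler0 addr0 scaleN1r addNr.
have tpureD a b c : tpure a (b + c) = tpure a b + tpure a c :> tens A A.
  by have := pr a 1 b c; rewrite !scale1r.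
elim: n => [|n [b [Sb bn b0 E]]].
  exists (fun i => if i is 0 then 1 else 0); split=> [[|i]||[]|] //.
  - exact: limg1.
  - exact: mem0v.
  by rewrite big_ord1 expr0 comul1.
exists (fun i => (if i is i'.+1 then b i' else 0) + x * b i); split.
- move=> i; apply: memvD; first by case: i => [|i]; rewrite ?mem0v.
  by apply: limgM => //; have := limg_x 1; rewrite expr1.
- by rewrite bn b0 // mulr0 addr0.
- by case=> // i ni; rewrite !b0 ?mulr0 ?addr0 // ltnW.
rewrite exprS comulM xprim E (linear_sum_fun _ _ (mr _)).
transitivity (\sum_(i < n.+1) (tpure (x ^+ i.+1) (b i) + tpure (x ^+ i) (x * b i))).
  apply: eq_bigr => i _.
  have := ml (tpure (x ^+ i) (b i)) 1 (tpure x 1) (tpure 1 x).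
  by rewrite !scale1r !tmulE mul1r mul1r -exprS.
rewrite big_split /= [RHS](eq_bigr (fun i : 'I_n.+2 =>
  tpure (x ^+ i) (if i : nat is i'.+1 then b i' else 0) + tpure (x ^+ i) (x * b i))); last by move=> i _; rewrite tpureD.
rewrite big_split /= [X in _ = X + _]big_ord_recl /= tpure0 add0r.
by rewrite [X in _ = _ + X]big_ord_recr /= (b0 n.+1) // mulr0 tpure0 addr0.
Qed.

(** The antipode axiom at [x^n] can be solved for the leading term, expressing it by the antipodes
    of lower powers. *)
Lemma limg_antipode_exp n : antipode G (x ^+ n) \in S.
Proof.
elim/ltn_ind: n => n IH; have [b [Sb bn b0 E]] := comul_primitive_exp n.
have SB : bilin (fun a b : A => antipode G a * b).
  split=> [v c u u'|u c v v']; first by rewrite linearP mulrDl -scalerAl.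
  by rewrite mulrDr -scalerAr.
have := antipodel G (x ^+ n); rewrite E linear_sum /= big_ord_recr /= !tliftE // bn mulr1.
move/(canRL (addKr _)) => ->; apply: memvD; last by rewrite memvZ ?limg1.
rewrite memvN; apply: memv_suml => i _; rewrite tliftE //.
by apply: limgM; [exact: IH | exact: Sb].
Qed.

Lemma limg_hopf : hopf_subalgebra G S.
Proof.
split; [exact: limg1 | exact: limgM | |].
  move=> _ /mem_limgP[q ->]; rewrite limg_sum linear_sum memv_suml // => i _.
  rewrite linearZ /= memvZ //; have [b [Sb _ _ ->]] := comul_primitive_exp i.
  by apply: memv_suml => l _; apply: tens_subP; [exact: limg_x | exact: Sb].
move=> _ /mem_limgP[q ->]; rewrite limg_sum linear_sum memv_suml // => i _.
by rewrite linearZ memvZ //; apply: limg_antipode_exp.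
Qed.

Lemma limg_unipotent : unipotent_subgroup eps S.
Proof.
move=> M rho [m m0] rho1 rhoM.
have x0 : eps x = 0 := eps_nilp (aug_lin eps) (aug1 eps) (augM eps) (tg_nilpx xyP).
have Sx : x \in S by have := limg_x 1; rewrite expr1.
(* The last nonzero vector among [m], [x m], [x^2 m], and so on. *)
have [m' m'0 xm'] : exists2 m', m' != 0 & rho x m' = 0.
  have : rho (x ^+ p) m = 0 by rewrite (tg_nilpx xyP) linear0 lfunE.
  elim: (p) m m0 => [|n IH] m m0; first by rewrite expr0 rho1 id_lfunE => /eqP; rewrite (negPf m0).
  rewrite exprSr rhoM ?limg_x // comp_lfunE => xm.
  by have [xm0|xm0] := eqVneq (rho x m) 0; [exists m | exact: IH xm].
exists m' => // _ /mem_limgP[q ->].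
rewrite limg_sum !linear_sum /= sum_lfunE scaler_suml; apply: eq_bigr => i _.
rewrite !linearZ /= scale_lfunE; case: (nat_of_ord i) => [|n].
  by rewrite expr0 rho1 id_lfunE rmorph1 /GRing.scale /= mulr1.
rewrite exprSr rhoM ?limg_x // comp_lfunE xm' linear0 scaler0.
by rewrite [eps _]augM x0 mulr0 scaler0 scale0r.
Qed.

Lemma limg_unip_ex : exists T : {vspace A},
  [/\ hopf_subalgebra G T, abelian_subgroup T, unipotent_subgroup eps T & (S <= T)%VS].
Proof.
exists S; split; [exact: limg_hopf | | exact: limg_unipotent | exact: subvv].
by move=> a b _ _; apply: (tg_mulC xyP).
Qed.

Definition primitive_point : pi_point p G :=
  @PiPoint p k A eps G (trivial_extension G) f
    (trunc_free_flat p_gt2 xyP (top_monomial_neq0 p_gt2 xyP xprim yprim) ft) limg_unip_ex.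

Lemma primitive_point_x : same_point (x_point p x eps) (pi_ideal primitive_point).
Proof.
apply: (pi_ideal_x pk p_gt2 xyP (c1 := 1) (c2 := 0)); last exact: linear0.
by rewrite /pi_elt /= mulr1 mulr0 addr0 ft.
Qed.

Lemma x_point_noble : noble p G (x_point p x eps).
Proof. by exists primitive_point; split; [exact: primitive_point_x | exact: limg_hopf]. Qed.

End PrimitivePoint.

(** * Closedness *)

Section CocycleFacts.
Variables (k : fieldType) (A : algType k) (eps : {lrmorphism A -> k^o}).
Implicit Types (f g : seq A -> k).

Lemma eq_bar_diff n f g s : size s = n.+1 -> (forall r, size r = n -> f r = g r) ->
  bar_diff eps f s = bar_diff eps g s.
Proof.
case: s => // a s [ss] e; rewrite !bar_diffE e //; congr (_ - _).
by apply: eq_bar_tail; rewrite ss.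
Qed.

Lemma eq_cocycle n f g : (forall s, size s = n -> f s = g s) ->
  cocycle eps n f -> cocycle eps n g.
Proof.
move=> e [/cochainP fm fd]; split; first by apply/cochainP; apply: (@multilinear_ext _ _ k^o _ _ _ e fm).
by move=> s ss; rewrite -(eq_bar_diff ss e) fd.
Qed.

Lemma cocycle_lincomb n c f g : cocycle eps n f -> cocycle eps n g ->
  cocycle eps n (fun s => c * f s + g s).
Proof.
move=> [/cochainP fm fd] [/cochainP gm gd]; split.
  by apply/cochainP; apply: (multilinear_lincomb (V := k^o)).
case=> // a s ss; have := fd _ ss; have := gd _ ss; rewrite !bar_diffE => g0 f0.
rewrite bar_tail_lincomb -[RHS](_ : c * 0 + 0 = 0); last by rewrite mulr0 addr0.
by rewrite -{1}f0 -g0; ring.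
Qed.

Lemma coboundary_cocycle n f : coboundary eps n f -> cocycle eps n f.
Proof.
case: n => [|n] /=.
  by move=> f0; split=> [|[|a []] // _]; [exact/cochainP | rewrite bar_diffE /= f0 mulr0 mul0r subrr].
move=> [g /cochainP gm fE]; split.
  apply/cochainP; apply: (@multilinear_ext _ _ k^o _ (bar_diff eps g)) => [s /fE //|].
  exact: (multilinear_bar_diff (aug_lin eps)).
move=> s ss; rewrite (eq_bar_diff ss fE) bar_diff_diff ?ss //.
exact: augM.
Qed.

End CocycleFacts.

Section ClosedPoint.
Variables (k : fieldType) (p : nat) (A : falgType k) (x y : A).
Hypothesis p_gt2 : (2 < p)%N.
Hypothesis xyP : trunc_gens p x y.
Variable eps : {lrmorphism A -> k^o}.
Hypothesis pk : p \in [pchar k].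

Local Notation P := (x_point p x eps).

(** For two odd degrees the product has even degree, so its value must be shown to vanish; it does
    because the cut leaves a shifted cycle. *)
Lemma x_point_cup m n f g : cocycle eps m f -> cocycle eps n g ->
  P m f \/ P n g -> P (m + n)%N (cup m f g).
Proof.
move=> fc gc fg; split; first exact: cocycle_cup.
rewrite oddD; case: (boolP (odd n)) => n_odd.
  rewrite addbT; case: (boolP (odd m)) => m_odd; last by left.
  right; rewrite cup_pcyc_odd //.
  rewrite (cocycle_pcyc_odd (aug_lin eps) (aug1 eps) (augM eps) p_gt2 (tg_mulC xyP)
    (tg_nilpx xyP) m_odd fc) mul0r //.
rewrite addbF; case: (boolP (odd m)) => m_odd; first by left.
right; rewrite cup_pcyc //.
by case: fg => [[_]|[_]]; rewrite ?(negPf m_odd) ?(negPf n_odd) => -[] // ->; rewrite ?mul0r ?mulr0.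
Qed.

Lemma x_point_proj : proj_point eps P.
Proof.
have xC : complex eps (pdiff p x).
  exact (complex_pdiff (aug_lin eps) (aug1 eps) (augM eps) p_gt2 (tg_nilpx xyP)).
split.
- by move=> n f [].
- move=> n f fb; split; first exact: coboundary_cocycle.
  by right; apply: coboundary_cyc xC fb.
- move=> n f g h [fc f0] [gc g0] hE; split.
    apply: (eq_cocycle (f := fun s => 1 * f s + g s)); last exact: cocycle_lincomb.
    by move=> s /hE ->; rewrite mul1r.
  case: f0 => [|f0]; first by left.
  case: g0 => [|g0]; first by left.
  by right; rewrite hE ?size_cyc // f0 g0 addr0.
- by move=> m n f g fc gP; apply: x_point_cup; [| exact: gP.1 | right].
- by move=> m n f g fP gc; apply: x_point_cup; [exact: fP.1 | | left].
- move=> m n f g fc gc [_].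
  case: (boolP (odd m)) => m_odd; first by move=> _; left; split=> //; left.
  case: (boolP (odd n)) => n_odd; first by move=> _; right; split=> //; left.
  rewrite oddD (negPf m_odd) (negPf n_odd) => -[//|/eqP].
  rewrite cup_pcyc // mulf_eq0 => /orP[] /eqP; first by left; split=> //; right.
  by right; split=> //; right.
have [f fc [_ /(_ erefl) f1]] := x_cocycle p_gt2 xyP eps 2.
exists 2%N, f; split=> // -[_ [//|]].
by rewrite f1 => /eqP; rewrite oner_eq0.
Qed.

Lemma proj_point_ext Q n f g : proj_point eps Q -> Q n f ->
  (forall s, size s = n -> f s = g s) -> Q n g.
Proof.
move=> QP Qf e; apply: (pt_add QP (f := f) (g := fun=> 0) Qf); last first.
  by move=> s ss; rewrite addr0 e.
apply: (pt_coboundary QP); case: n {Qf e} => //= n.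
exists (fun=> 0); first exact/cochainP/(multilinear_cst0 _ k^o).
by case=> // a s _; rewrite bar_diffE bar_tail_0 mulr0 subrr.
Qed.

Lemma proj_point_cupX Q m f n : proj_point eps Q -> cocycle eps m f ->
  Q (n * m)%N (cupX m f n) -> Q m f.
Proof.
move=> QP fc; elim: n => [|n IH] Qn.
  (* The zeroth power is the unit class, so [Q] contains everything, in particular [f] times the
     unit. *)
  rewrite mul0n in Qn; have := pt_mull QP fc Qn; rewrite addn0 => Qf.
  apply: (proj_point_ext QP Qf) => s ss.
  by rewrite /cup mulr1 take_oversize // ss.
have [//|/IH //] := pt_prime QP fc (cocycle_cupX n fc) Qn.
Qed.

(* Modulo [P], any two classes of positive degree have proportional powers. *)
Lemma x_point_closed : closed_point eps P.
Proof.
split; first exact: x_point_proj.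
move=> Q QP PQ n g; split; last exact: PQ.
move=> Qg; have gc := pt_cocycle QP Qg; split=> //.
case: (boolP (odd n)) => n_odd; [by left | right].
have [g0|g0] := eqVneq (g (pcyc p x n)) 0; first by [].
have [m [f [m0 fc Qf]]] := pt_relevant QP.
case: (boolP (odd m)) => m_odd.
  by case: Qf; apply: PQ; split=> //; left.
have [f0|f0] := eqVneq (f (pcyc p x m)) 0.
  by case: Qf; apply: PQ; split=> //; right.
case: Qf; apply: (proj_point_cupX (n := n)) => //.
have Qgm : Q (m * n)%N (cupX n g m).
  by case: m m0 {fc m_odd f0} => // m _; apply: (pt_mulr QP) => //; apply: cocycle_cupX.
(* The scalar for which [f^n - e g^m] has value zero, so lies in [P] and hence in [Q]. With [g] in
   [Q] this forces [f] into [Q], against its choice. *)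
pose e := f (pcyc p x m) ^+ n / g (pcyc p x n) ^+ m.
have Qeg := pt_mull QP (cocycle_const eps e) Qgm; rewrite add0n mulnC in Qeg.
have gmc := cocycle_cupX m gc; rewrite mulnC in gmc.
have fnc := cocycle_cupX n fc.
have QD : Q (n * m)%N (fun s => (- e) * cupX n g m s + cupX m f n s).
  apply: PQ; split; first exact: cocycle_lincomb.
  right; rewrite (cupX_pcyc _ _ _ n m_odd) mulnC (cupX_pcyc _ _ _ m n_odd) /e.
  by rewrite mulNr divfK ?expf_neq0 // addNr.
apply: (pt_add QP QD Qeg) => s _.
by rewrite /cup drop0; ring.
Qed.

End ClosedPoint.

(** * Support and the counterexample *)

Section Support.
Variables (k : fieldType) (p : nat) (A : falgType k) (x y : A).
Hypothesis pk : p \in [pchar k].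
Hypothesis p_gt2 : (2 < p)%N.
Hypothesis xyP : trunc_gens p x y.
Variables (eps : {lrmorphism A -> k^o}) (G : group_scheme eps).

Lemma supported_at_x (h : {lrmorphism A -> trunc_poly k p}) c :
  h x = c *: tX k p ^+ 2 -> h y = tX k p ->
  supported_at p G (x_point p x eps) (mod_pullback h (trunc_regular k p)).
Proof.
move=> hx hy Q [alpha [Qalpha [MK MKnproj]]] n f; rewrite Qalpha.
have [c1 [c2 uE]] := pi_elt_decomp p_gt2 xyP alpha.
have [c20|c20] := eqVneq (ext_eps alpha c2 : ext_field alpha) 0.
  by rewrite (pi_ideal_x pk p_gt2 xyP uE c20).
by case: MKnproj; apply: (restriction_projective p_gt2 xyP hx hy uE c20).
Qed.

End Support.

Section Difference.
Variables (k : fieldType) (p : nat) (A : falgType k).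
Hypothesis p_gt2 : (2 < p)%N.
Variables (eps : {lrmorphism A -> k^o}) (G G' : group_scheme eps) (x y : A).
Hypotheses (xG : comul G x = tpure x 1 + tpure 1 x + tpure y y) (xG' : primitive G' x).
Variable h : {lrmorphism A -> trunc_poly k p}.
Hypotheses (hx : h x = 0) (hy : h y = tX k p).
Local Notation V := (mod_pullback h (trunc_regular k p)).

Lemma tens_not_iso : ~ mod_iso (mod_tens G V V) (mod_tens G' V V).
Proof.
move=> [f [fhom /bij_inj f_inj]].
have tpure0r (v : V) : tpure v (0 : V) = 0.
  by have := (tpure_bilin V V).2 v (-1) 0 0; rewrite scaler0 addr0 scaleN1r addNr.
have tpure0l (v : V) : tpure (0 : V) v = 0.
  by have := (tpure_bilin V V).1 v (-1) 0 0; rewrite scaler0 addr0 scaleN1r addNr.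
have tactD X Y : tens_act2 V V (X + Y) = tens_act2 V V X + tens_act2 V V Y.
  by rewrite /tens_act2 linearD.
have x0 (v : V) : mod_act V x v = 0 by rewrite /= hx trunc_actE mul0r.
have G'0 X : mod_act (mod_tens G' V V) x X = 0.
  move: X; apply: tens_ext => [c X Y|c X Y|v w]; first by rewrite linearP.
    by rewrite scaler0 addr0.
  rewrite -[mod_act _ x]/(tens_act2 V V (comul G' x)) xG' tactD add_lfunE !tens_act2E !tmapE.
  by rewrite !x0 tpure0l tpure0r addr0.
(* Only the cross term [y (x) y] of the coproduct survives, because [x] acts as zero on [V]. *)
have Gx : mod_act (mod_tens G V V) x (tpure (1 : trunc_poly k p) (1 : trunc_poly k p)) =
    tpure (tX k p : V) (tX k p : V).
  rewrite -[mod_act _ x]/(tens_act2 V V (comul G x)) xG !tactD !add_lfunE !tens_act2E !tmapE.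
  by rewrite !x0 tpure0l tpure0r !add0r /= hy trunc_actE mulr1.
have := fhom x (tpure (1 : trunc_poly k p) (1 : trunc_poly k p)).
rewrite G'0 Gx -(linear0 f) => /f_inj/eqP; apply/negP.
have t0 : tX k p != 0.
  apply/eqP => t0; have := tXp1_neq0 k p_gt2.
  by rewrite t0 expr0n; case: p p_gt2 => [|[|q]] //=; rewrite eqxx.
exact: tpure_neq0.
Qed.

End Difference.

Lemma noble_counterexample (k : fieldType) (p : nat) (g : restrictedLie k p)
    (A : envelope g) : p \in [pchar k] -> (2 < p)%N -> \dim {:g} = 2%N ->
    (forall x y : g, lie_br x y = 0) -> (forall x : g, lie_pmap x = 0) ->
  exists (G : group_scheme (env_eps A)) (P : nat -> (seq A -> k) -> Prop)
      (V W : module A),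
    [/\ closed_point (env_eps A) P, noble p G P,
        supported_at p G P V, supported_at p G P W & ~ same_tens G V W].
Proof.
move=> pk p_gt2 dimg br0 pmap0.
have [z [w xyP]] := envelope_trunc_gens A pk dimg br0 pmap0.
set x := env_in A z in xyP; set y := env_in A w in xyP.
have xprim : primitive (env_std A) x := env_std_prim A z.
have yprim : primitive (env_std A) y := env_std_prim A w.
pose c : k := 2%:R^-1; pose X := x + (- c) *: y ^+ 2.
have c2 : c *+ 2 = 1.
  rewrite -mulr_natr mulVf //; apply/negP => /eqP two0.
  have : (2 \in [pchar k])%N by rewrite inE /= two0 eqxx.
  by rewrite (pcharf_eq pk) inE => /eqP p2; move: p_gt2; rewrite -p2.
(* Both [X, y] and [x + c y^2, y] are generating pairs of the same kind; the resulting endomorphisms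
   [phi] and [psi] are inverse to each other. *)
have XyP : trunc_gens p X y := tg_shift pk xyP (- c) p_gt2.
have [phi [phix phiy]] := tg_map xyP (tg_comm XyP) (tg_nilpx XyP) (tg_nilpy XyP).
have X'yP : trunc_gens p (x + c *: y ^+ 2) y := tg_shift pk xyP c p_gt2.
have [psi [psix psiy]] := tg_map xyP (tg_comm X'yP) (tg_nilpx X'yP) (tg_nilpy X'yP).
have phiy2 : phi (y ^+ 2) = y ^+ 2 by rewrite rmorphXn /= phiy.
have psiy2 : psi (y ^+ 2) = y ^+ 2 by rewrite rmorphXn /= psiy.
have psiX : psi X = x.
  by rewrite /X linearD linearZ /= psix psiy2 scaleNr addrK.
have phiK : cancel phi psi.
  move=> a; apply: (tg_uniq xyP (h := psi \o phi) (h' := idfun)).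
    by rewrite /= phix.
  by rewrite /= phiy.
have psiK : cancel psi phi.
  move=> a; apply: (tg_uniq xyP (h := phi \o psi) (h' := idfun)).
    by rewrite /= psix linearD linearZ /= phix phiy2 /X scaleNr subrK.
  by rewrite /= psiy.
have eps_phi a : env_eps A (phi a) = env_eps A a.
  apply: (tg_uniq xyP (h := env_eps A \o phi) (h' := env_eps A)).
    rewrite /= phix /X linearD linearZ /= rmorphXn /= !env_eps_in.
    by rewrite expr0n /= scaler0 addr0.
  by rewrite /= phiy.
have [G GE] : exists G : group_scheme (env_eps A), forall a,
    comul G a = tmap (linfun phi) (linfun phi) (comul (env_std A) (psi a)).
  by exists (twist (env_std A) phiK psiK eps_phi) => a; apply: twist_comulE.
have GX : primitive G X.
  by rewrite /primitive GE psiX xprim linearD /= !tmapE !lfunE /= phix rmorph1.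
have Gy : primitive G y.
  by rewrite /primitive GE psiy yprim linearD /= !tmapE !lfunE /= phiy rmorph1.
have Gx : comul G x = tpure x 1 + tpure 1 x + tpure y y.
  have xE : x = X + c *: y ^+ 2 by rewrite /X scaleNr subrK.
  have [pl pr] := tpure_bilin A A; have [ml mr] := tmul_bilin A.
  have mD (P Q R : tens A A) : tmul (P + Q) R = tmul P R + tmul Q R.
    by have := ml R 1 P Q; rewrite !scale1r.
  have mDr (P Q R : tens A A) : tmul R (P + Q) = tmul R P + tmul R Q.
    by have := mr R 1 P Q; rewrite !scale1r.
  have -> : tpure x (1 : A) = c *: tpure (y ^+ 2) (1 : A) + tpure X (1 : A).
    by rewrite -(pl 1 c) /= addrC -xE.
  have -> : tpure (1 : A) x = c *: tpure (1 : A) (y ^+ 2) + tpure (1 : A) X.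
    by rewrite -(pr 1 c) /= addrC -xE.
  rewrite [in LHS]xE linearD linearZ /= GX expr2 comulM Gy mD !mDr !tmulE.
  rewrite !mulr1 !mul1r !scalerDr.
  (* The square of [y (x) 1 + 1 (x) y] contains [y (x) y] twice, and [c] is one half. *)
  have yyE : tpure y y = c *: tpure y y + c *: tpure y y.
    by rewrite -scalerDl -mulr2n c2 scale1r.
  rewrite [Z in _ = _ + Z]yyE.
  move: (c *: tpure (y * y) 1) (c *: tpure y y) (c *: tpure 1 (y * y)) (tpure X 1) (tpure 1 X) => a b d e f.
  by rewrite [b + d]addrC [a + b + _]addrACA [a + e]addrC [d + f]addrC [e + a + _]addrACA; apply: addrA.
have [f ft] := trunc_eval_ex p_gt2 (tg_nilpx XyP).
have [h [hx hy]] : exists h : {lrmorphism A -> trunc_poly k p}, h x = 0 /\ h y = tX k p.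
  apply: (tg_map xyP); rewrite ?mulr0 ?mul0r ?tX_nilp //.
  by rewrite expr0n gtn_eqF // ltnW // ltnW.
(* In terms of the generators [X, y] of the new structure, [V] has the shape required by
   [supported_at_x]. *)
have hX : h X = (- c) *: tX k p ^+ 2.
  by rewrite /X linearD linearZ /= hx rmorphXn /= hy add0r.
pose V := mod_pullback h (trunc_regular k p).
have VP : supported_at p G (x_point p X (env_eps A)) V.
  exact: (supported_at_x pk p_gt2 XyP hX hy).
exists G, (x_point p X (env_eps A)), V, V; split=> //.
- exact: (x_point_closed p_gt2 XyP (env_eps A)).
- exact: (x_point_noble pk p_gt2 XyP GX Gy ft).
- exact: (tens_not_iso p_gt2 Gx xprim hx hy).
Qed.

Theorem theorem1p1p3 (k : closedFieldType) (p : nat) (hp : p \in [pchar k])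
    (g : restrictedLie k p) (hdim : \dim {:g} = 2%N)
    (hab : forall x y : g, lie_br x y = 0)
    (hres : forall x : g, lie_pmap x = 0)
    (hp2 : (2 < p)%N) (A : envelope g) :
  [/\ ~ property_PA A,
      exists (G : group_scheme (env_eps A)) (P : nat -> (seq A -> k) -> Prop)
        (V W : module A),
        [/\ closed_point (env_eps A) P, noble p G P,
            supported_at p G P V, supported_at p G P W & ~ same_tens G V W] &
      ~ property_PC A].
Proof.
have ex := noble_counterexample A hp hp2 hdim hab hres.
have nPA : ~ property_PA A.
  by case: ex => G [P [V [W [Pc Pn VP WP VW]]]] PA; apply: VW; apply: (PA G P).
by split=> // -[].
Qed.
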